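(* Let $T$ be an interval exchange map of Roth type and let $r\ge1$ be an integer. For every $\Phi\in\mathrm{BV}^r_*(I)$ there exist $\chi\in\Gamma_*(r)$ and $\Psi\in C^{r-2+Lip}(I)$ such that $$\Phi=\chi+\Psi\circ T-\Psi .$$
   Context: Interval exchange map: alphabet $\mathcal A$ with $d\ge2$ letters, admissible combinatorial data $\pi_0,\pi_1:\mathcal A\to\{1,\dots,d\}$ (bijections with $\pi_0^{-1}(\{1,\dots,k\})\neq\pi_1^{-1}(\{1,\dots,k\})$ for $1\le k<d$), lengths $\lambda\in(0,\infty)^{\mathcal A}$, $\lambda^*=\sum\lambda_\alpha$, $I=[0,\lambda^* )$, $I_\alpha=[0,\lambda_\alpha)\times\{\alpha\}$, $j_\varepsilon(x,\alpha)=x+\sum_{\pi_\varepsilon(\beta)<\pi_\varepsilon(\alpha)}\lambda_\beta$, $T=j_1\circ j_0^{-1}$. Roth type: $T$ has the Keane property (no $(\alpha,\beta,m)$ with $\pi_0(\beta)>1$, $m\ge1$, $T^m(j_0(0,\alpha))=j_0(0,\beta)$) and satisfies (a),(b),(c) below. Rauzy–Veech step: with $\pi_0(\alpha_0)=\pi_1(\alpha_1)=d$, $\lambda_{\alpha_\varepsilon}>\lambda_{\alpha_{1-\varepsilon}}$, pass to the first return map of $T$ to $[0,\lambda^*-\lambda_{\alpha_{1-\varepsilon}})$, an i.e.m. with $\hat\lambda_{\alpha_\varepsilon}=\lambda_{\alpha_\varepsilon}-\lambda_{\alpha_{1-\varepsilon}}$, other lengths unchanged, $\hat\pi_\varepsilon=\pi_\varepsilon$,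 $\hat\pi_{1-\varepsilon}(\alpha)=\pi_{1-\varepsilon}(\alpha)$ if $\pi_{1-\varepsilon}(\alpha)\le\pi_{1-\varepsilon}(\alpha_\varepsilon)$, $\pi_{1-\varepsilon}(\alpha)+1$ if $\pi_{1-\varepsilon}(\alpha_\varepsilon)<\pi_{1-\varepsilon}(\alpha)<d$, $\pi_{1-\varepsilon}(\alpha_\varepsilon)+1$ if $\pi_{1-\varepsilon}(\alpha)=d$; name $\alpha_\varepsilon$; matrix $V=\mathbf I+E_{\alpha_\varepsilon\alpha_{1-\varepsilon}}$; iterating gives $V^{[n]}$. $n(0)=0$, $n(k+1)$ largest integer such that steps $n(k)<n\le n(k+1)$ have at most $d-1$ distinct names; $Z(k)=V^{[n(k-1)+1]}\cdots V^{[n(k)]}$, $Q(k,l)=Z(k+1)\cdots Z(l)$, $Q(l)=Q(0,l)$; $\|M\|$ sum of absolute values of entries; $S(k,l)$ linear map of $\mathbb R^{\mathcal A}$ with matrix ${}^tQ(k,l)$, $S(l)=S(0,l)$. (a) $\forall\varepsilon>0\exists C_\varepsilon$: $\|Z(k+1)\|\le C_\varepsilon\|Q(k)\|^\varepsilon$ $\forall k$. (b) With $\Gamma_*=\{v:\sum\lambda_\alpha v_\alpha=0\}$, $\exists\theta,C>0$: $\|S(k)|_{\Gamma_*}\|\le C\|Q(k)\|^{1-\theta}$ $\forall k$. (c) With $\Gamma^{(k)}_s=\{v:\exists\sigma,C>0,\ \|S(k,l)v\|\le C\|S(k,l)\|^{-\sigma}\|v\|\ \forall l\ge k\}$ (a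 subspace, mapped onto $\Gamma^{(l)}_s$ by $S(k,l)$) and $S_\flat(k,l)$ the induced isomorphism of quotients: $\forall\varepsilon>0\exists C_\varepsilon$: $\|S_\flat(k,l)^{-1}\|\le C_\varepsilon\|Q(l)\|^\varepsilon$ and $\|S(k,l)|_{\Gamma_s^{(k)}}\|\le C_\varepsilon\|Q(l)\|^\varepsilon$ for $0\le k\le l$. Function spaces: $\Gamma(r)$ = functions on $I$ whose restriction to each $j_0(I_\alpha)$ is a polynomial of degree $<r$. $\mathrm{BV}^r_*(I)$ = functions $\Phi:I\to\mathbb R$ such that for each $\alpha$, $\Phi$ is $C^{r-1}$ on $j_0(I_\alpha)$, $D^{r-1}\Phi$ is absolutely continuous on $j_0(I_\alpha)$ and $D^r\Phi$ is of bounded variation on $j_0(I_\alpha)$, and such that each $D^l\Phi$, $0<l\le r$, has mean value $0$ on $I$ (discontinuities at endpoints of the $j_0(I_\alpha)$ are allowed). $\Gamma_*(r)=\Gamma(r)\cap\mathrm{BV}^r_*(I)$. $C^{r-2+Lip}(I)$ = functions of class $C^{r-2}$ on all of $I$ whose $(r-2)$-th derivative is Lipschitz on $I$; for $r=1$ it is the space of bounded functions on $I$. *)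

(* Defs.v *)
From HB Require Import structures.
From mathcomp Require Import all_boot all_order all_algebra.
From mathcomp Require Import all_classical all_reals all_analysis.
Set Implicit Arguments. Unset Strict Implicit. Unset Printing Implicit Defensive.
Import Order.TTheory GRing.Theory Num.Theory.
Import numFieldNormedType.Exports.
Local Open Scope classical_set_scope.
Local Open Scope ring_scope.

Section IEM.
Variables (R : realType) (A : finType).

Definition comb_bij (p : A -> nat) : Prop :=
  injective p /\ forall a, (1 <= p a <= #|A|)%N.

Definition admissible (pi0 pi1 : A -> nat) : Prop :=
  comb_bij pi0 /\ comb_bij pi1 /\
  forall k : nat, (1 <= k)%N -> (k < #|A|)%N ->
    [set a : A | (pi0 a <= k)%N] != [set a : A | (pi1 a <= k)%N].

Definition left_end (p : A -> nat) (lam : A -> R) (a : A) : R :=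
  \sum_(b : A | (p b < p a)%N) lam b.

Definition lamstar (lam : A -> R) : R := \sum_(a : A) lam a.

(* T = j1 o j0^{-1} on I = [0, lamstar) (identity outside I) *)
Definition iem (pi0 pi1 : A -> nat) (lam : A -> R) (x : R) : R :=
  x + \sum_(a : A | (left_end pi0 lam a <= x) && (x < left_end pi0 lam a + lam a))
        (left_end pi1 lam a - left_end pi0 lam a).

Definition keane (pi0 pi1 : A -> nat) (lam : A -> R) : Prop :=
  ~ exists (a b : A) (m : nat), (1 < pi0 b)%N /\ (1 <= m)%N /\
      iter m (iem pi0 pi1 lam) (left_end pi0 lam a) = left_end pi0 lam b.

Record rv_state := RVState { st_pi0 : A -> nat; st_pi1 : A -> nat; st_lam : A -> R }.

Definition rv_newpi (p : A -> nat) (w : A) (a : A) : nat :=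
  if (p a <= p w)%N then p a
  else if (p a < #|A|)%N then (p a).+1 else (p w).+1.

Definition rv_newlam (lam : A -> R) (w l : A) (a : A) : R :=
  if a == w then lam w - lam l else lam a.

(* (winner alpha_eps, loser alpha_{1-eps}) of the Rauzy-Veech step *)
Definition rv_wl (s : rv_state) : option (A * A) :=
  match [pick a | st_pi0 s a == #|A|], [pick a | st_pi1 s a == #|A|] with
  | Some a0, Some a1 =>
      if st_lam s a1 < st_lam s a0 then Some (a0, a1) else Some (a1, a0)
  | _, _ => None
  end.

Definition rv_step (s : rv_state) : rv_state :=
  match [pick a | st_pi0 s a == #|A|], [pick a | st_pi1 s a == #|A|] with
  | Some a0, Some a1 =>
      if st_lam s a1 < st_lam s a0 then
        RVState (st_pi0 s) (rv_newpi (st_pi1 s) a0) (rv_newlam (st_lam s) a0 a1)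
      else
        RVState (rv_newpi (st_pi0 s) a1) (st_pi1 s) (rv_newlam (st_lam s) a1 a0)
  | _, _ => s
  end.

Definition rv_seq (s : rv_state) (n : nat) : rv_state := iter n rv_step s.

Definition rv_name (s : rv_state) (n : nat) : option A :=
  omap fst (rv_wl (rv_seq s n.-1)).

Definition mat := A -> A -> R.
Definition mat_id : mat := fun a b => (a == b)%:R.
Definition mat_mul (M N : mat) : mat := fun a c => \sum_(b : A) M a b * N b c.
Definition mat_norm (M : mat) : R := \sum_(a : A) \sum_(b : A) `|M a b|.
Definition vec_norm (v : A -> R) : R := \sum_(a : A) `|v a|.
Definition tapply (M : mat) (v : A -> R) : A -> R := fun a => \sum_(b : A) M b a * v b.

Definition rv_V (s : rv_state) (n : nat) : mat :=
  match rv_wl (rv_seq s n.-1) with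
  | Some (w, l) => fun a b => (a == b)%:R + ((a == w) && (b == l))%:R
  | None => mat_id
  end.

Fixpoint prodV (s : rv_state) (m n : nat) : mat :=
  match n with
  | 0 => mat_id
  | n'.+1 => if (m <= n')%N then mat_mul (prodV s m n') (rv_V s n'.+1) else mat_id
  end.

Definition n_names (s : rv_state) (m N : nat) : nat :=
  #|[set a : A | [exists i : 'I_N.+1, (m < i)%N && (rv_name s i == Some a)]]|.

Definition is_block_seq (s : rv_state) (nk : nat -> nat) : Prop :=
  nk 0%N = 0%N /\
  forall k, (n_names s (nk k) (nk k.+1) <= #|A| - 1)%N /\
            forall N, (n_names s (nk k) N <= #|A| - 1)%N -> (N <= nk k.+1)%N.

Definition Qkl (s : rv_state) (nk : nat -> nat) (k l : nat) : mat :=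
  prodV s (nk k) (nk l).

Definition Gamma_s (s : rv_state) (nk : nat -> nat) (k : nat) (v : A -> R) : Prop :=
  exists sigma C : R, 0 < sigma /\ 0 < C /\
    forall l, (k <= l)%N ->
      vec_norm (tapply (Qkl s nk k l) v)
        <= C * (mat_norm (Qkl s nk k l)) `^ (- sigma) * vec_norm v.

Definition qnorm (s : rv_state) (nk : nat -> nat) (k : nat) (v : A -> R) : R :=
  inf [set vec_norm (fun a => v a - g a) | g in Gamma_s s nk k].

Definition roth_conditions (pi0 pi1 : A -> nat) (lam : A -> R) (nk : nat -> nat) : Prop :=
  let s := RVState pi0 pi1 lam in
  (forall eps : R, 0 < eps -> exists C : R, forall k,
     mat_norm (Qkl s nk k k.+1) <= C * (mat_norm (Qkl s nk 0 k)) `^ eps) /\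
  (exists theta C : R, 0 < theta /\ 0 < C /\ forall k (v : A -> R),
     \sum_(a : A) lam a * v a = 0 ->
     vec_norm (tapply (Qkl s nk 0 k) v)
       <= C * (mat_norm (Qkl s nk 0 k)) `^ (1 - theta) * vec_norm v) /\
  (forall eps : R, 0 < eps -> exists C : R, forall k l, (k <= l)%N ->
     (* || S_flat(k,l)^{-1} || <= C ||Q(l)||^eps *)
     (forall v : A -> R,
        qnorm s nk k v <= C * (mat_norm (Qkl s nk 0 l)) `^ eps
                              * qnorm s nk l (tapply (Qkl s nk k l) v)) /\
     (forall v : A -> R, Gamma_s s nk k v ->
        vec_norm (tapply (Qkl s nk k l) v)
          <= C * (mat_norm (Qkl s nk 0 l)) `^ eps * vec_norm v)).

Definition roth_type (pi0 pi1 : A -> nat) (lam : A -> R) : Prop :=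
  keane pi0 pi1 lam /\
  exists nk, is_block_seq (RVState pi0 pi1 lam) nk /\ roth_conditions pi0 pi1 lam nk.

End IEM.

Section Analysis.
Variable R : realType.

Definition inI (a b x : R) : bool := (a <= x) && (x < b).

Definition deriv_within (a b : R) (f : R -> R) (x y : R) : Prop :=
  forall e : R, 0 < e -> exists d : R, 0 < d /\ forall z, inI a b z ->
    0 < `|z - x| < d -> `|(f z - f x) / (z - x) - y| < e.

Definition deriv_on (a b : R) (f f' : R -> R) : Prop :=
  forall x, inI a b x -> deriv_within a b f x (f' x).

Definition cont_on (a b : R) (f : R -> R) : Prop :=
  forall x, inI a b x -> forall e : R, 0 < e -> exists d : R, 0 < d /\
    forall y, inI a b y -> `|y - x| < d -> `|f y - f x| < e.

Definition abs_cont_on (a b : R) (f : R -> R) : Prop :=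
  forall e : R, 0 < e -> exists d : R, 0 < d /\
    forall s : seq (R * R),
      all (fun p => (a <= p.1) && (p.1 <= p.2) && (p.2 < b)) s ->
      sorted (fun p q => p.2 <= q.1) s ->
      \sum_(p <- s) (p.2 - p.1) < d ->
      \sum_(p <- s) `|f p.2 - f p.1| < e.

Definition bv_on (a b : R) (f : R -> R) : Prop :=
  exists M : R, forall s : seq R, all (inI a b) s -> sorted <=%R s ->
    \sum_(i < (size s).-1) `|f (nth 0 s i.+1) - f (nth 0 s i)| <= M.

Definition lipschitz_on (a b : R) (f : R -> R) : Prop :=
  exists L : R, forall x y, inI a b x -> inI a b y -> `|f x - f y| <= L * `|x - y|.

End Analysis.

Section Spaces.
Variables (R : realType) (A : finType).

Definition jl (pi0 : A -> nat) (lam : A -> R) (a : A) : R := left_end pi0 lam a.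
Definition jr (pi0 : A -> nat) (lam : A -> R) (a : A) : R := left_end pi0 lam a + lam a.

(* BV^r_*(I).  D a l is the l-th derivative of Phi on j0(I_a) (for l <= r-1),
   and D a r is (a version of) the a.e. derivative of D a (r-1). *)
Definition BVr_star (pi0 : A -> nat) (lam : A -> R) (r : nat) (Phi : R -> R) : Prop :=
  exists D : A -> nat -> R -> R,
    (forall a : A,
       let l := jl pi0 lam a in let u := jr pi0 lam a in
       (forall x, inI l u x -> D a 0%N x = Phi x) /\
       (forall j, (j.+1 < r)%N -> deriv_on l u (D a j) (D a j.+1)) /\
       cont_on l u (D a (r.-1)) /\
       abs_cont_on l u (D a (r.-1)) /\
       {ae (@lebesgue_measure R), forall x, inI l u x ->
           deriv_within l u (D a (r.-1)) x (D a r x)} /\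
       bv_on l u (D a r)) /\
    (forall j, (1 <= j <= r)%N ->
       (\sum_(a : A) \int[@lebesgue_measure R]_(x in `[jl pi0 lam a, jr pi0 lam a[)
            (D a j x)%:E = 0)%E).

Definition Gamma_r (pi0 : A -> nat) (lam : A -> R) (r : nat) (chi : R -> R) : Prop :=
  forall a : A, exists p : {poly R}, (size p <= r)%N /\
    forall x, inI (jl pi0 lam a) (jr pi0 lam a) x -> chi x = p.[x].

Definition Gamma_star (pi0 : A -> nat) (lam : A -> R) (r : nat) (chi : R -> R) : Prop :=
  Gamma_r pi0 lam r chi /\ BVr_star pi0 lam r chi.

(* C^{r-2+Lip}(I); for r = 1 the bounded functions on I *)
Definition C_lip (lam : A -> R) (r : nat) (Psi : R -> R) : Prop :=
  let u := lamstar lam in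
  if (r <= 1)%N then exists M : R, forall x, inI 0 u x -> `|Psi x| <= M
  else exists D : nat -> R -> R,
    (forall x, inI 0 u x -> D 0%N x = Psi x) /\
    (forall j, (j < r - 2)%N -> deriv_on 0 u (D j) (D j.+1)) /\
    cont_on 0 u (D (r - 2)%N) /\
    lipschitz_on 0 u (D (r - 2)%N).

End Spaces.

(* Main.v *)
(** Following Marmi, Moussa and Yoccoz.  For r = 1, let S(k) Phi be the special Birkhoff sums of Phi
    along the Rauzy-Veech algorithm.  The derivative of Phi has bounded variation and mean 0, so
    condition (b) and the positivity of Q(k, k + 4d) give |S(k) DPhi| <= C |Q(k)|^(1 - theta'); as
    the intervals of level k have length at most C |Q(k)|^(eps - 1), S(k) Phi is constant on each
    of them up to C |Q(k)|^(-w).  Condition (c) then yields a vector chi such that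
    |S(k) (Phi - chi)| <= C |Q(k)|^(-w').  Propagating the zero function from the k-th induced
    interval to I by the cohomological equation gives functions that converge uniformly to a bounded
    solution for Phi - chi.  For larger r, the solution for DPhi is integrated.

    The finiteness of the blocks n(k) < n <= n(k+1) forces every letter to win infinitely often,
    whence winners and losers differ, lengths stay positive and the matrices Q(k, k + 4d) are
    positive.

    Functions on the k-th induced interval are handled as families F a x with 0 <= x <= lambda_a.
    Variation is carried by nondecreasing majorants V with |phi y - phi x| <= V y - V x, which are
    transported by special sums like phi itself. *)
Require Import Defs.
From HB Require Import structures.
From mathcomp Require Import all_boot all_order all_algebra all_fingroup.
From mathcomp Require Import all_classical all_reals all_analysis measurable_realfun.
From mathcomp Require Import ring lra zify.
Set Implicit Arguments. Unset Strict Implicit. Unset Printing Implicit Defensive.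
Import Order.TTheory GRing.Theory Num.Theory.
Import numFieldNormedType.Exports.
Local Open Scope ring_scope.

(** * Rauzy-Veech steps and positivity *)

Arguments prodV : simpl never.

(** Condition (b) controls only products that start at level 0, whereas replacing a special sum by a
    vector makes an error at every level J. The effect of such an error at level k is therefore
    estimated twice: by the norm of Q(J, k), which is summable over J but gains nothing in |Q(k)|,
    and by lifting the error to level 0, which gains a power of |Q(k)| but costs a fixed power of
    |Q(J)|. This cost is polynomial because the determinant is a nonzero integer. A geometric mean
    with a small weight on the second bound is summable and keeps part of the gain. The same device
    gives the decay of recursions inside the stable spaces. The vector chi is the initial vector
    plus the sum of the errors lifted to level 0 modulo stable vectors, a lift that (c) makes almost
    free; the stable remainder is shown to decay separately. That phi is the derivative of Phi is
    kept as a Taylor inequality, which passes to special sums term by term. Extending a solution by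
    one step does not enlarge its error, and the number of steps in a block is at most the norm of
    its matrix, so the corrections made in a block are summable. *)

Section CombinatorialData.
Variable A : finType.
Implicit Types (p : A -> nat) (w l a b : A).

Lemma comb_bij_surj p k : comb_bij p -> (0 < k <= #|A|)%N -> exists a, p a = k.
Proof.
move=> [pinj pran] /andP[k0 kA].
have h a : ((p a).-1 < #|A|)%N by have := pran a; lia.
have finj : injective (fun a => Ordinal (h a)).
  move=> a b [eab]; apply: pinj; have := pran a; have := pran b; lia.
have [g _ gK] := inj_card_bij finj (eq_leq (card_ord _)).
have h1 : (k.-1 < #|A|)%N by lia.
exists (g (Ordinal h1)); have := congr1 val (gK (Ordinal h1)) => /=.
by move: (p _) (pran (g (Ordinal h1))) => z /andP[z0 _] e; rewrite -(prednK z0) e prednK.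
Qed.

Lemma comb_bij_last p : comb_bij p -> (0 < #|A|)%N -> exists a, p a = #|A|.
Proof. by move=> pb A0; apply: comb_bij_surj => //; rewrite A0 leqnn. Qed.

Lemma comb_bij_newpi p w : comb_bij p -> comb_bij (rv_newpi p w).
Proof.
move=> [pinj pran]; split.
  move=> a b; rewrite /rv_newpi => e; apply: pinj; move: e.
  have := pran a; have := pran b; have := pran w.
  do ! case: ifP => ?; lia.
move=> a; rewrite /rv_newpi.
have := pran a; have := pran w.
do ! case: ifP => ?; lia.
Qed.

Lemma newpi_last p w : comb_bij p -> p w = #|A| -> rv_newpi p w =1 p.
Proof. by move=> [_ pran] pw a; rewrite /rv_newpi pw; have /andP[_ ->] := pran a. Qed.

End CombinatorialData.

Section Steps.
Variables (R : realType) (A : finType).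
Hypothesis card_gt0 : (0 < #|A|)%N.
Implicit Types s : rv_state R A.

Definition comb_state s := comb_bij (st_pi0 s) /\ comb_bij (st_pi1 s).

(** Relational form of a step, with winner and loser named, so that the [pick] in [rv_step] need not
    be unfolded again. In [step_top] the winner is last on the top row, in [step_bot] on the bottom
    row; equal lengths fall under [step_bot]. *)
Definition step_top s (w l : A) :=
  [/\ st_pi0 s w = #|A|, st_pi1 s l = #|A|, rv_wl s = Some (w, l) &
   rv_step s = RVState (st_pi0 s) (rv_newpi (st_pi1 s) w) (rv_newlam (st_lam s) w l)].

Definition step_bot s (w l : A) :=
  [/\ st_pi1 s w = #|A|, st_pi0 s l = #|A|, rv_wl s = Some (w, l) &
   rv_step s = RVState (rv_newpi (st_pi0 s) w) (st_pi1 s) (rv_newlam (st_lam s) w l)].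

Lemma rv_stepP s : comb_state s ->
  exists wl : A * A, st_lam s wl.2 <= st_lam s wl.1 /\
    (step_top s wl.1 wl.2 \/ step_bot s wl.1 wl.2).
Proof.
move=> [b0 b1]; rewrite /step_top /step_bot /rv_wl /rv_step.
case: pickP => [a0 /eqP e0|h]; last first.
  by have [a e] := comb_bij_last b0 card_gt0; have := h a; rewrite e eqxx.
case: pickP => [a1 /eqP e1|h]; last first.
  by have [a e] := comb_bij_last b1 card_gt0; have := h a; rewrite e eqxx.
case: ltP => h; [exists (a0, a1)|exists (a1, a0)] => /=.
  by split; [exact: ltW|left].
by split => //; right.
Qed.

Lemma comb_state_step s : comb_state s -> comb_state (rv_step s).
Proof.
move=> cs; have [b0 b1] := cs.
have [[w l] [_ [[_ _ _ ->]|[_ _ _ ->]]]] := rv_stepP cs; split=> //=;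
  exact: comb_bij_newpi.
Qed.

Lemma comb_state_seq s n : comb_state s -> comb_state (rv_seq s n).
Proof. by move=> cs; elim: n => //= n; exact: comb_state_step. Qed.

Lemma rv_winners s : comb_state s -> exists W L : nat -> A,
  (forall n, st_lam (rv_seq s n) (L n) <= st_lam (rv_seq s n) (W n)) /\
  (forall n, step_top (rv_seq s n) (W n) (L n) \/ step_bot (rv_seq s n) (W n) (L n)).
Proof.
move=> cs; have /choice[f fP] := fun n => rv_stepP (comb_state_seq n cs).
by exists (fst \o f), (snd \o f); split=> n; have [] := fP n.
Qed.

End Steps.

Section Winners.
Variables (R : realType) (A : finType) (s : rv_state R A) (W L : nat -> A).
Hypothesis cs : comb_state s.
Hypothesis stepWL : forall n,
  step_top (rv_seq s n) (W n) (L n) \/ step_bot (rv_seq s n) (W n) (L n).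
Notation lamn n := (st_lam (rv_seq s n)).
Notation Q := (prodV s).

Let cardA : (0 < #|A|)%N.
Proof. by apply/card_gt0P; exists (W 0%N). Qed.

Lemma rv_wlE n : rv_wl (rv_seq s n) = Some (W n, L n).
Proof. by have [[]|[]] := stepWL n. Qed.

Lemma rv_nameE n : rv_name s n.+1 = Some (W n).
Proof. by rewrite /rv_name /= rv_wlE. Qed.

Lemma lamnS n a : lamn n.+1 a = if a == W n then lamn n (W n) - lamn n (L n) else lamn n a.
Proof.
have -> : lamn n.+1 = rv_newlam (lamn n) (W n) (L n).
  by rewrite /rv_seq iterS -/(rv_seq s n); have [[_ _ _ ->]|[_ _ _ ->]] := stepWL n.
by [].
Qed.

(** The row on which the winner is last is not modified, so at the next step the winner is again one
    of the two last letters. *)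
Lemma winner_persists n : W n.+1 = W n \/ L n.+1 = W n.
Proof.
have [[i0 _] [i1 _]] := comb_state_seq cardA n.+1 cs.
have [[p0 p1 _ e]|[p1 p0 _ e]] := stepWL n.
  have eW : st_pi0 (rv_seq s n.+1) (W n) = #|A| by rewrite /rv_seq iterS -/(rv_seq s n) e.
  have [[q0 _ _ _]|[_ q0 _ _]] := stepWL n.+1; [left|right]; apply: i0; congruence.
have eW : st_pi1 (rv_seq s n.+1) (W n) = #|A| by rewrite /rv_seq iterS -/(rv_seq s n) e.
have [[_ q0 _ _]|[q0 _ _ _]] := stepWL n.+1; [right|left]; apply: i1; congruence.
Qed.

(** A letter that is last on both rows stays there: inserting the last letter after itself is the
    identity by [newpi_last]. *)
Lemma degenerate_persists n : W n = L n -> W n.+1 = W n /\ L n.+1 = W n.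
Proof.
move=> eWL.
have [b0 b1] := comb_state_seq cardA n cs.
have [[i0 _] [i1 _]] := comb_state_seq cardA n.+1 cs.
suff [e0 e1] : st_pi0 (rv_seq s n.+1) (W n) = #|A| /\ st_pi1 (rv_seq s n.+1) (W n) = #|A|.
  have [[q0 q1 _ _]|[q1 q0 _ _]] := stepWL n.+1; split;
  (apply: i0; congruence) || (apply: i1; congruence).
rewrite /rv_seq iterS -/(rv_seq s n).
have [[p0 p1 _ ->]|[p1 p0 _ ->]] /= := stepWL n; rewrite -?eWL in p0 p1.
  by rewrite newpi_last.
by rewrite newpi_last.
Qed.

Lemma prodV_id n a b : Q n n a b = (a == b)%:R.
Proof. by case: n => [//|n]; rewrite /prodV ltnn. Qed.

(** Right multiplication by the step matrix adds the column of the winner to the column of the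
    loser. *)
Lemma prodVS m n a b : (m <= n)%N ->
  Q m n.+1 a b = Q m n a b + (b == L n)%:R * Q m n a (W n).
Proof.
move=> mn; rewrite {1}/prodV mn -/(prodV s m n) /mat_mul /rv_V /= rv_wlE.
under eq_bigr do rewrite mulrDr.
rewrite big_split /= (bigD1 b) //= eqxx mulr1 big1 ?addr0; last first.
  by move=> c /negbTE cb; rewrite cb mulr0.
congr (_ + _); rewrite (bigD1 (W n)) //= eqxx big1 ?addr0 1?mulrC //.
by move=> c /negbTE cb; rewrite cb mulr0.
Qed.

Lemma prodV_nat m n a b : (m <= n)%N -> Q m n a b \is a Num.nat.
Proof.
move=> /subnK <-; elim: (n - m)%N a b => [|k IH] a b.
  by rewrite add0n prodV_id natr_nat.
by rewrite addSn prodVS ?leq_addl// rpredD ?rpredM ?natr_nat.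
Qed.

Lemma prodV_ge0 m n a b : (m <= n)%N -> 0 <= Q m n a b.
Proof. by move=> mn; rewrite natr_ge0 // prodV_nat. Qed.

Lemma prodV_mono m n n' a b : (m <= n)%N -> (n <= n')%N -> Q m n a b <= Q m n' a b.
Proof.
move=> mn /subnK <-; elim: (n' - n)%N => [//|k IH].
have mk : (m <= k + n)%N by lia.
rewrite addSn prodVS //; apply: (le_trans IH).
by rewrite lerDl mulr_ge0 ?prodV_ge0.
Qed.

Lemma prodV_diag m n a : (m <= n)%N -> 1 <= Q m n a a.
Proof.
by move=> mn; rewrite (le_trans _ (prodV_mono _ _ (leqnn m) mn)) // prodV_id eqxx.
Qed.

Lemma prodV_cat m n k a b : (m <= n)%N -> (n <= k)%N ->
  Q m k a b = \sum_c Q m n a c * Q n k c b.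
Proof.
move=> mn /subnK <-; elim: (k - n)%N b => [|j IH] b.
  rewrite add0n (bigD1 b) //= prodV_id eqxx mulr1 big1 ?addr0 // => c cb.
  by rewrite prodV_id (negbTE cb) mulr0.
rewrite addSn prodVS; last lia.
rewrite !IH mulr_sumr -big_split; apply: eq_bigr => c _ /=.
rewrite prodVS; last lia.
ring.
Qed.

(** One step only subtracts the loser's length from the winner's, which the step matrix undoes when
    the two letters differ. *)
Lemma lamn_sum m n a : (m <= n)%N -> (forall i, W i != L i) ->
  lamn m a = \sum_b Q m n a b * lamn n b.
Proof.
move=> /subnK <- WL; elim: (n - m)%N => [|k IH].
  rewrite add0n (bigD1 a) //= prodV_id eqxx mul1r big1 ?addr0 // => c cb.
  by rewrite prodV_id eq_sym (negbTE cb) mul0r.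
rewrite IH addSn; set j := (k + m)%N.
have mj : (m <= j)%N by rewrite /j; lia.
have qE b := prodVS a b mj; move: (Q m j.+1 a) qE => q' qE.
rewrite [RHS](bigD1 (W j)) //= [LHS](bigD1 (W j)) //=.
have LW : L j != W j by rewrite eq_sym WL.
rewrite (bigD1 (L j)) //= [in RHS](bigD1 (L j)) //=.
rewrite lamnS eqxx lamnS (negbTE LW) !qE eqxx (negbTE (WL j)).
set X := \sum_(i | _) _; set Y := \sum_(i | _) _.
have -> : X = Y.
  apply: eq_bigr => i /andP[iW iL].
  by rewrite qE (negbTE iL) mul0r addr0 lamnS (negbTE iW).
rewrite mul0r mul1r; ring.
Qed.

End Winners.

(** * Blocks of steps, positive matrices and positive lengths *)

Section Blocks.
Variables (R : realType) (A : finType) (s : rv_state R A) (W L : nat -> A) (nk : nat -> nat).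
Hypothesis cs : comb_state s.
Hypothesis stepWL : forall n,
  step_top (rv_seq s n) (W n) (L n) \/ step_bot (rv_seq s n) (W n) (L n).
Hypothesis leWL : forall n, st_lam (rv_seq s n) (L n) <= st_lam (rv_seq s n) (W n).
Hypothesis cardA2 : (2 <= #|A|)%N.
Hypothesis blk : is_block_seq s nk.
Hypothesis lam_gt0 : forall a, 0 < st_lam s a.
Notation lamn n := (st_lam (rv_seq s n)).
Notation Q := (prodV s).

Lemma n_namesE m N : n_names s m N =
  #|[set a | [exists i : 'I_N.+1, (m < i)%N && (rv_name s i == Some a)]]%SET|.
Proof.
by apply: eq_card => a; rewrite inE; apply/idP/idP => h; [exact: set_mem h|exact: mem_set].
Qed.

(** By maximality of [nk k.+1], one more step brings in all the names. That extra step has index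
    [nk k.+1], since [rv_name] numbers from 1 the steps that [W] numbers from 0. *)
Lemma winners_block k a : exists i, (nk k <= i <= nk k.+1)%N /\ W i = a.
Proof.
have [_ /(_ k) [_ h]] := blk.
have : ~~ (n_names s (nk k) (nk k.+1).+1 <= #|A| - 1)%N.
  by apply/negP => /h; rewrite ltnn.
rewrite n_namesE; set X := finset _ => hX.
have XT : X = [set: A]%SET.
  apply/eqP; rewrite eqEcard finset.subsetT cardsT /=.
  by move: hX; set x := #|X|; move: x #|A| => x y; lia.
have : a \in X by rewrite XT inE.
rewrite inE => /existsP[[i hi] /= /andP[ki]].
case: i hi ki => [//|i] hi ki.
rewrite (rv_nameE stepWL) => /eqP[<-]; exists i; split=> //; lia.
Qed.

Lemma nk_incr k : (nk k < nk k.+1)%N.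
Proof.
have [_ /(_ k) [_ h]] := blk; apply: h.
apply: (@leq_trans 1); last by move: cardA2; move: #|A| => x; lia.
rewrite n_namesE -(cards1 (W (nk k))); apply: subset_leq_card.
apply/fintype.subsetP => a; rewrite !inE => /existsP[[i hi] /= /andP[ki]].
have -> : i = (nk k).+1 by lia.
by rewrite (rv_nameE stepWL) => /eqP[<-].
Qed.

Lemma nk_mono k k' : (k <= k')%N -> (nk k <= nk k')%N.
Proof.
move=> /subnK <-; elim: (k' - k)%N => [//|j IH].
by rewrite addSn (leq_trans IH) // ltnW // nk_incr.
Qed.

Lemma nk_ge k : (k <= nk k)%N.
Proof. by elim: k => // k IH; apply: (leq_trans _ (nk_incr k)). Qed.

(** Otherwise the same letter would win at all steps from [n] on, whereas block [n] starts no
    earlier than step [n] and all letters win in it. *)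
Lemma winner_neq_loser n : W n != L n.
Proof.
apply/eqP => e.
have h i : (n <= i)%N -> W i = W n /\ L i = W n.
  move=> /subnK <-; elim: (i - n)%N => [|j [IH1 IH2]]; first by split.
  rewrite addSn; have [|-> ->] := degenerate_persists cs stepWL (n := (j + n)%N).
    by rewrite IH1 IH2.
  by rewrite IH1.
have : (#|A| <= #|[set W n]%SET|)%N.
  rewrite -cardsT; apply: subset_leq_card; apply/fintype.subsetP => a _.
  have [i [/andP[ki _] <-]] := winners_block n a.
  by have [-> _] := h i (leq_trans (nk_ge n) ki); rewrite inE.
by rewrite cards1; move: cardA2; move: #|A| => x; lia.
Qed.

Let Q_ge0 m n a b := @prodV_ge0 _ _ _ _ _ stepWL m n a b.
Let Q_mono m n n' a b := @prodV_mono _ _ _ _ _ stepWL m n n' a b.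

(* As long as the support of row b does not grow, a winner inside it forces its loser inside it;
   by [winner_persists] the winners then can never pass from outside the support to inside. *)
Lemma support_grows M b k c0 : (M <= nk k)%N -> Q M (nk k) b c0 = 0 ->
  exists c, Q M (nk k) b c = 0 /\ 0 < Q M (nk (k + 4)) b c.
Proof.
move=> Mk c0_0; apply: contrapT => /forallNP h.
have stab n c : (nk k <= n <= nk (k + 4))%N -> 0 < Q M n b c -> 0 < Q M (nk k) b c.
  move=> /andP[kn nk4] pos; rewrite lt0r Q_ge0 // andbT; apply/eqP => e0.
  by apply: (h c); split=> //; apply: (lt_le_trans pos); apply: Q_mono => //; lia.
have posb : 0 < Q M (nk k) b b by apply: (lt_le_trans ltr01); exact: prodV_diag stepWL _ _ _ Mk.
have [i [/andP[ki ik] Wi]] := winners_block k c0.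
(* A win of [b] in block [k + 2] comes no earlier than the win of [c0] in block [k], and stopping at
   [nk (k + 4)] leaves room for the index [u.+2] below. *)
have [i' [/andP[ki' ik'] Wi']] := winners_block (k + 2) b.
have e1 : (nk k.+1 <= nk (k + 2))%N by apply: nk_mono; lia.
have e2 : (nk (k + 2).+1 < nk (k + 4))%N.
  by have := nk_incr (k + 3); rewrite -!addnS.
suff out j : (i <= j <= i')%N -> ~~ (0 < Q M (nk k) b (W j)).
  have ii' : (i <= i' <= i')%N by lia.
  by have := out i' ii'; rewrite Wi' posb.
move=> /andP[] /subnK <-; elim: (j - i)%N => [_|t IH].
  by rewrite add0n Wi c0_0 ltxx.
rewrite addSn => ti; have /IH oj : (t + i <= i')%N by lia.
move: oj ti; set u := (t + i)%N => oj ti.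
have [->//|Lu] := winner_persists cs stepWL u.
apply/negP => pos; move/negP: oj; apply; apply: (@stab u.+2).
  by rewrite /u in ti *; lia.
have Mu : (M <= u.+1)%N by rewrite /u; lia.
rewrite (prodVS stepWL) // Lu eqxx mul1r ltr_wpDl ?Q_ge0 //.
by apply: (lt_le_trans pos); apply: Q_mono => //; rewrite /u; lia.
Qed.

(** The support of row [b] contains [b] and, as long as it is not full, gains a letter every four
    blocks by [support_grows]. The entries are natural numbers, so positive ones are at least 1. *)
Lemma prodV_pos k b c : 1 <= Q (nk k) (nk (k + 4 * #|A|)) b c.
Proof.
pose X j := [set c | 0 < Q (nk k) (nk (k + 4 * j)) b c]%SET.
have kk j : (nk k <= nk (k + 4 * j))%N by apply: nk_mono; lia.
have hX j : (minn #|A| j.+1 <= #|X j|)%N.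
  elim: j => [|j IH].
    apply: (@leq_trans 1%N); first by rewrite geq_minr.
    apply/card_gt0P; exists b; rewrite inE; apply: (lt_le_trans ltr01).
    exact: prodV_diag stepWL _ _ _ (kk _).
  have sX : X j \subset X j.+1.
    apply/fintype.subsetP => a; rewrite !inE => pos; apply: (lt_le_trans pos).
    by apply: Q_mono => //; apply: nk_mono; lia.
  have [eT|nT] := eqVneq (X j) [set: A]%SET.
    move: sX; rewrite eT => /subset_leq_card; rewrite cardsT; apply: leq_trans.
    by rewrite geq_minl.
  have [c1 c1X] : exists c, c \notin X j.
    apply/existsP; rewrite -negb_forall; apply/negP => /forallP h.
    by move/eqP: nT; apply; apply/finset.setP => a; rewrite h inE.
  have c10 : Q (nk k) (nk (k + 4 * j)) b c1 = 0.
    by apply/eqP; move: c1X; rewrite inE lt0r Q_ge0 // andbT negbK.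
  have [c2 [c20 c2p]] := support_grows (kk j) c10.
  have : X j \proper X j.+1.
    apply/properP; split=> //; exists c2; rewrite !inE ?c20 ?ltxx //.
    by move: c2p; congr (0 < Q _ (nk _) _ _); lia.
  by move=> /proper_card; move: IH; move: #|X j| #|X j.+1| #|A| => x y z; lia.
have XT : X #|A| = [set: A]%SET.
  apply/eqP; rewrite eqEcard finset.subsetT cardsT /=.
  by move: (hX #|A|); move: #|X #|A| | #|A| => x y; lia.
have : c \in X #|A| by rewrite XT inE.
rewrite inE; have /natrP[n ->] := prodV_nat stepWL b c (kk #|A|).
by rewrite ltr0n ler1n.
Qed.

Lemma lamn_ge0 n a : 0 <= lamn n a.
Proof.
elim: n a => [|n IH] a; first exact: ltW.
by rewrite (lamnS stepWL); case: eqP => // _; rewrite subr_ge0.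
Qed.

Lemma lamn_nincr m n a : (m <= n)%N -> lamn n a <= lamn m a.
Proof.
move=> /subnK <-; elim: (n - m)%N => [//|j IH].
rewrite addSn; apply: le_trans IH.
by rewrite (lamnS stepWL); case: eqP => // ->; rewrite gerBl lamn_ge0.
Qed.

Lemma lamn_block k a : \sum_b lamn (nk (k + 4 * #|A|)) b <= lamn (nk k) a.
Proof.
rewrite [leRHS](lamn_sum stepWL a _ winner_neq_loser (n := nk (k + 4 * #|A|))); last first.
  by apply: nk_mono; lia.
apply: ler_sum => b _; rewrite ler_peMl ?lamn_ge0 //; exact: prodV_pos.
Qed.

(** A step between equal lengths would create a zero length. By [lamn_block] every length at level
    [nk n] dominates a later total length; if that total were zero, [lamn_sum] would make the
    initial lengths zero. *)
Lemma lamn_gt0 n a : 0 < lamn n a.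
Proof.
apply: (lt_le_trans _ (lamn_nincr a (nk_ge n))).
apply: (lt_le_trans _ (lamn_block n a)).
set N := nk _; rewrite lt0r sumr_ge0 ?andbT; last by move=> *; exact: lamn_ge0.
apply/eqP => /eqP; rewrite psumr_eq0; last by move=> *; exact: lamn_ge0.
move=> /allP h; move: (lam_gt0 a).
rewrite (lamn_sum stepWL a (leq0n N) winner_neq_loser) big1 ?ltxx // => b _.
by have /eqP -> := h b (mem_index_enum _); rewrite mulr0.
Qed.

End Blocks.

(** * Positive cocycles *)

Lemma sum_ord_cst (R : pzSemiRingType) n (c : R) : \sum_(i < n) c = n%:R * c.
Proof. by rewrite sumr_const card_ord mulr_natl. Qed.

Section Norms.
Variables (R : realType) (A : finType).
Implicit Types (u v : A -> R) (M N : mat R A).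

Lemma vec_norm_ge0 v : 0 <= vec_norm v.
Proof. exact: sumr_ge0. Qed.

Lemma vec_normD u v : vec_norm (fun a => u a + v a) <= vec_norm u + vec_norm v.
Proof. by rewrite -big_split; apply: ler_sum => a _; exact: ler_normD. Qed.

Lemma vec_normZ (c : R) v : vec_norm (fun a => c * v a) = `|c| * vec_norm v.
Proof. by rewrite /vec_norm mulr_sumr; apply: eq_bigr => a _; rewrite normrM. Qed.

Lemma vec_normN v : vec_norm (fun a => - v a) = vec_norm v.
Proof. by apply: eq_bigr => a _; rewrite normrN. Qed.

Lemma vec_normB u v : vec_norm (fun a => u a - v a) <= vec_norm u + vec_norm v.
Proof. by rewrite -(vec_normN v); exact: vec_normD. Qed.

Lemma vec_norm0 : vec_norm (fun _ : A => 0 : R) = 0.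
Proof. by rewrite /vec_norm big1 // => a _; rewrite normr0. Qed.

Lemma vec_norm_sum n (f : nat -> A -> R) :
  vec_norm (fun a => \sum_(i < n) f i a) <= \sum_(i < n) vec_norm (f i).
Proof.
elim: n => [|n IH].
  rewrite big_ord0 (_ : (fun _ => _) = fun=> 0) ?vec_norm0 //.
  by apply: funext => a; rewrite big_ord0.
rewrite big_ord_recr /= (_ : (fun _ => _) = fun a => (\sum_(i < n) f i a) + f n a).
  by apply: (le_trans (vec_normD _ _)); rewrite lerD2r.
by apply: funext => a; rewrite big_ord_recr.
Qed.

Lemma le_vec_norm v a : `|v a| <= vec_norm v.
Proof. by rewrite /vec_norm (bigD1 a) //= lerDl sumr_ge0. Qed.

Lemma vec_norm_le v (B : R) : (forall a, `|v a| <= B) -> vec_norm v <= #|A|%:R * B.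
Proof.
move=> h; apply: (@le_trans _ _ (\sum_(a : A) B)); first exact: ler_sum.
by rewrite sumr_const mulr_natl; exact: lexx.
Qed.

Lemma mat_norm_ge0 M : 0 <= mat_norm M.
Proof. by apply: sumr_ge0 => a _; exact: sumr_ge0. Qed.

Lemma le_mat_norm M a b : `|M a b| <= mat_norm M.
Proof.
rewrite /mat_norm (bigD1 a) //= (bigD1 b) //= -addrA lerDl addr_ge0 ?sumr_ge0 //.
by move=> c _; rewrite sumr_ge0.
Qed.

Lemma tapply_norm M v : vec_norm (tapply M v) <= mat_norm M * vec_norm v.
Proof.
rewrite /mat_norm exchange_big /= mulr_suml; apply: ler_sum => a _.
rewrite mulr_suml; apply: (le_trans (ler_norm_sum _ _ _)); apply: ler_sum => b _.
by rewrite normrM ler_wpM2l // le_vec_norm.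
Qed.

Lemma tapplyD M u v : tapply M (fun a => u a + v a) = fun a => tapply M u a + tapply M v a.
Proof.
apply: funext => a; rewrite /tapply -big_split; apply: eq_bigr => b _.
by rewrite mulrDr.
Qed.

Lemma tapplyZ M (c : R) v : tapply M (fun a => c * v a) = fun a => c * tapply M v a.
Proof.
by apply: funext => a; rewrite /tapply mulr_sumr; apply: eq_bigr => b _; rewrite mulrCA.
Qed.

Lemma tapplyN M v : tapply M (fun a => - v a) = fun a => - tapply M v a.
Proof.
by apply: funext => a; rewrite /tapply -sumrN; apply: eq_bigr => b _; rewrite mulrN.
Qed.

Lemma tapplyB M u v : tapply M (fun a => u a - v a) = fun a => tapply M u a - tapply M v a.
Proof. by rewrite tapplyD tapplyN. Qed.

Lemma tapply_sum M n (f : nat -> A -> R) :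
  tapply M (fun a => \sum_(i < n) f i a) = fun a => \sum_(i < n) tapply M (f i) a.
Proof.
apply: funext => a; rewrite /tapply exchange_big /=; apply: eq_bigr => b _.
by rewrite mulr_sumr.
Qed.

Lemma tapply_id v : tapply (@mat_id R A) v = v.
Proof.
apply: funext => a; rewrite /tapply /mat_id (bigD1 a) //= eqxx mul1r big1 ?addr0 //.
by move=> b /negbTE ->; rewrite mul0r.
Qed.

Lemma tapply_mul M N v : tapply (mat_mul M N) v = tapply N (tapply M v).
Proof.
apply: funext => a; rewrite /tapply /mat_mul.
under eq_bigr do rewrite mulr_suml.
rewrite exchange_big /=; apply: eq_bigr => b _; rewrite mulr_sumr.
by apply: eq_bigr => c _; ring.
Qed.

End Norms.

(** * Real powers and interpolation of bounds *)

Section PowR.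
Variable R : realType.
Implicit Types x y z s t : R.

Lemma powR_add x s t : 0 < x -> x `^ (s + t) = x `^ s * x `^ t.
Proof. by move=> x0; rewrite powRD // lt0r_neq0 ?implybT. Qed.

Lemma powR_mono x s t : 1 <= x -> s <= t -> x `^ s <= x `^ t.
Proof. by move=> x1; apply: ler_powR. Qed.

Lemma powR_monol x y s : 0 <= x -> x <= y -> 0 <= s -> x `^ s <= y `^ s.
Proof. by move=> x0 xy s0; apply: ge0_ler_powR; rewrite ?nnegrE // (le_trans x0). Qed.

Lemma powR_monolN x y s : 0 < x -> x <= y -> 0 <= s -> y `^ (- s) <= x `^ (- s).
Proof.
move=> x0 xy s0; rewrite !powRN lef_pV2 ?posrE ?powR_gt0 ?(lt_le_trans x0) //.
by apply: powR_monol => //; exact: ltW.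
Qed.

Lemma powR_ge1 x s : 1 <= x -> 0 <= s -> 1 <= x `^ s.
Proof. by move=> x1 s0; rewrite -(powRr0 x) powR_mono. Qed.

Lemma powR_le1 x s : 1 <= x -> s <= 0 -> x `^ s <= 1.
Proof. by move=> x1 s0; rewrite -(powRr0 x) powR_mono. Qed.

(** The geometric mean of two bounds with weights [1 - t] and [t]. It is used with small [t]: the
    first bound then supplies the decay in [Y], and the second a gain in [X]. *)
Lemma interpolation (x c X Y a1 b1 a2 b2 t : R) :
  0 < c -> 0 < X -> 0 < Y -> 0 <= t <= 1 ->
  x <= c * X `^ a1 * Y `^ b1 -> x <= c * X `^ a2 * Y `^ b2 ->
  x <= c * X `^ ((1 - t) * a1 + t * a2) * Y `^ ((1 - t) * b1 + t * b2).
Proof.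
move=> c0 X0 Y0 /andP[t0 t1] h1 h2.
have [x0|x0] := leP x 0.
  by apply: (le_trans x0); rewrite !mulr_ge0 ?powR_ge0 // ltW.
have -> : x = x `^ (1 - t) * x `^ t.
  by rewrite -powR_add // subrK powRr1 // ltW.
have e : c * X `^ ((1 - t) * a1 + t * a2) * Y `^ ((1 - t) * b1 + t * b2) =
    (c * X `^ a1 * Y `^ b1) `^ (1 - t) * (c * X `^ a2 * Y `^ b2) `^ t.
  have cE : c = c `^ (1 - t) * c `^ t by rewrite -powR_add // subrK powRr1 // ltW.
  rewrite {1}cE !powRM ?mulr_ge0 ?powR_ge0 ?ltW // -!powRrM !powR_add //.
  rewrite ![(1 - t) * _]mulrC ![t * _]mulrC; ring.
rewrite e; apply: ler_pM; rewrite ?powR_ge0 //.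
  by apply: powR_monol; [exact: ltW|exact: h1|rewrite subr_ge0].
by apply: powR_monol; [exact: ltW|exact: h2|].
Qed.

End PowR.

(** What the growth estimates use of the matrices Q(k, l): natural entries, lengths as an
    eigenvector-like family, and positivity over [N0] levels. Together with integrality,
    [cocycle_inv] makes the determinants at least 1 in absolute value. *)
Record positive_cocycle (R : realType) (A : finType)
    (P : nat -> nat -> mat R A) (lam : nat -> A -> R) (N0 : nat) : Prop := PositiveCocycle {
  cocycle_id : forall k, P k k = @mat_id R A;
  cocycle_cat : forall k l m, (k <= l)%N -> (l <= m)%N -> P k m = mat_mul (P k l) (P l m);
  cocycle_nat : forall k l a b, (k <= l)%N -> P k l a b \is a Num.nat;
  cocycle_diag : forall k l a, (k <= l)%N -> 1 <= P k l a a;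
  cocycle_pos : forall k a b, 1 <= P k (k + N0)%N a b;
  cocycle_lam : forall k l a, (k <= l)%N -> lam k a = \sum_b P k l a b * lam l b;
  cocycle_lam_gt0 : forall k a, 0 < lam k a;
  cocycle_inv : forall k l, (k <= l)%N -> exists N : mat R A, mat_mul (P k l) N = @mat_id R A }.

Section CocycleGrowth.
Variables (R : realType) (A : finType).
Variables (P : nat -> nat -> mat R A) (lam : nat -> A -> R) (N0 : nat).
Hypothesis cardA2 : (2 <= #|A|)%N.
Hypothesis PC : positive_cocycle P lam N0.
Notation q k := (mat_norm (P 0%N k)).

Lemma cocycle_ge0 k l a b : (k <= l)%N -> 0 <= P k l a b.
Proof. by move=> kl; rewrite natr_ge0 // (cocycle_nat PC). Qed.

Lemma cocycle_normE k l : (k <= l)%N -> mat_norm (P k l) = \sum_a \sum_b P k l a b.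
Proof.
by move=> kl; apply: eq_bigr => a _; apply: eq_bigr => b _; rewrite ger0_norm // cocycle_ge0.
Qed.

Lemma tapply_cocycle k l m v : (k <= l)%N -> (l <= m)%N ->
  tapply (P k m) v = tapply (P l m) (tapply (P k l) v).
Proof. by move=> kl lm; rewrite (cocycle_cat PC kl lm) tapply_mul. Qed.

Lemma cocycle_norm_sub k l m : (k <= l)%N -> (l <= m)%N ->
  mat_norm (P k m) <= mat_norm (P k l) * mat_norm (P l m).
Proof.
move=> kl lm; rewrite (cocycle_cat PC kl lm) /mat_mul.
rewrite [mat_norm (P k l)]/mat_norm mulr_suml; apply: ler_sum => a _.
apply: (@le_trans _ _ (\sum_b \sum_c `|P k l a c| * `|P l m c b|)).
  by apply: ler_sum => b _; apply: (le_trans (ler_norm_sum _ _ _)); apply: ler_sum => c _; rewrite normrM.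
rewrite exchange_big mulr_suml; apply: ler_sum => c _; rewrite -mulr_sumr ler_wpM2l //.
by rewrite /mat_norm [leRHS](bigD1 c) //= lerDl sumr_ge0 // => *; rewrite sumr_ge0.
Qed.

Lemma card_ge2 : 2 <= #|A|%:R :> R.
Proof. by rewrite ler_nat. Qed.

Lemma cocycle_norm_ge2 k l : (k <= l)%N -> 2 <= mat_norm (P k l).
Proof.
move=> kl; apply: (le_trans card_ge2); rewrite -sum1_card natr_sum.
apply: ler_sum => a _; rewrite (bigD1 a) //= -[1]addr0 lerD ?sumr_ge0 //.
by rewrite (le_trans (cocycle_diag PC a kl)) // ler_norm.
Qed.

Lemma cocycle_norm_ge1 k l : (k <= l)%N -> 1 <= mat_norm (P k l).
Proof. by move=> /cocycle_norm_ge2; lra. Qed.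

Lemma cocycle_norm_monor k l m : (k <= l)%N -> (l <= m)%N ->
  mat_norm (P k l) <= mat_norm (P k m).
Proof.
move=> kl lm; rewrite !cocycle_normE ?(leq_trans kl) //.
apply: ler_sum => a _; apply: ler_sum => b _.
rewrite (cocycle_cat PC kl lm) /mat_mul (bigD1 b) //= -[leLHS]addr0 lerD //.
  by rewrite ler_peMr ?cocycle_ge0 // (cocycle_diag PC).
by rewrite sumr_ge0 // => c _; rewrite mulr_ge0 ?cocycle_ge0.
Qed.

Lemma cocycle_norm_monol k l m : (k <= l)%N -> (l <= m)%N ->
  mat_norm (P l m) <= mat_norm (P k m).
Proof.
move=> kl lm; rewrite !cocycle_normE ?(leq_trans kl) //.
apply: ler_sum => a _; apply: ler_sum => b _.
rewrite (cocycle_cat PC kl lm) /mat_mul (bigD1 a) //= -[leLHS]addr0 lerD //.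
  by rewrite ler_peMl ?cocycle_ge0 // (cocycle_diag PC).
by rewrite sumr_ge0 // => c _; rewrite mulr_ge0 ?cocycle_ge0.
Qed.

(** The norm is supermultiplicative up to a gap of [N0] levels: the matrix across the gap has
    entries at least 1 and so joins every entry of the left factor to every entry of the right
    one. *)
Lemma cocycle_norm_mul k l m : (k <= l)%N -> (l + N0 <= m)%N ->
  mat_norm (P k l) * mat_norm (P (l + N0) m) <= mat_norm (P k m).
Proof.
move=> kl lm; have ll := leq_addr N0 l.
have lm' := leq_trans ll lm; have km := leq_trans kl lm'.
rewrite !cocycle_normE // mulr_suml; apply: ler_sum => a _.
rewrite exchange_big mulr_sumr; apply: ler_sum => b _.
rewrite (cocycle_cat PC kl lm') /mat_mul mulr_suml; apply: ler_sum => c _.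
rewrite ler_wpM2l ?cocycle_ge0 // (cocycle_cat PC ll lm) /mat_mul.
by apply: ler_sum => e _; rewrite ler_peMl ?cocycle_ge0 // (cocycle_pos PC).
Qed.

Lemma q_ge1 k : 1 <= q k. Proof. exact: cocycle_norm_ge1. Qed.
Lemma q_gt0 k : 0 < q k. Proof. exact: lt_le_trans (q_ge1 k). Qed.
Lemma q_mono k l : (k <= l)%N -> q k <= q l.
Proof. by move=> kl; apply: cocycle_norm_monor. Qed.

Lemma q_double k : 2 * q k <= q (k + N0)%N.
Proof.
have := cocycle_norm_mul (leq0n k) (leqnn (k + N0)).
apply: le_trans; rewrite mulrC ler_wpM2l ?cocycle_norm_ge2 //.
exact: mat_norm_ge0.
Qed.

Lemma N0_gt0 : (0 < N0)%N.
Proof.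
case: N0 q_double => // /(_ 0%N); rewrite addn0 => h.
by have := q_ge1 0; lra.
Qed.

(** By [q_double] the norm doubles every [N0] levels, so the sums over consecutive windows of [N0]
    levels are dominated by a geometric series of ratio [2 ^ (-s)]. *)
Lemma q_sum (s : R) : 0 < s -> exists C, 0 < C /\
  forall k n, \sum_(i < n) q (k + i)%N `^ (- s) <= C * q k `^ (- s).
Proof.
move=> s0; pose rho : R := 2 `^ (- s).
have rho1 : rho < 1.
  rewrite /rho powRN invf_lt1 ?powR_gt0 //.
  have e1 : 1 `^ s = 1 by rewrite powR1.
  by rewrite -[ltLHS]e1; apply: gt0_ltr_powR; rewrite ?nnegrE //; lra.
have rho0 : 0 < rho by rewrite powR_gt0.
have N0R : 0 < N0%:R :> R by rewrite ltr0n N0_gt0.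
(* The solution of [N0 + C * rho = C]: one window plus the bound for the levels after it. *)
pose C := N0%:R / (1 - rho); have C0 : 0 < C by rewrite divr_gt0 // subr_gt0.
have CE : N0%:R + C * rho = C by rewrite /C; field; rewrite subr_eq0 eq_sym lt_eqF.
clearbody C.
have term k i : q (k + i)%N `^ (- s) <= q k `^ (- s).
  by apply: powR_monolN; rewrite ?q_gt0 ?q_mono ?leq_addr // ltW.
have small k n : (n <= N0)%N -> \sum_(i < n) q (k + i)%N `^ (- s) <= N0%:R * q k `^ (- s).
  move=> nN; apply: (@le_trans _ _ (\sum_(i < n) q k `^ (- s))); first by apply: ler_sum.
  by rewrite sum_ord_cst ler_wpM2r ?powR_ge0 // ler_nat.
exists C; split=> // k n; elim/ltn_ind: n k => n IH k.
have [nN|Nn] := leqP n N0.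
  by apply: (le_trans (small _ _ nN)); rewrite ler_wpM2r ?powR_ge0 // -CE lerDl mulr_ge0 ?ltW.
have -> : n = (N0 + (n - N0))%N by lia.
rewrite big_split_ord /= -CE mulrDl; apply: lerD; first exact: small.
have lt : (n - N0 < n)%N by have := N0_gt0; lia.
under eq_bigr do rewrite addnA.
apply: (le_trans (IH _ lt _)); rewrite -mulrA ler_wpM2l ?(ltW C0) //.
rewrite /rho -powRM ?(ltW (q_gt0 _)) //.
by apply: powR_monolN; rewrite ?mulr_gt0 ?q_gt0 ?q_double // ltW.
Qed.

(** Cramer's rule: the determinant is a nonzero integer, and the cofactors are bounded by [(d - 1)!]
    times the power [d - 1] of the norm. *)
Lemma cocycle_inverse : exists (C p : R), [/\ 0 < C, 0 <= p &
  forall k v, exists u, tapply (P 0%N k) u = v /\ vec_norm u <= C * q k `^ p * vec_norm v].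
Proof.
(* One factor [d] comes from summing the coordinates in [vec_norm], the other from the [d] terms of
   each coordinate of the adjugate times [v]. *)
pose d := #|A|; exists (d%:R * (d%:R * (d.-1)`!%:R)), d.-1%:R.
have d0 : 0 < d%:R :> R by have := card_ge2; rewrite -/d; lra.
split => //; first by rewrite !mulr_gt0 // ltr0n fact_gt0.
move=> k v.
(* The transpose is taken because [tapply] acts by the transposed matrix. *)
pose M : 'M[R]_d := \matrix_(i, j) P 0%N k (enum_val j) (enum_val i).
pose V : 'cV[R]_d := \col_i v (enum_val i).
have entry i j : `|M i j| <= q k by rewrite mxE le_mat_norm.
have sumE (F : A -> R) : \sum_a F a = \sum_(i < d) F (enum_val i).
  by rewrite -[RHS](@big_enum_val _ _ _ A A F).
have mulE (x : 'cV[R]_d) : tapply (P 0%N k) (fun a => x (enum_rank a) 0) =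
    fun a => (M *m x) (enum_rank a) 0.
  apply: funext => a; rewrite /tapply sumE mxE; apply: eq_bigr => i _.
  by rewrite mxE enum_valK enum_rankK.
have det_int : \det M \is a Num.int.
  rewrite /determinant; apply: rpred_sum => s _; apply: rpredM; first exact: rpred_sign.
  by apply: rpred_prod => i _; rewrite mxE intr_nat // (cocycle_nat PC).
have det_neq0 : \det M != 0.
  have [N MN] := cocycle_inv PC (leq0n k).
  pose N' : 'M[R]_d := \matrix_(i, j) N (enum_val j) (enum_val i).
  have e : N' *m M = 1%:M.
    apply/matrixP => i j; rewrite !mxE.
    have := congr1 (fun F => F (enum_val j) (enum_val i)) MN.
    rewrite /mat_mul /mat_id sumE (inj_eq enum_val_inj) eq_sym => <-.
    by apply: eq_bigr => c _; rewrite !mxE mulrC.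
  have := congr1 determinant e; rewrite det_mulmx det1 => h.
  by apply/eqP => h0; move: h; rewrite h0 mulr0 => /eqP; rewrite eq_sym oner_eq0.
have det1 : 1 <= `|\det M| by rewrite norm_intr_ge1.
pose x := (\det M)^-1 *: (\adj M *m V).
exists (fun a => x (enum_rank a) 0); split.
  rewrite mulE /x -scalemxAr mulmxA mul_mx_adj mul_scalar_mx scalerA mulVf // scale1r.
  by apply: funext => a; rewrite mxE enum_rankK.
have adj i j : `|\adj M i j| <= (d.-1)`!%:R * q k `^ d.-1%:R.
  rewrite mxE /cofactor normrM normrX normrN1 expr1n mul1r /determinant.
  apply: (le_trans (ler_norm_sum _ _ _)).
  apply: (@le_trans _ _ (\sum_(s : 'S_(d.-1)) q k `^ d.-1%:R)).
    apply: ler_sum => s _; rewrite normrM normrX normrN1 expr1n mul1r normr_prod.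
    apply: (@le_trans _ _ (\prod_(i < d.-1) q k)).
      by apply: ler_prod => t _; rewrite normr_ge0 /= !mxE le_mat_norm.
    by rewrite prodr_const card_ord powR_mulrn // mat_norm_ge0.
  by rewrite sumr_const card_Sn mulr_natl.
rewrite -!mulrA; apply: vec_norm_le => a; rewrite /x !mxE normrM normfV.
apply: (@le_trans _ _ `|\sum_j \adj M (enum_rank a) j * V j 0|).
  by rewrite ler_piMl // invf_le1 // (lt_le_trans ltr01).
apply: (le_trans (ler_norm_sum _ _ _)).
apply: (@le_trans _ _ (\sum_(j < d) (d.-1)`!%:R * q k `^ d.-1%:R * vec_norm v)).
  apply: ler_sum => j _; rewrite normrM; apply: ler_pM => //.
  by rewrite mxE le_vec_norm.
by rewrite sum_ord_cst -!mulrA.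
Qed.

End CocycleGrowth.

(** * Consequences of the Roth conditions (a) and (b) *)

(** Every [x n - r n] lies below every [x m + r m], so the supremum of the former is within [r n] of
    each [x n]. *)
Lemma dominated_limit (R : realType) (x r : nat -> R) :
  (forall n m, (n <= m)%N -> `|x m - x n| <= r n) -> exists l, forall n, `|l - x n| <= r n.
Proof.
move=> h.
have hnm n m : x n - r n <= x m + r m.
  have r0 i : 0 <= r i by apply: le_trans (h i i (leqnn i)).
  case: (leqP n m) => nm.
    by have := h n m nm; have := r0 m; rewrite ler_norml => ? /andP[]; lra.
  by have := h m n (ltnW nm); have := r0 n; rewrite ler_norml => ? /andP[]; lra.
pose E := [set y | exists n, y = x n - r n]%classic.
have E0 : (E !=set0)%classic by exists (x 0%N - r 0%N), 0%N.
have ubE m : ubound E (x m + r m) by move=> _ [n ->].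
exists (sup E) => n; rewrite ler_norml; apply/andP; split.
  have : x n - r n <= sup E.
    by apply: ub_le_sup; [exists (x 0%N + r 0%N)|exists n].
  lra.
have : sup E <= x n + r n by apply: ge_sup.
lra.
Qed.

Section RothGrowth.
Variables (R : realType) (A : finType).
Variables (P : nat -> nat -> mat R A) (lam : nat -> A -> R) (N0 : nat).
Hypothesis cardA2 : (2 <= #|A|)%N.
Hypothesis PC : positive_cocycle P lam N0.
Notation q k := (mat_norm (P 0%N k)).
Hypothesis rothA : forall eps : R, 0 < eps -> exists C : R, forall k,
  mat_norm (P k k.+1) <= C * q k `^ eps.

Let q1 k : 1 <= q k. Proof. exact: (q_ge1 cardA2 PC). Qed.
Let q0 k : 0 < q k. Proof. exact: (q_gt0 cardA2 PC). Qed.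

Lemma q_le_step k n : q (k + n)%N <= q k * mat_norm (P k (k + n)).
Proof. by apply: (cocycle_norm_sub PC) => //; lia. Qed.

Lemma rothA_gt0 (eps : R) : 0 < eps -> exists C : R, 0 < C /\ forall k,
  mat_norm (P k k.+1) <= C * q k `^ eps.
Proof.
move=> /rothA[C h]; exists (`|C| + 1); split; first by rewrite ltr_wpDl.
by move=> k; apply: (le_trans (h k)); rewrite ler_wpM2r ?powR_ge0 //; have := ler_norm C; lra.
Qed.

(** Condition (a) iterated over [n] levels. The norm at level [k + n] is at most a constant times
    the square of that at level [k], so an exponent [eps / 4] there costs [eps / 2] here. *)
Lemma cocycle_subpoly n (eps : R) : 0 < eps -> exists C : R, 0 < C /\ forall k,
  mat_norm (P k (k + n)) <= C * q k `^ eps.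
Proof.
elim: n eps => [|n IH] eps e0.
  exists (mat_norm (P 0%N 0%N)); split => // k.
  rewrite addn0 !(cocycle_id PC) ler_peMr ?mat_norm_ge0 // powR_ge1 ?q1 // ltW //.
have e2 : 0 < eps / 2 by lra.
have e4 : 0 < eps / 4 by lra.
have [C [C0 hC]] := IH _ e2.
have [C1 [C10 hC1]] := IH 1 ltr01.
have [D [D0 hD]] := rothA_gt0 e4.
exists (C * (D * C1 `^ (eps / 4))); split; first by rewrite !mulr_gt0 // powR_gt0.
move=> k; rewrite addnS.
have h1 : mat_norm (P k (k + n).+1) <= mat_norm (P k (k + n)) * mat_norm (P (k + n)%N (k + n).+1).
  by apply: (cocycle_norm_sub PC) => //; lia.
apply: (le_trans h1).
have h2 : q (k + n)%N <= C1 * q k `^ 2.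
  apply: (le_trans (q_le_step k n)).
  have -> : C1 * q k `^ 2 = q k * (C1 * q k `^ 1).
    by rewrite (_ : 2 = 1 + 1) // powR_add // powRr1 ?(ltW (q0 _)) //; ring.
  by rewrite ler_wpM2l ?hC1 // ltW.
have h3 : q (k + n)%N `^ (eps / 4) <= C1 `^ (eps / 4) * q k `^ (eps / 2).
  apply: (@le_trans _ _ ((C1 * q k `^ 2) `^ (eps / 4))).
    by apply: powR_monol => //; exact: ltW.
  rewrite powRM ?powR_ge0 ?(ltW C10) // -powRrM.
  by rewrite (_ : 2 * (eps / 4) = eps / 2) //; field.
have -> : C * (D * C1 `^ (eps / 4)) * q k `^ eps =
    C * q k `^ (eps / 2) * (D * (C1 `^ (eps / 4) * q k `^ (eps / 2))).
  have -> : q k `^ eps = q k `^ (eps / 2) * q k `^ (eps / 2).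
    by rewrite -powR_add //; congr (_ `^ _); field.
  by ring.
apply: ler_pM; rewrite ?mat_norm_ge0 ?hC //.
by apply: (le_trans (hD _)); rewrite ler_wpM2l ?(ltW D0).
Qed.

Lemma q_step : exists C : R, 0 < C /\ forall k, q k.+1 <= C * q k `^ 2.
Proof.
have [C [C0 hC]] := cocycle_subpoly 1 ltr01.
exists C; split=> // k; rewrite -addn1; apply: (le_trans (q_le_step k 1)).
have -> : C * q k `^ 2 = q k * (C * q k `^ 1).
  by rewrite (_ : 2 = 1 + 1) // powR_add // powRr1 ?(ltW (q0 _)) //; ring.
by rewrite ler_wpM2l ?hC // ltW.
Qed.

(** A decay expressed at level [k] becomes one at level [k.+1] with half the exponent, since
    [q_step] bounds the norm by a square. *)
Lemma powR_q_step (s : R) : 0 < s -> exists C : R, 0 < C /\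
  forall k, q k `^ (- s) <= C * q k.+1 `^ (- (s / 2)).
Proof.
move=> s0; have [C [C0 hC]] := q_step.
exists (C `^ (s / 2)); split; first by rewrite powR_gt0.
move=> k; rewrite !powRN ler_pdivlMr ?powR_gt0 // mulrC ler_pdivrMr ?powR_gt0 //.
apply: (@le_trans _ _ ((C * q k `^ 2) `^ (s / 2))).
  by apply: powR_monol; [exact: ltW|exact: hC|lra].
rewrite powRM ?powR_ge0 ?(ltW C0) // -powRrM.
by rewrite (_ : 2 * (s / 2) = s) //; field.
Qed.

(** Up to the subpolynomial factor of [N0] levels, the norm from [k] to [l] is the quotient of the
    norms at [l] and at [k], by [cocycle_norm_mul]. *)
Lemma cocycle_norm_bound (eps : R) : 0 < eps -> exists C : R, 0 < C /\
  forall k l, (k <= l)%N -> mat_norm (P k l) <= C * q l * q k `^ (eps - 1).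
Proof.
move=> e0; have [C [C0 hC]] := cocycle_subpoly N0 e0.
exists C; split=> // k l kl.
have qE : q k `^ (eps - 1) = q k `^ eps * (q k)^-1.
  by rewrite powR_add // powR_inv1 // ltW.
rewrite qE [X in _ <= X](_ : _ = C * q k `^ eps * (q l / q k)); last by ring.
have [lt|ge] := ltnP l (k + N0).
  apply: (@le_trans _ _ (C * q k `^ eps)).
    apply: (le_trans _ (hC k)); apply: (cocycle_norm_monor PC) => //; exact: ltnW.
  rewrite ler_peMr ?mulr_ge0 ?powR_ge0 ?(ltW C0) // ler_pdivlMr // mul1r.
  exact: (q_mono PC).
apply: (@le_trans _ _ (mat_norm (P k (k + N0)) * mat_norm (P (k + N0)%N l))).
  by apply: (cocycle_norm_sub PC) => //; lia.
apply: ler_pM; rewrite ?mat_norm_ge0 ?hC // ler_pdivlMr // mulrC.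
exact: (cocycle_norm_mul PC).
Qed.

(** By positivity, the norm at level [k] times the total length at level [k + N0] is at most the
    initial total length; (a) compares the lengths at levels [k] and [k + N0]. *)
Lemma cocycle_lam_bound (eps : R) : 0 < eps -> exists C : R, 0 < C /\
  forall k a, lam k a <= C * q k `^ (eps - 1).
Proof.
move=> e0; have [C [C0 hC]] := cocycle_subpoly N0 e0.
have lam0 k a := ltW (cocycle_lam_gt0 PC k a).
pose Lam := \sum_a lam 0%N a; have Lam0 : 0 <= Lam by rewrite sumr_ge0.
exists (C * (Lam + 1)); split; first by rewrite mulr_gt0 //; lra.
move=> k a; pose t := \sum_b lam (k + N0)%N b.
have t0 : 0 <= t by rewrite sumr_ge0.
have kN : (k <= k + N0)%N by lia.
have h1 : lam k a <= mat_norm (P k (k + N0)) * t.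
  rewrite (cocycle_lam PC a kN) /t mulr_sumr; apply: ler_sum => b _.
  by rewrite ler_wpM2r // (le_trans (ler_norm _)) // le_mat_norm.
have h2 : q k * t <= Lam.
  rewrite (cocycle_normE PC) // mulr_suml; apply: ler_sum => c _.
  rewrite (cocycle_lam PC c (leq0n k)) mulr_suml; apply: ler_sum => b _.
  rewrite ler_wpM2l ?(cocycle_ge0 PC) // (cocycle_lam PC b kN).
  by apply: ler_sum => e _; rewrite ler_peMl // (cocycle_pos PC).
apply: (le_trans h1).
have -> : C * (Lam + 1) * q k `^ (eps - 1) = C * q k `^ eps * ((Lam + 1) / q k).
  by rewrite powR_add // powR_inv1 ?(ltW (q0 _)) //; ring.
apply: ler_pM; rewrite ?mat_norm_ge0 ?hC // ler_pdivlMr // mulrC.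
by apply: (le_trans h2); lra.
Qed.

(** Variation of constants: each error is transported from the level where it is made. *)
Lemma cocycle_recursion (v e : nat -> A -> R) :
  (forall k a, v k.+1 a = tapply (P k k.+1) (v k) a + e k a) ->
  forall k, v k = fun a => tapply (P 0%N k) (v 0%N) a + \sum_(j < k) tapply (P j.+1 k) (e j) a.
Proof.
move=> h; elim=> [|k IH].
  by rewrite (cocycle_id PC) tapply_id; apply: funext => a; rewrite big_ord0 addr0.
apply: funext => a; rewrite h IH tapplyD (tapply_sum _ k (fun j => tapply (P j.+1 k) (e j))).
rewrite big_ord_recr /= (cocycle_id PC) tapply_id addrA; congr (_ + _ + _).
  by rewrite -(tapply_cocycle PC).
by apply: eq_bigr => j _; rewrite -(tapply_cocycle PC) // ltn_ord.
Qed.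

(** The lengths are transported by the matrices and the vectors by their transposes, so the pairing,
    which is a mean value, is conserved. *)
Lemma lam_tapply k l v : (k <= l)%N ->
  \sum_a lam l a * tapply (P k l) v a = \sum_a lam k a * v a.
Proof.
move=> kl; under [RHS]eq_bigr do rewrite (cocycle_lam PC _ kl) mulr_suml.
rewrite exchange_big /=; apply: eq_bigr => a _; rewrite /tapply mulr_sumr.
by apply: eq_bigr => b _; ring.
Qed.

Lemma sum_bound (s : R) : 0 < s -> exists C : R, 0 < C /\
  forall (k : nat) (x : nat -> R) (c : R), 0 <= c ->
  (forall j, (j < k)%N -> x j <= c * q j.+1 `^ (- s)) -> \sum_(j < k) x j <= c * C.
Proof.
move=> s0; have [C [C0 hC]] := q_sum cardA2 PC s0; exists C; split=> // k x c c0 h.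
apply: (@le_trans _ _ (\sum_(j < k) c * q (0 + j)%N `^ (- s))).
  apply: ler_sum => j _; apply: (le_trans (h j (ltn_ord j))); rewrite ler_wpM2l //.
  by apply: powR_monolN; [exact: q0|exact: (q_mono PC)|exact: ltW].
rewrite -mulr_sumr ler_wpM2l //; apply: (le_trans (hC 0%N k)).
rewrite ler_piMr ?(ltW C0) // powR_le1 ?q1 //; lra.
Qed.

Section Centered.
Hypothesis rothB : exists theta C : R, 0 < theta /\ 0 < C /\ forall k (v : A -> R),
  \sum_(a : A) lam 0%N a * v a = 0 ->
  vec_norm (tapply (P 0%N k) v) <= C * q k `^ (1 - theta) * vec_norm v.

(** The errors are centered but arise at all levels. Each is bounded at level [k] by the norm of the
    cocycle ([b1]), and by lifting it to a centered vector at level 0 and applying (b) there ([b2]);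
    interpolation makes the sum converge while keeping a power saving. *)
Lemma centered_growth (v e : nat -> A -> R) (B : R) :
  (forall k a, v k.+1 a = tapply (P k k.+1) (v k) a + e k a) ->
  \sum_a lam 0%N a * v 0%N a = 0 ->
  (forall k, \sum_a lam k.+1 a * e k a = 0) ->
  (forall k, vec_norm (e k) <= B * mat_norm (P k k.+1)) ->
  exists theta C : R, [/\ 0 < theta, theta <= 1, 0 < C &
    forall k, vec_norm (v k) <= C * q k `^ (1 - theta)].
Proof.
move=> rec v0 e0 eB.
have [th0 [Cb [th00 [Cb0 hB]]]] := rothB.
pose th := Num.min th0 1.
have th_gt0 : 0 < th by rewrite lt_min th00 ltr01.
have th_le1 : th <= 1 by rewrite ge_min lexx orbT.
have {}hB k u : \sum_(a : A) lam 0%N a * u a = 0 ->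
    vec_norm (tapply (P 0%N k) u) <= Cb * q k `^ (1 - th) * vec_norm u.
  move=> /hB h; apply: (le_trans (h k)); rewrite ler_wpM2r ?vec_norm_ge0 //.
  rewrite ler_wpM2l ?(ltW Cb0) //; apply: powR_mono => //.
  by rewrite lerD2l lerN2 ge_min lexx.
have [Ci [p [Ci0 p0 inv]]] := cocycle_inverse cardA2 PC.
have s4 : 0 < 1/4 :> R by lra.
have [Ca [Ca0 hA]] := rothA_gt0 s4.
have [Cn [Cn0 hn]] := cocycle_norm_bound s4.
have [Cs [Cs0 hs]] := sum_bound s4.
pose D := (`|B| + 1) * Ca.
have D0 : 0 < D by rewrite mulr_gt0 // ltr_wpDl.
have eD k : vec_norm (e k) <= D * q k.+1 `^ (1/4).
  apply: (le_trans (eB k)); rewrite /D -mulrA.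
  apply: (@le_trans _ _ ((`|B| + 1) * mat_norm (P k k.+1))).
    by rewrite ler_wpM2r ?mat_norm_ge0 //; have := ler_norm B; lra.
  apply: ler_wpM2l; first by rewrite addr_ge0.
  apply: (le_trans (hA k)); rewrite ler_wpM2l ?(ltW Ca0) //.
  by apply: powR_monol; [exact: ltW|exact: (q_mono PC)|lra].
pose c := Cn * D + Cb * Ci * D.
have c0 : 0 < c by rewrite addr_gt0 ?mulr_gt0.
(* Small enough that the loss of exponent [p] in [b2] leaves at least the decay of exponent 1/4 of
   the level of the error, and the saving becomes [t * th]. *)
pose t : R := (4 * (p + 1))^-1.
have t0 : 0 < t by rewrite invr_gt0; lra.
have tp : t * (p + 1) = 1/4 by rewrite /t; field; lra.
have t1 : t <= 1 by nra.
exists (t * th), (Cb * (vec_norm (v 0%N) + 1) + c * Cs).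
have vn := vec_norm_ge0 (v 0%N).
split; first by rewrite mulr_gt0.
- by nra.
- by rewrite addr_gt0 ?mulr_gt0 //; lra.
move=> k; rewrite (cocycle_recursion rec k).
apply: (le_trans (vec_normD _ _)); rewrite mulrDl; apply: lerD.
  apply: (le_trans (hB k _ v0)); rewrite -!mulrA ler_wpM2l ?(ltW Cb0) // mulrC.
  apply: ler_pM; rewrite ?powR_ge0 //; first by lra.
  by apply: powR_mono => //; nra.
apply: (le_trans (vec_norm_sum _ (fun j => tapply (P j.+1 k) (e j)))).
rewrite mulrAC; apply: (hs k (fun j => vec_norm (tapply (P j.+1 k) (e j)))); first by rewrite mulr_ge0 ?powR_ge0 // ltW.
move=> j jk /=; set J := j.+1.
have b1 : vec_norm (tapply (P J k) (e j)) <= c * q k `^ 1 * q J `^ (- (1/2)).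
  apply: (le_trans (tapply_norm _ _)).
  apply: (@le_trans _ _ ((Cn * q k * q J `^ (1/4 - 1)) * (D * q J `^ (1/4)))).
    by apply: ler_pM; rewrite ?mat_norm_ge0 ?vec_norm_ge0 // hn.
  have -> : q J `^ (- (1/2)) = q J `^ (1/4 - 1) * q J `^ (1/4).
    by rewrite -powR_add //; congr (_ `^ _); field.
  rewrite powRr1 ?(ltW (q0 _)) //.
  have x0 : 0 <= q k * (q J `^ (1/4 - 1) * q J `^ (1/4)) by rewrite !mulr_ge0 ?powR_ge0 ?(ltW (q0 _)).
  have : 0 <= Cb * Ci * D * (q k * (q J `^ (1/4 - 1) * q J `^ (1/4))).
    by rewrite mulr_ge0 // ltW // !mulr_gt0.
  rewrite /c; move: (q J `^ _) (q J `^ _) => y z; lra.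
have b2 : vec_norm (tapply (P J k) (e j)) <= c * q k `^ (1 - th) * q J `^ (p + 1/4).
  have [u [Su nu]] := inv J (e j).
  (* The lift is centered because the mean is conserved; this is what makes (b) applicable to it. *)
  have u0 : \sum_a lam 0%N a * u a = 0 by rewrite -(lam_tapply _ (leq0n J)) Su e0.
  rewrite -Su -(tapply_cocycle PC) //.
  apply: (le_trans (hB k _ u0)).
  apply: (@le_trans _ _ (Cb * q k `^ (1 - th) * (Ci * q J `^ p * (D * q J `^ (1/4))))).
    rewrite ler_wpM2l ?mulr_ge0 ?powR_ge0 ?(ltW Cb0) //.
    by apply: (le_trans nu); rewrite ler_wpM2l ?mulr_ge0 ?powR_ge0 ?(ltW Ci0) // eD.
  rewrite powR_add //.
  have : 0 <= Cn * D * (q k `^ (1 - th) * (q J `^ p * q J `^ (1/4))).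
    by rewrite !mulr_ge0 ?powR_ge0 // ltW.
  rewrite /c; move: (q J `^ _) (q J `^ _) (q k `^ _) => x y z; lra.
have t01 : 0 <= t <= 1 by apply/andP; split; lra.
apply: (le_trans (interpolation c0 (q0 k) (q0 J) t01 b1 b2)).
have -> : (1 - t) * 1 + t * (1 - th) = 1 - t * th by ring.
rewrite ler_wpM2l ?mulr_ge0 ?powR_ge0 ?(ltW c0) //; apply: powR_mono => //.
have -> : (1 - t) * - (1/2) + t * (p + 1/4) = t * (p + 1) - 1/2 - t * (1/4) by field.
by rewrite tp; lra.
Qed.

End Centered.
End RothGrowth.

(** * Stable spaces and condition (c) *)

Section RothCorrection.
Variables (R : realType) (A : finType).
Variables (P : nat -> nat -> mat R A) (lam : nat -> A -> R) (N0 : nat).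
Hypothesis cardA2 : (2 <= #|A|)%N.
Hypothesis PC : positive_cocycle P lam N0.
Notation q k := (mat_norm (P 0%N k)).
Notation S k l := (tapply (P k l)).

Let q1 k : 1 <= q k. Proof. exact: (q_ge1 cardA2 PC). Qed.
Let q0 k : 0 < q k. Proof. exact: (q_gt0 cardA2 PC). Qed.
Let P1 k l : (k <= l)%N -> 1 <= mat_norm (P k l).
Proof. exact: (cocycle_norm_ge1 cardA2 PC). Qed.
Let P0 k l : (k <= l)%N -> 0 < mat_norm (P k l).
Proof. by move=> kl; exact: lt_le_trans (P1 kl). Qed.

(** The counterpart of [Gamma_s] for an abstract cocycle, and [stable_norm] that of [qnorm]; for
    [Qkl s nk] they are the same by conversion. *)
Definition stable k (v : A -> R) : Prop :=
  exists sigma C : R, 0 < sigma /\ 0 < C /\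
    forall l, (k <= l)%N -> vec_norm (S k l v) <= C * mat_norm (P k l) `^ (- sigma) * vec_norm v.

Definition stable_norm k (v : A -> R) : R :=
  inf [set vec_norm (fun a => v a - g a) | g in stable k]%classic.

(** The constant may absorb the norm of [v]; in this form sums and images of stable vectors are
    treated without normalizing. *)
Lemma stableP k v : stable k v <-> exists sigma C : R, 0 < sigma /\ 0 <= C /\
  forall l, (k <= l)%N -> vec_norm (S k l v) <= C * mat_norm (P k l) `^ (- sigma).
Proof.
split=> [[s [C [s0 [C0 h]]]]|[s [C [s0 [C0 h]]]]].
  exists s, (C * vec_norm v); split=> //; split; first by rewrite mulr_ge0 ?vec_norm_ge0 // ltW.
  by move=> l kl; apply: (le_trans (h l kl)); rewrite mulrAC.
have [v0|v0] := eqVneq (vec_norm v) 0.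
  exists s, 1; do 2 split=> //; move=> l kl.
  by rewrite v0 mulr0; apply: (le_trans (tapply_norm _ _)); rewrite v0 mulr0.
have vp : 0 < vec_norm v by rewrite lt0r v0 vec_norm_ge0.
exists s, ((C + 1) / vec_norm v); split=> //; split; first by rewrite divr_gt0 //; lra.
move=> l kl; apply: (le_trans (h l kl)).
have -> : (C + 1) / vec_norm v * mat_norm (P k l) `^ (- s) * vec_norm v =
  (C + 1) * mat_norm (P k l) `^ (- s) by field.
by rewrite ler_wpM2r ?powR_ge0 //; lra.
Qed.

Lemma stable0 k : stable k (fun=> 0).
Proof.
apply/stableP; exists 1, 0; do 2 split => //; move=> l kl.
by apply: (le_trans (tapply_norm _ _)); rewrite vec_norm0 mulr0 mul0r.
Qed.

Lemma stableD k u v : stable k u -> stable k v -> stable k (fun a => u a + v a).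
Proof.
move=> /stableP[s [C [s0 [C0 h]]]] /stableP[s' [C' [s'0 [C'0 h']]]]; apply/stableP.
exists (Num.min s s'), (C + C'); split; first by rewrite lt_min s0.
split; first by rewrite addr_ge0.
move=> l kl; rewrite tapplyD; apply: (le_trans (vec_normD _ _)); rewrite mulrDl.
apply: lerD.
  apply: (le_trans (h l kl)); rewrite ler_wpM2l //; apply: powR_mono; first exact: P1.
  by rewrite lerN2 ge_min lexx.
apply: (le_trans (h' l kl)); rewrite ler_wpM2l //; apply: powR_mono; first exact: P1.
by rewrite lerN2 ge_min lexx orbT.
Qed.

Lemma stableZ k c v : stable k v -> stable k (fun a => c * v a).
Proof.
move=> /stableP[s [C [s0 [C0 h]]]]; apply/stableP.
exists s, (`|c| * C); split=> //; split; first by rewrite mulr_ge0.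
by move=> l kl; rewrite tapplyZ vec_normZ -mulrA ler_wpM2l ?h.
Qed.

Lemma stableN k v : stable k v -> stable k (fun a => - v a).
Proof.
move=> /(stableZ (-1)); congr stable; apply: funext => a; exact: mulN1r.
Qed.

Lemma stableB k u v : stable k u -> stable k v -> stable k (fun a => u a - v a).
Proof. by move=> su /stableN; exact: stableD. Qed.

Lemma stable_sum k n (f : nat -> A -> R) : (forall i, (i < n)%N -> stable k (f i)) ->
  stable k (fun a => \sum_(i < n) f i a).
Proof.
elim: n => [|n IH] h.
  by rewrite (_ : (fun _ => _) = fun=> 0); [exact: stable0|apply: funext => a; rewrite big_ord0].
rewrite (_ : (fun _ => _) = fun a => (\sum_(i < n) f i a) + f n a).
  by apply: stableD; [apply: IH => i ni; apply: h; lia|apply: h].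
by apply: funext => a; rewrite big_ord_recr.
Qed.

(** A shorter product has smaller norm, so a negative power of it is a weaker bound. *)
Lemma stable_fwd k l v : (k <= l)%N -> stable k v -> stable l (S k l v).
Proof.
move=> kl /stableP[s [C [s0 [C0 h]]]]; apply/stableP; exists s, C; do 2 split=> //.
move=> m lm; rewrite -(tapply_cocycle PC) //; apply: (le_trans (h m (leq_trans kl lm))).
rewrite ler_wpM2l //; apply: powR_monolN; [exact: P0| |exact: ltW].
exact: (cocycle_norm_monol PC).
Qed.

(** Stability concerns only distant levels: beyond [l] the norms from [k] and from [l] differ by the
    factor [X] at most, and the levels below [l] are absorbed by the second term of the constant. *)
Lemma stable_bwd k l v : (k <= l)%N -> stable l (S k l v) -> stable k v.
Proof.
move=> kl /stableP[s [C [s0 [C0 h]]]]; apply/stableP.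
pose X := mat_norm (P k l); have X0 : 0 < X by exact: P0.
exists s, (C * X `^ s + X * vec_norm v * X `^ s); split=> //.
have c1 : 0 <= C * X `^ s by rewrite mulr_ge0 ?powR_ge0.
have c2 : 0 <= X * vec_norm v * X `^ s by rewrite !mulr_ge0 ?powR_ge0 ?vec_norm_ge0 // ltW.
split; first exact: addr_ge0.
move=> m km; have Pm := powR_ge0 (mat_norm (P k m)) (- s).
have [lm|lm] := leqP l m.
  apply: (@le_trans _ _ (C * X `^ s * mat_norm (P k m) `^ (- s))); last first.
    by rewrite ler_wpM2r //; lra.
  rewrite (tapply_cocycle PC _ kl lm); apply: (le_trans (h m lm)).
  rewrite -mulrA ler_wpM2l //.
  have -> : mat_norm (P l m) `^ (- s) = X `^ s * (X * mat_norm (P l m)) `^ (- s).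
    rewrite powRM ?mat_norm_ge0 // mulrA -powR_add // subrr powRr0 mul1r //.
  rewrite ler_wpM2l ?powR_ge0 //; apply: powR_monolN; [exact: P0| |exact: ltW].
  exact: (cocycle_norm_sub PC).
apply: (@le_trans _ _ (X * vec_norm v * X `^ s * mat_norm (P k m) `^ (- s))); last first.
  by rewrite ler_wpM2r //; lra.
apply: (le_trans (tapply_norm _ _)).
have le : mat_norm (P k m) <= X by apply: (cocycle_norm_monor PC) => //; exact: ltnW.
apply: (@le_trans _ _ (X * vec_norm v)); first by rewrite ler_wpM2r ?vec_norm_ge0.
rewrite -[leRHS]mulrA ler_peMr ?mulr_ge0 ?vec_norm_ge0 ?(ltW X0) //.
apply: (@le_trans _ _ (X `^ s * X `^ (- s))).
  by rewrite -powR_add // subrr powRr0.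
by rewrite ler_wpM2l ?powR_ge0 //; apply: powR_monolN; [exact: P0| |exact: ltW].
Qed.

Lemma has_inf_stable k v :
  has_inf [set vec_norm (fun a => v a - g a) | g in stable k]%classic.
Proof.
split; first by exists (vec_norm (fun a => v a - 0)), (fun=> 0) => //; exact: stable0.
by exists 0 => _ [g _ <-]; exact: vec_norm_ge0.
Qed.

Lemma stable_norm_le k v g : stable k g -> stable_norm k v <= vec_norm (fun a => v a - g a).
Proof. by move=> sg; apply: ge_inf; [have [] := has_inf_stable k v|exists g]. Qed.

Lemma stable_norm_le_norm k v : stable_norm k v <= vec_norm v.
Proof.
apply: (le_trans (stable_norm_le v (stable0 k))).
by rewrite le_eqVlt; apply/orP; left; apply/eqP; congr vec_norm; apply: funext => a; rewrite subr0.
Qed.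

Lemma stable_norm_adherent k v (d : R) : 0 < d ->
  exists g, stable k g /\ vec_norm (fun a => v a - g a) <= stable_norm k v + d.
Proof.
move=> d0; have [_ [g sg <-] h] := inf_adherent d0 (has_inf_stable k v).
by exists g; split=> //; exact: ltW.
Qed.

Lemma stable_normD k u v :
  stable_norm k (fun a => u a + v a) <= stable_norm k u + stable_norm k v.
Proof.
apply/ler_addgt0Pr => d d0; have d2 : 0 < d / 2 by lra.
have [g [sg hg]] := stable_norm_adherent k u d2.
have [g' [sg' hg']] := stable_norm_adherent k v d2.
apply: (le_trans (stable_norm_le _ (stableD sg sg'))).
rewrite (_ : (fun _ => _) = fun a => (u a - g a) + (v a - g' a)).
  by apply: (le_trans (vec_normD _ _)); lra.
by apply: funext => a; ring.
Qed.

Lemma stable_norm_sum k n (f : nat -> A -> R) :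
  stable_norm k (fun a => \sum_(i < n) f i a) <= \sum_(i < n) stable_norm k (f i).
Proof.
elim: n => [|n IH].
  rewrite big_ord0 (_ : (fun _ => _) = fun=> 0); last by apply: funext => a; rewrite big_ord0.
  by apply: (le_trans (stable_norm_le_norm _ _)); rewrite vec_norm0.
rewrite big_ord_recr /= (_ : (fun _ => _) = fun a => (\sum_(i < n) f i a) + f n a).
  by apply: (le_trans (stable_normD _ _ _)); rewrite lerD2r.
by apply: funext => a; rewrite big_ord_recr.
Qed.

Lemma uniform_decay_family n (f : nat -> A -> R) : (forall i, (i < n)%N -> stable 0%N (f i)) ->
  exists sigma C : R, [/\ 0 < sigma, 0 < C & forall i l, (i < n)%N ->
    vec_norm (S 0%N l (f i)) <= C * q l `^ (- sigma)].
Proof.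
elim: n => [|n IH] h; first by exists 1, 1.
have [|s [C [s0 C0 hs]]] := IH; first by move=> i ni; apply: h; lia.
have /stableP[s' [C' [s'0 [C'0 hs']]]] := h n (ltnSn n).
exists (Num.min s s'), (C + C'); split; first by rewrite lt_min s0.
  by lra.
move=> i l; rewrite ltnS leq_eqVlt => /orP[/eqP ->|ni].
  apply: (le_trans (hs' l (leq0n l))); apply: ler_pM; rewrite ?powR_ge0 //; first by lra.
  by apply: powR_mono => //; rewrite lerN2 ge_min lexx orbT.
apply: (le_trans (hs i l ni)); apply: ler_pM; rewrite ?powR_ge0 ?(ltW C0) //; first by lra.
by apply: powR_mono => //; rewrite lerN2 ge_min lexx.
Qed.

(* A stable vector is a combination, with coefficients linear in it, of finitely many stable ones. *)
Lemma uniform_decay : exists sigma C : R, [/\ 0 < sigma, 0 < C & forall l v, stable 0%N v ->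
    vec_norm (S 0%N l v) <= C * q l `^ (- sigma) * vec_norm v].
Proof.
pose vec (x : 'rV[R]_#|A|) : A -> R := fun a => x 0 (enum_rank a).
pose good n := exists m (B : 'M[R]_(m, #|A|)),
  (forall i, stable 0%N (vec (row i B))) /\ \rank B = n.
have ex : exists n, `[< good n >].
  exists 0%N; apply/asboolP; exists 0%N, 0; split; last exact: mxrank0.
  by case.
have bd n : `[< good n >] -> (n <= #|A|)%N.
  by move=> /asboolP[m [B [_ <-]]]; exact: rank_leq_col.
(* The stable rows of [B] have maximal rank; a stable vector outside their span would raise it, so
   they span all stable vectors. *)
have [n /asboolP[m [B [sB rB]]] nmax] := ex_maxnP ex bd.
have inB (x : 'rV[R]_#|A|) : stable 0%N (vec x) -> (x <= B)%MS.
  move=> sx; have /leqifP := mxrank_leqif_sup (addsmxSl B x).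
  case: ifP => [h _|_ lt]; first exact: submx_trans (addsmxSr B x) h.
  have : `[< good (\rank (col_mx B x)) >].
    apply/asboolP; exists (m + 1)%N, (col_mx B x); split=> // i.
    rewrite -(splitK i); case: (fintype.split i) => j /=.
      by rewrite rowKu.
    by rewrite rowKd (ord1 j) row_id.
  by move=> /nmax; rewrite -addsmxE -rB leqNgt lt.
(* Extension by zero beyond [m], because the lemmas on finite sums take families indexed by
   [nat]. *)
pose f i : A -> R := if insub i is Some j then vec (row j B) else fun=> 0.
have fE (i : 'I_m) : f i = vec (row i B) by rewrite /f valK.
have [|s [C [s0 C0 hs]]] := @uniform_decay_family m f.
  by move=> i im; rewrite -[i]/(val (Ordinal im)) fE.
(* The coefficients of a stable vector along the rows of [B] are obtained by the pseudo-inverse, so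
   [K] bounds them in terms of its norm. *)
pose K := \sum_j \sum_i `|pinvmx B j i|.
have K0 : 0 <= K by apply: sumr_ge0 => j _; exact: sumr_ge0.
exists s, (m%:R * (K * C) + 1); split=> //.
  by rewrite ltr_wpDl // !mulr_ge0 // ltW.
move=> l v sv; pose x : 'rV[R]_#|A| := \row_j v (enum_val j).
have xv : vec x = v by apply: funext => a; rewrite /vec mxE enum_rankK.
have /mulmxKpV xB : (x <= B)%MS by apply: inB; rewrite xv.
pose c i := (x *m pinvmx B) 0 i.
have vE : v = fun a => \sum_(i < m) c i * f i a.
  rewrite -{1}xv -xB; apply: funext => a; rewrite /vec mxE; apply: eq_bigr => i _.
  by rewrite fE /vec /c !mxE.
have cb i : `|c i| <= K * vec_norm v.
  rewrite /c mxE; apply: (le_trans (ler_norm_sum _ _ _)); rewrite /K mulr_suml.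
  apply: ler_sum => j _; rewrite normrM mulrC; apply: ler_pM => //.
    by rewrite (bigD1 i) //= lerDl sumr_ge0.
  by rewrite mxE le_vec_norm.
pose g i : A -> R := if insub i is Some j then fun a => c j * f i a else fun=> 0.
have gE (i : 'I_m) : g i = fun a => c i * f i a by rewrite /g valK.
have {1}-> : v = fun a => \sum_(i < m) g i a.
  by rewrite {1}vE; apply: funext => a; apply: eq_bigr => i _; rewrite gE.
rewrite tapply_sum; apply: (le_trans (vec_norm_sum m (fun i => S 0%N l (g i)))).
apply: (@le_trans _ _ (\sum_(i < m) K * vec_norm v * (C * q l `^ (- s)))).
  apply: ler_sum => i _; rewrite gE tapplyZ vec_normZ; apply: ler_pM => //.
    exact: vec_norm_ge0.
  exact: hs.
rewrite sum_ord_cst.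
have := vec_norm_ge0 v; have := powR_ge0 (q l) (- s).
move: (vec_norm v) (q l `^ _) => y z z0 y0.
have : 0 <= z * y by rewrite mulr_ge0.
lra.
Qed.

Lemma q_unbounded (X : R) k : exists m, (k <= m)%N /\ X <= q m.
Proof.
have h n : 2 ^+ n <= q (n * N0)%N.
  elim: n => [|n IH]; first by rewrite expr0 mul0n.
  rewrite exprS mulSn addnC; apply: le_trans (q_double cardA2 PC _).
  by rewrite ler_wpM2l.
pose n := (Num.truncn X).+1.
have Xn : X <= n%:R by rewrite ltW // truncnS_gt.
exists (maxn k (n * N0)); split; first exact: leq_maxl.
apply: (le_trans Xn); apply: (@le_trans _ _ (2 ^+ n)).
  by rewrite -natrX ler_nat ltnW // ltn_expl.
by apply: (le_trans (h n)); apply: (q_mono PC); exact: leq_maxr.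
Qed.

End RothCorrection.

(** * The correction vector furnished by condition (c) *)

Section Correction.
Variables (R : realType) (A : finType).
Variables (P : nat -> nat -> mat R A) (lam : nat -> A -> R) (N0 : nat).
Hypothesis cardA2 : (2 <= #|A|)%N.
Hypothesis PC : positive_cocycle P lam N0.
Notation q k := (mat_norm (P 0%N k)).
Notation S k l := (tapply (P k l)).
Hypothesis rothA : forall eps : R, 0 < eps -> exists C : R, forall k,
  mat_norm (P k k.+1) <= C * q k `^ eps.
Hypothesis rothC : forall eps : R, 0 < eps -> exists C : R, forall k l, (k <= l)%N ->
  (forall v : A -> R, stable_norm P k v <= C * q l `^ eps * stable_norm P l (S k l v)) /\
  (forall v : A -> R, stable P k v -> vec_norm (S k l v) <= C * q l `^ eps * vec_norm v).

Let q1 k : 1 <= q k. Proof. exact: (q_ge1 cardA2 PC). Qed.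
Let q0 k : 0 < q k. Proof. exact: (q_gt0 cardA2 PC). Qed.

Lemma stable_norm_ge0 k v : 0 <= stable_norm P k v.
Proof.
apply: lb_le_inf; first by have [] := has_inf_stable P k v.
by move=> _ [g _ <-]; exact: vec_norm_ge0.
Qed.

Lemma rothC_gt0 (eps : R) : 0 < eps -> exists C : R, 0 < C /\ forall k l, (k <= l)%N ->
  (forall v : A -> R, stable_norm P k v <= C * q l `^ eps * stable_norm P l (S k l v)) /\
  (forall v : A -> R, stable P k v -> vec_norm (S k l v) <= C * q l `^ eps * vec_norm v).
Proof.
move=> /rothC[C h]; exists (`|C| + 1); split; first by rewrite ltr_wpDl.
have CC : C <= `|C| + 1 by have := ler_norm C; lra.
move=> k l kl; have [h1 h2] := h k l kl; split=> v.
  apply: (le_trans (h1 v)); rewrite ler_wpM2r ?stable_norm_ge0 //.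
  by rewrite ler_wpM2r ?powR_ge0.
move=> sv; apply: (le_trans (h2 v sv)); rewrite ler_wpM2r ?vec_norm_ge0 //.
by rewrite ler_wpM2r ?powR_ge0.
Qed.

(** A lift of [e j] to level 0 may be large, but (c) bounds its distance to the stable space;
    subtracting a nearly closest stable vector leaves a small lift, valid modulo stable vectors.
    Half of the exponent [w] pays for (c). *)
Lemma stable_lift (w B : R) (e : nat -> A -> R) : 0 < w ->
  (forall j, vec_norm (e j) <= B * q j.+1 `^ (- w)) ->
  exists (u : nat -> A -> R) (c : R), 0 < c /\ forall j,
    stable P j.+1 (fun a => e j a - S 0%N j.+1 (u j) a) /\
    vec_norm (u j) <= c * q j.+1 `^ (- (w / 2)).
Proof.
move=> w0 eB; have w2 : 0 < w / 2 by lra.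
have [C [C0 hC]] := rothC_gt0 w2.
have [Ci [p [_ _ inv]]] := cocycle_inverse cardA2 PC.
(* The last 1 pays for approaching the infimum in [stable_norm] only up to [q j.+1 ^ (-w/2)]. *)
pose c := C * (`|B| + 1) + 1.
have c0 : 0 < c by rewrite ltr_wpDl // mulr_ge0 ?addr_ge0 // ltW.
suff /choice[u hu] : forall j, exists u : A -> R,
    stable P j.+1 (fun a => e j a - S 0%N j.+1 u a) /\
    vec_norm u <= c * q j.+1 `^ (- (w / 2)) by exists u, c.
move=> j; have [u' [Su' _]] := inv j.+1 (e j).
have d0 : 0 < q j.+1 `^ (- (w / 2)) by rewrite powR_gt0.
have [g [sg hg]] := stable_norm_adherent P 0%N u' d0.
exists (fun a => u' a - g a); split.
  have := stable_fwd cardA2 PC (leq0n j.+1) sg; congr stable.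
  by rewrite tapplyB Su'; apply: funext => a; ring.
apply: (le_trans hg); rewrite /c mulrDl mul1r lerD2r.
have [/(_ u') h _] := hC 0%N j.+1 (leq0n _).
apply: (le_trans h); rewrite Su'.
have -> : C * (`|B| + 1) * q j.+1 `^ (- (w / 2)) =
    C * q j.+1 `^ (w / 2) * ((`|B| + 1) * q j.+1 `^ (- w)).
  have -> : q j.+1 `^ (- (w / 2)) = q j.+1 `^ (w / 2) * q j.+1 `^ (- w).
    by rewrite -powR_add //; congr (_ `^ _); field.
  by ring.
rewrite ler_wpM2l ?mulr_ge0 ?powR_ge0 ?(ltW C0) //.
apply: (le_trans (stable_norm_le_norm _ _ _)).
apply: (le_trans (eB j)); rewrite ler_wpM2r ?powR_ge0 //.
by have := ler_norm B; lra.
Qed.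

(** With [chi] the sum of [v 0] and of all lifts [u j], the difference at level [k] is a stable
    vector minus the image of the tail of the series. The norm of this image is not controlled
    directly, but its quotient norm is: term [j] becomes [e j] modulo stable vectors at level
    [j.+1], and (c) brings the bound back to level [k]. *)
Lemma correction_mod_stable (w B : R) (v e : nat -> A -> R) : 0 < w ->
  (forall k a, v k.+1 a = S k k.+1 (v k) a + e k a) ->
  (forall j, vec_norm (e j) <= B * q j.+1 `^ (- w)) ->
  exists (chi : A -> R) (c : R), 0 < c /\ forall k, exists g, stable P k g /\
    vec_norm (fun a => (v k a - S 0%N k chi a) - g a) <= c * q k `^ (- (w / 2)).
Proof.
move=> w0 rec eB; have w2 : 0 < w / 2 by lra.
have [u [c [c0 hu]]] := stable_lift w0 eB.
have [C [C0 hC]] := rothC_gt0 w2.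
have [Cs [Cs0 hs]] := q_sum cardA2 PC w2.
pose U n a := \sum_(j < n) u j a.
have tail (x : nat -> R) (d : R) k n : 0 <= d ->
    (forall i, x i <= d * q (k + i).+1 `^ (- (w / 2))) ->
    \sum_(i < n) x i <= d * Cs * q k `^ (- (w / 2)).
  move=> d0 hx.
  apply: (@le_trans _ _ (\sum_(i < n) d * q (k + i)%N `^ (- (w / 2)))).
    apply: ler_sum => i _; apply: (le_trans (hx _)); rewrite ler_wpM2l //.
    by apply: powR_monolN; [exact: q0|exact: (q_mono PC)|exact: ltW].
  by rewrite -mulr_sumr -mulrA ler_wpM2l.
have Udiff k n a : U (k + n)%N a - U k a = \sum_(i < n) u (k + i)%N a.
  by rewrite /U big_split_ord /= addrAC subrr add0r.
have lim a : exists l, forall n, `|l - U n a| <= c * Cs * q n `^ (- (w / 2)).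
  apply: dominated_limit => n m /subnKC <-; rewrite Udiff.
  apply: (le_trans (ler_norm_sum _ _ _)).
  apply: (tail (fun i => `|u (n + i)%N a|)); first exact: ltW.
  by move=> j /=; apply: (le_trans (le_vec_norm _ _)); have [] := hu (n + j)%N.
have [Ui hUi] := choice lim.
exists (fun a => v 0%N a + Ui a), (C * (`|B| + 1) * Cs + 2).
have B0 : 0 < `|B| + 1 by rewrite ltr_wpDl.
have CB0 : 0 <= C * (`|B| + 1) * Cs by rewrite ltW // !mulr_gt0.
split; first by lra.
move=> k; pose G a := \sum_(j < k) S j.+1 k (fun b => e j b - S 0%N j.+1 (u j) b) a.
have sG : stable P k G.
  apply: (stable_sum cardA2 PC (f := fun j => S j.+1 k (fun b => e j b - S 0%N j.+1 (u j) b))).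
  by move=> j jk; apply: (stable_fwd cardA2 PC jk); have [] := hu j.
pose z a := v k a - S 0%N k (fun a => v 0%N a + Ui a) a.
have zE : z = fun a => G a - S 0%N k (fun b => Ui b - U k b) a.
  rewrite /z (cocycle_recursion PC rec) tapplyD tapplyB.
  apply: funext => a; rewrite /G.
  have -> : S 0%N k (U k) a = \sum_(j < k) S j.+1 k (S 0%N j.+1 (u j)) a.
    rewrite (tapply_sum _ k u); apply: eq_bigr => j _.
    by rewrite -(tapply_cocycle PC).
  have -> : \sum_(j < k) S j.+1 k (fun b => e j b - S 0%N j.+1 (u j) b) a =
    \sum_(j < k) S j.+1 k (e j) a - \sum_(j < k) S j.+1 k (S 0%N j.+1 (u j)) a.
    by rewrite -sumrB; apply: eq_bigr => j _; rewrite tapplyB.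
  by ring.
have Qk0 : 0 < q k `^ (- (w / 2)) by rewrite powR_gt0.
suff hz : stable_norm P k z <= (C * (`|B| + 1) * Cs + 1) * q k `^ (- (w / 2)).
  have [g [sg hg]] := stable_norm_adherent P k z Qk0.
  by exists g; split=> //; apply: (le_trans hg); lra.
have d0 : 0 < #|A|%:R :> R by have := card_ge2 R cardA2; lra.
(* The infinite tail is cut at a level [m] so far away that the rest, even multiplied by the norm
   [q k], is below the target bound; only finitely many terms then need the quotient norm. *)
have [m [km hm]] := q_unbounded cardA2 PC
  ((q k * (#|A|%:R * (c * Cs)) / q k `^ (- (w / 2))) `^ (w / 2)^-1) k.
have small : q k * (#|A|%:R * (c * Cs * q m `^ (- (w / 2)))) <= q k `^ (- (w / 2)).
  have X0 : 0 < q k * (#|A|%:R * (c * Cs)) / q k `^ (- (w / 2)) by rewrite divr_gt0 // !mulr_gt0.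
  have : q k * (#|A|%:R * (c * Cs)) / q k `^ (- (w / 2)) <= q m `^ (w / 2).
    apply: le_trans (powR_monol (powR_ge0 _ _) hm (ltW w2)).
    by rewrite -powRrM mulVf ?powRr1 // ?(ltW X0) // gt_eqF.
  rewrite ler_pdivrMr // [q m `^ (- _)]powRN => h.
  have qm : 0 < q m `^ (w / 2) by rewrite powR_gt0.
  rewrite !mulrA ler_pdivrMr //; apply: le_trans (_ : _ <= q m `^ (w / 2) * q k `^ (- (w / 2))) _; last by rewrite mulrC.
  by apply: le_trans h; rewrite !mulrA.
have dist : vec_norm (S 0%N k (fun b => - (Ui b - U m b))) <= q k `^ (- (w / 2)).
  apply: (le_trans (tapply_norm _ _)); apply: le_trans small.
  rewrite ler_wpM2l ?(ltW (q0 k)) // vec_normN; apply: vec_norm_le => a; exact: hUi.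
have zE2 : z = fun a => G a + (S 0%N k (fun b => - (Ui b - U m b)) a +
    \sum_(i < m - k) S 0%N k (fun b => - u (k + i)%N b) a).
  rewrite zE; apply: funext => a.
  have /= <- := congr1 (fun F => F a) (tapply_sum (P 0%N k) (m - k) (fun i b => - u (k + i)%N b)).
  transitivity (G a + S 0%N k (fun b => - (Ui b - U k b)) a); first by rewrite tapplyN.
  congr (_ + _); rewrite -[RHS]/((fun a => _ + _) a) -tapplyD; congr (S _ _ _ _).
  apply: funext => b; rewrite sumrN -Udiff subnKC //; ring.
rewrite zE2 mulrDl mul1r addrC.
apply: (le_trans (stable_normD cardA2 PC _ _ _)).
rewrite -[leRHS]add0r; apply: lerD.
  apply: (le_trans (stable_norm_le _ sG)).
  rewrite (_ : (fun _ => _) = fun=> 0) ?vec_norm0 //.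
  by apply: funext => a; rewrite subrr.
apply: (le_trans (stable_normD cardA2 PC _ _ _)); apply: lerD.
  by apply: (le_trans (stable_norm_le_norm _ _ _)).
apply: (le_trans (stable_norm_sum cardA2 PC k (m - k) (fun i => S 0%N k (fun b => - u (k + i)%N b)))).
apply: (tail (fun i => stable_norm P k (S 0%N k (fun b => - u (k + i)%N b)))).
  by rewrite mulr_ge0 // ltW.
move=> i /=; have kJ : (k <= (k + i).+1)%N := leqW (leq_addr i k).
(* The quotient norm at level [k] is estimated from level [(k + i).+1], where the vector is
   congruent to [- e (k + i)]. *)
have [/(_ (S 0%N k (fun b => - u (k + i)%N b))) h _] := hC _ _ kJ.
apply: (le_trans h); rewrite -(tapply_cocycle PC) // tapplyN.
have [se _] := hu (k + i)%N; move: kJ h se; set J := (k + i).+1 => kJ h se.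
have -> : C * (`|B| + 1) * q J `^ (- (w / 2)) =
    C * q J `^ (w / 2) * ((`|B| + 1) * q J `^ (- w)).
  have -> : q J `^ (- (w / 2)) = q J `^ (w / 2) * q J `^ (- w).
    by rewrite -powR_add //; congr (_ `^ _); field.
  by ring.
rewrite ler_wpM2l ?mulr_ge0 ?powR_ge0 ?(ltW C0) //.
apply: (le_trans (stable_norm_le _ se)).
rewrite (_ : (fun _ => _) = fun a => - e (k + i)%N a); last by apply: funext => a; ring.
rewrite vec_normN; apply: (le_trans (eB _)); rewrite ler_wpM2r ?powR_ge0 //.
by have := ler_norm B; lra.
Qed.

(** Inside the stable spaces, (c) gives only almost boundedness ([b1]). Lifting an error to level 0,
    where it is stable by [stable_bwd], gives genuine decay at the cost of a power of the starting
    level ([b2]); interpolation combines the two. *)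
Lemma stable_recursion_decay (s B : R) (g f : nat -> A -> R) : 0 < s ->
  (forall k a, g k.+1 a = S k k.+1 (g k) a + f k a) ->
  stable P 0%N (g 0%N) -> (forall k, stable P k.+1 (f k)) ->
  (forall k, vec_norm (f k) <= B * q k.+1 `^ (- s)) ->
  exists s' c : R, [/\ 0 < s', 0 < c & forall k, vec_norm (g k) <= c * q k `^ (- s')].
Proof.
move=> s0 rec sg sf fB.
have [sig [Cd [sig0 Cd0 decay]]] := uniform_decay cardA2 PC.
have [Ci [p [Ci0 p0 inv]]] := cocycle_inverse cardA2 PC.
(* The weight leaves at least half of the decay [s] of the errors; the exponent in (c) is then taken
   to be [t * sig / 2], half of what the interpolation gains from [sig]. *)
pose t : R := s / (2 * (p + s + 1)).
have t0 : 0 < t by rewrite divr_gt0 //; lra.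
have tp : t * (p + s + 1) = s / 2 by rewrite /t; field; lra.
have t1 : t <= 1 by nra.
clearbody t.
have eps0 : 0 < t * sig / 2 by rewrite divr_gt0 // mulr_gt0.
have [C [C0 hC]] := rothC_gt0 eps0.
have s2 : 0 < s / 2 by lra.
have [Cs [Cs0 hs]] := sum_bound cardA2 PC s2.
pose D := `|B| + 1; have D0 : 0 < D by rewrite ltr_wpDl.
have fD k : vec_norm (f k) <= D * q k.+1 `^ (- s).
  apply: (le_trans (fB k)); rewrite ler_wpM2r ?powR_ge0 //.
  by have := ler_norm B; rewrite /D; lra.
pose c := C * D + Cd * Ci * D.
have CD : 0 < C * D by rewrite mulr_gt0.
have CiD : 0 < Cd * Ci * D by rewrite !mulr_gt0.
have c0 : 0 < c by rewrite addr_gt0.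
have tsig : t * sig <= sig by rewrite ler_piMl // ltW.
have ttsig : 0 <= t * (t * sig) by apply: mulr_ge0 (ltW t0) (mulr_ge0 (ltW t0) (ltW sig0)).
have tsig0 : 0 < t * sig by rewrite mulr_gt0.
have gn := vec_norm_ge0 (g 0%N).
exists (t * sig / 2), (Cd * (vec_norm (g 0%N) + 1) + c * Cs); split=> //.
  by rewrite addr_gt0 ?mulr_gt0 //; lra.
move=> k; rewrite (cocycle_recursion PC rec k).
apply: (le_trans (vec_normD _ _)); rewrite mulrDl; apply: lerD.
  apply: (le_trans (decay k _ sg)).
  rewrite -!mulrA ler_wpM2l ?(ltW Cd0) // mulrC.
  apply: ler_pM; rewrite ?powR_ge0 //; first by lra.
  by apply: powR_mono => //; lra.
apply: (le_trans (vec_norm_sum _ (fun j => S j.+1 k (f j)))).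
rewrite mulrAC; apply: (hs k (fun j => vec_norm (S j.+1 k (f j)))).
  by rewrite mulr_ge0 ?powR_ge0 // ltW.
move=> j jk /=; set J := j.+1.
have b1 : vec_norm (S J k (f j)) <= c * q k `^ (t * sig / 2) * q J `^ (- s).
  have [_ /(_ _ (sf j)) h] := hC J k jk; apply: (le_trans h).
  apply: (@le_trans _ _ (C * q k `^ (t * sig / 2) * (D * q J `^ (- s)))).
    by rewrite ler_wpM2l ?mulr_ge0 ?powR_ge0 ?(ltW C0) // fD.
  rewrite (_ : _ * (D * _) = (C * D) * q k `^ (t * sig / 2) * q J `^ (- s)); last by ring.
  by rewrite !ler_wpM2r ?powR_ge0 // /c; lra.
have b2 : vec_norm (S J k (f j)) <= c * q k `^ (- sig) * q J `^ p.
  have [u [Su nu]] := inv J (f j).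
  have su : stable P 0%N u by apply: (stable_bwd cardA2 PC (leq0n J)); rewrite Su; exact: sf.
  rewrite -Su -(tapply_cocycle PC) //.
  apply: (le_trans (decay k _ su)).
  apply: (@le_trans _ _ (Cd * q k `^ (- sig) * (Ci * q J `^ p * D))).
    rewrite ler_wpM2l ?mulr_ge0 ?powR_ge0 ?(ltW Cd0) //.
    apply: (le_trans nu); rewrite ler_wpM2l ?mulr_ge0 ?powR_ge0 ?(ltW Ci0) //.
    apply: (le_trans (fD j)); rewrite ler_piMr ?(ltW D0) // powR_le1 //; lra.
  rewrite (_ : _ * (Ci * _ * D) = (Cd * Ci * D) * q k `^ (- sig) * q J `^ p); last by ring.
  by rewrite !ler_wpM2r ?powR_ge0 // /c; lra.
have t01 : 0 <= t <= 1 by apply/andP; split; lra.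
apply: (le_trans (interpolation c0 (q0 k) (q0 J) t01 b1 b2)).
apply: ler_pM; rewrite ?mulr_ge0 ?powR_ge0 ?(ltW c0) //.
  by rewrite ler_wpM2l ?(ltW c0) //; apply: powR_mono => //; lra.
by apply: powR_mono => //; lra.
Qed.

(** The difference left by [correction_mod_stable] splits into a small part [pk] and a stable part
    [g], and [g] obeys a recursion with small stable errors. *)
Lemma cocycle_correction (w B : R) (v e : nat -> A -> R) : 0 < w ->
  (forall k a, v k.+1 a = S k k.+1 (v k) a + e k a) ->
  (forall j, vec_norm (e j) <= B * q j.+1 `^ (- w)) ->
  exists (chi : A -> R) (s c : R), [/\ 0 < s, 0 < c &
    forall k, vec_norm (fun a => v k a - S 0%N k chi a) <= c * q k `^ (- s)].
Proof.
move=> w0 rec eB.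
have [chi [c [c0 /choice[g hg]]]] := correction_mod_stable w0 rec eB.
have w2 : 0 < w / 2 by lra.
have w4 : 0 < w / 4 by lra.
have w8 : 0 < w / 4 / 2 by lra.
pose z k a := v k a - S 0%N k chi a; pose pk k a := z k a - g k a.
(* This is [g k.+1] minus the image of [g k], hence stable. Its last term loses [w / 4] to (a), and
   then half of the remaining exponent in the passage from level [k] to [k.+1]. *)
pose f k a := e k a - pk k.+1 a + S k k.+1 (pk k) a.
have recz k a : z k.+1 a = S k k.+1 (z k) a + e k a.
  rewrite /z rec tapplyB (tapply_cocycle PC _ (leq0n k) (leqnSn k)).
  by ring.
have recg k a : g k.+1 a = S k k.+1 (g k) a + f k a.
  by rewrite /f /pk recz tapplyB; ring.
have sg k : stable P k (g k) by have [] := hg k.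
have pkB k : vec_norm (pk k) <= c * q k `^ (- (w / 2)) by have [] := hg k.
have sf k : stable P k.+1 (f k).
  have := stableB cardA2 PC (sg k.+1) (stable_fwd cardA2 PC (leqnSn k) (sg k)).
  by congr stable; apply: funext => a; rewrite recg; ring.
have [C2 [C20 h2]] := rothA_gt0 rothA w4.
have [C3 [C30 h3]] := powR_q_step cardA2 PC rothA w4.
have fB k : vec_norm (f k) <= (`|B| + c + C2 * c * C3) * q k.+1 `^ (- (w / 4 / 2)).
  apply: (le_trans (vec_normD _ _)).
  apply: (le_trans (lerD (vec_normB _ _) (tapply_norm _ _))).
  rewrite !mulrDl; apply: lerD; first apply: lerD.
  - apply: (le_trans (eB k)); apply: (@le_trans _ _ (`|B| * q k.+1 `^ (- w))).
      by rewrite ler_wpM2r ?powR_ge0 ?ler_norm.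
    by rewrite ler_wpM2l //; apply: powR_mono => //; lra.
  - apply: (le_trans (pkB k.+1)); rewrite ler_wpM2l ?(ltW c0) //.
    by apply: powR_mono => //; lra.
  apply: (@le_trans _ _ ((C2 * q k `^ (w / 4)) * (c * q k `^ (- (w / 2))))).
    by apply: ler_pM; rewrite ?mat_norm_ge0 ?vec_norm_ge0.
  have -> : C2 * q k `^ (w / 4) * (c * q k `^ (- (w / 2))) = C2 * c * q k `^ (- (w / 4)).
    have -> : q k `^ (- (w / 4)) = q k `^ (w / 4) * q k `^ (- (w / 2)).
      by rewrite -powR_add //; congr (_ `^ _); field.
    by ring.
  rewrite -[leRHS]mulrA; apply: ler_wpM2l; [by rewrite mulr_ge0 ?ltW|exact: h3].
have [s [d [s0 d0 hd]]] := stable_recursion_decay w8 recg (sg 0%N) sf fB.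
exists chi, (Num.min s (w / 2)), (c + d); split.
- by rewrite lt_min s0.
- by rewrite addr_gt0.
move=> k; rewrite (_ : (fun _ => _) = fun a => pk k a + g k a); last first.
  by apply: funext => a; rewrite /pk /z; ring.
apply: (le_trans (vec_normD _ _)); rewrite mulrDl; apply: lerD.
  apply: (le_trans (pkB k)); rewrite ler_wpM2l ?(ltW c0) //; apply: powR_mono => //.
  by rewrite lerN2 ge_min lexx orbT.
apply: (le_trans (hd k)); rewrite ler_wpM2l ?(ltW d0) //; apply: powR_mono => //.
by rewrite lerN2 ge_min lexx.
Qed.

End Correction.

(** * Special Birkhoff sums *)

Section SpecialSums.
Variables (R : realType) (A : finType) (s : rv_state R A) (W L : nat -> A) (nk : nat -> nat).
Hypothesis cs : comb_state s.
Hypothesis stepWL : forall n,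
  step_top (rv_seq s n) (W n) (L n) \/ step_bot (rv_seq s n) (W n) (L n).
Hypothesis leWL : forall n, st_lam (rv_seq s n) (L n) <= st_lam (rv_seq s n) (W n).
Hypothesis cardA2 : (2 <= #|A|)%N.
Hypothesis blk : is_block_seq s nk.
Hypothesis lam_gt0 : forall a, 0 < st_lam s a.
Notation lamn n := (st_lam (rv_seq s n)).
Notation Q := (prodV s).

Let WL n : W n != L n. Proof. exact: winner_neq_loser cs stepWL cardA2 blk n. Qed.
Let lam0 n a : 0 < lamn n a.
Proof. exact: lamn_gt0 cs stepWL leWL cardA2 blk lam_gt0 n a. Qed.
Let nkm k l : (k <= l)%N -> (nk k <= nk l)%N.
Proof. exact: nk_mono stepWL cardA2 blk k l. Qed.

Lemma prodV_inverse m n : (m <= n)%N -> exists N, mat_mul (Q m n) N = @mat_id R A.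
Proof.
move=> /subnK <-; elim: (n - m)%N => [|k [N IH]].
  exists (@mat_id R A); rewrite add0n; apply: funext => a; apply: funext => b.
  rewrite /mat_mul (bigD1 a) //= prodV_id eqxx mul1r big1 ?addr0 // => c ca.
  by rewrite prodV_id eq_sym (negbTE ca) mul0r.
rewrite addSn; set j := (k + m)%N; have mj : (m <= j)%N by rewrite /j; lia.
(* The inverse [I - E] of the step matrix [I + E], where [E] has its entry at (winner, loser),
   multiplied by the inverse already found. *)
exists (fun c b => N c b - (c == W j)%:R * N (L j) b).
rewrite -IH; apply: funext => a; apply: funext => b; rewrite /mat_mul.
under eq_bigr do rewrite mulrBr (prodVS stepWL) // mulrDl.
rewrite sumrB big_split /= -[RHS]addr0 -addrA; congr (_ + _).
rewrite (bigD1 (L j)) //= eqxx mul1r big1 ?addr0; last first.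
  by move=> c cL; rewrite (negbTE cL) !mul0r.
rewrite (bigD1 (W j)) //= eqxx (negbTE (WL j)) mul1r mul0r addr0 big1 ?addr0 ?subrr //.
by move=> c cW; rewrite (negbTE cW) mul0r mulr0.
Qed.

Lemma rv_positive_cocycle :
  positive_cocycle (Qkl s nk) (fun k => lamn (nk k)) (4 * #|A|).
Proof.
split.
- by move=> k; apply: funext => a; apply: funext => b; rewrite /Qkl prodV_id.
- move=> k l m kl lm; apply: funext => a; apply: funext => b.
  by rewrite /Qkl (prodV_cat stepWL _ _ (nkm kl) (nkm lm)).
- by move=> k l a b kl; apply: (prodV_nat stepWL); exact: nkm.
- by move=> k l a kl; apply: (prodV_diag stepWL); exact: nkm.
- by move=> k a b; exact: prodV_pos cs stepWL cardA2 blk k a b.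
- by move=> k l a kl; apply: (lamn_sum stepWL) => //; exact: nkm.
- by move=> k a; exact: lam0.
- by move=> k l kl; exact: prodV_inverse (nkm kl).
Qed.

(** Each step adds to the norm a column sum, which contains a diagonal entry and so is at least 1.
    Through (a) this bounds the number of steps of a block. *)
Lemma prodV_steps m n : (m <= n)%N -> (n - m)%:R <= mat_norm (Q m n).
Proof.
move=> /subnK <-; rewrite addnK; elim: (n - m)%N => [|k IH].
  exact: mat_norm_ge0.
rewrite addSn; set j := (k + m)%N; have mj : (m <= j)%N by rewrite /j; lia.
have Q0 i l a b : (i <= l)%N -> `|Q i l a b| = Q i l a b.
  by move=> il; rewrite ger0_norm // (prodV_ge0 stepWL).
have E : mat_norm (Q m j.+1) = mat_norm (Q m j) + \sum_a Q m j a (W j).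
  rewrite /mat_norm -big_split; apply: eq_bigr => a _ /=.
  under eq_bigr do rewrite Q0 ?(prodVS stepWL) ?leqW //.
  under [in RHS]eq_bigr do rewrite Q0 //.
  rewrite big_split /=; congr (_ + _).
  rewrite (bigD1 (L j)) //= eqxx mul1r big1 ?addr0 // => c cL.
  by rewrite (negbTE cL) mul0r.
rewrite E -natr1 lerD // (bigD1 (W j)) //= -[1]addr0 lerD //.
  exact: (prodV_diag stepWL).
by rewrite sumr_ge0 // => *; exact: (prodV_ge0 stepWL).
Qed.

(* In the coordinates of the disjoint union of the intervals, the sum along the return orbit has
   the same expression for both types of Rauzy-Veech steps. *)
Definition special_from m (F : nat -> A -> R -> R) := forall n a x, (m <= n)%N ->
  F n.+1 a x = if a == L n then F n (L n) x + F n (W n) (x + (lamn n (W n) - lamn n (L n)))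
               else F n a x.

Fixpoint special_sum (F : A -> R -> R) n : A -> R -> R :=
  if n is n'.+1 then fun a x =>
    if a == L n' then
      special_sum F n' (L n') x
      + special_sum F n' (W n') (x + (lamn n' (W n') - lamn n' (L n')))
    else special_sum F n' a x
  else F.

Lemma special_sumP F : special_from 0 (special_sum F).
Proof. by []. Qed.

Lemma special_from_le m m' F : (m <= m')%N -> special_from m F -> special_from m' F.
Proof. by move=> mm h n a x mn; apply: h; exact: leq_trans mn. Qed.

Lemma special_fromB m F G : special_from m F -> special_from m G ->
  special_from m (fun n a x => F n a x - G n a x).
Proof. by move=> hF hG n a x mn; rewrite hF // hG //; case: ifP => _; ring. Qed.

Lemma tapplyS m n v a : (m <= n)%N -> tapply (Q m n.+1) v a =
  tapply (Q m n) v a + (a == L n)%:R * tapply (Q m n) v (W n).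
Proof.
move=> mn; rewrite /tapply mulr_sumr -big_split; apply: eq_bigr => b _ /=.
rewrite (prodVS stepWL) //; ring.
Qed.

Lemma special_from_vec m v : special_from m (fun n a _ => tapply (Q m n) v a).
Proof.
move=> n a x mn; rewrite tapplyS //; case: eqP => [->|_]; first by rewrite mul1r.
by rewrite mul0r addr0.
Qed.

Definition cell n a (x : R) := 0 <= x <= lamn n a.

Lemma cell_step n a x : cell n.+1 a x -> cell n a x.
Proof.
rewrite /cell (lamnS stepWL); case: eqP => [->|_] // /andP[-> h] /=.
by apply: (le_trans h); rewrite gerBl ltW.
Qed.

Lemma cell_shift n x : cell n.+1 (L n) x -> cell n (W n) (x + (lamn n (W n) - lamn n (L n))).
Proof.
rewrite /cell (lamnS stepWL) eq_sym (negbTE (WL n)) => /andP[x0 xl].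
by have := leWL n; lra.
Qed.

(** A column sum of the matrix is a return time, that is, the number of terms in the Birkhoff
    sum. *)
Lemma special_bound m B F : special_from m F -> 0 <= B ->
  (forall a x, cell m a x -> `|F m a x| <= B) ->
  forall n a x, (m <= n)%N -> cell n a x -> `|F n a x| <= B * \sum_b Q m n b a.
Proof.
move=> sF B0 h n a x /subnK <-; elim: (n - m)%N a x => [|k IH] a x.
  rewrite add0n => /h; move=> /le_trans; apply; rewrite ler_peMr // (bigD1 a) //=.
  rewrite prodV_id eqxx lerDl sumr_ge0 // => b _; exact: (prodV_ge0 stepWL).
rewrite addSn; set j := (k + m)%N; have mj : (m <= j)%N by rewrite /j; lia.
move=> dx; rewrite sF //.
under eq_bigr do rewrite (prodVS stepWL) //.
rewrite big_split /= mulrDr.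
case: eqP dx => [->|_] dx.
  apply: (le_trans (ler_normD _ _)); apply: lerD; first exact: IH (cell_step dx).
  rewrite (eq_bigr (fun b => Q m j b (W j))); last by move=> b _; rewrite mul1r.
  exact: IH (cell_shift dx).
rewrite [X in _ + B * X]big1 ?mulr0 ?addr0; last by move=> b _; rewrite mul0r.
exact: IH (cell_step dx).
Qed.

Lemma special_bound_norm m B F : special_from m F -> 0 <= B ->
  (forall a x, cell m a x -> `|F m a x| <= B) ->
  forall n a x, (m <= n)%N -> cell n a x -> `|F n a x| <= B * mat_norm (Q m n).
Proof.
move=> sF B0 h n a x mn dx; apply: (le_trans (special_bound sF B0 h mn dx)).
rewrite ler_wpM2l //; apply: ler_sum => b _; rewrite (bigD1 a) //=.
by rewrite (le_trans (ler_norm _)) // lerDl sumr_ge0.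
Qed.

(** A step cuts the winner's cell at the difference of the two lengths and adds the increment over
    its right piece to that over the loser's cell. For [Phi] this conserves the integral of the
    derivative, for [V] the total variation. *)
Lemma special_total m F : special_from m F -> forall n, (m <= n)%N ->
  \sum_a (F n a (lamn n a) - F n a 0) = \sum_a (F m a (lamn m a) - F m a 0).
Proof.
move=> sF n /subnK <-; elim: (n - m)%N => [//|k <-].
rewrite addSn; set j := (k + m)%N; have mj : (m <= j)%N by rewrite /j; lia.
rewrite (bigD1 (W j)) //= [in RHS](bigD1 (W j)) //=.
have LW : L j != W j by rewrite eq_sym WL.
rewrite (bigD1 (L j)) //= [in RHS](bigD1 (L j)) //=.
rewrite !sF // !(lamnS stepWL) eqxx eqxx (negbTE (WL j)) (negbTE LW).
rewrite (eq_bigr (fun i => F j i (lamn j i) - F j i 0)); last first.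
  by move=> i /andP[iW iL]; rewrite !sF // (lamnS stepWL) (negbTE iW) (negbTE iL).
rewrite add0r [lamn j (L j) + _]addrC subrK; ring.
Qed.

Definition increment_bound n (phi V : A -> R -> R) := forall a x y,
  0 <= x -> x <= y -> y <= lamn n a -> `|phi a y - phi a x| <= V a y - V a x.

(** A form of [phi] being the derivative of [Phi] with no limit or integral; involving only
    differences, it is preserved by translations and sums. *)
Definition taylor_bound n (Phi phi V : A -> R -> R) := forall a x y,
  0 <= x -> x <= y -> y <= lamn n a ->
  `|Phi a y - Phi a x - phi a x * (y - x)| <= (V a y - V a x) * (y - x).

Lemma special_increment phi V : special_from 0 phi -> special_from 0 V ->
  increment_bound 0 (phi 0%N) (V 0%N) -> forall n, increment_bound n (phi n) (V n).
Proof.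
move=> sp sV h; elim=> [//|n IH] a x y x0 xy yl.
have dx : cell n.+1 a x by rewrite /cell x0 (le_trans xy).
have dy : cell n.+1 a y by rewrite /cell yl (le_trans x0).
rewrite !sp // !sV //; case: eqP dx dy => [->|_] dx dy; last first.
  by apply: IH => //; have /andP[] := cell_step dy.
have /andP[_ h1] := cell_step dy.
have /andP[h2 _] := cell_shift dx; have /andP[_ h3] := cell_shift dy.
set d := _ - lamn n (L n) in h2 h3 *.
have := IH _ _ _ x0 xy h1; have := IH _ _ _ h2 (_ : x + d <= y + d) h3.
rewrite lerD2r xy => /(_ isT) e1 e2.
rewrite (_ : _ - _ = (phi n (L n) y - phi n (L n) x) + (phi n (W n) (y + d) - phi n (W n) (x + d))); last by ring.
by apply: (le_trans (ler_normD _ _)); lra.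
Qed.

Lemma special_taylor Phi phi V :
  special_from 0 Phi -> special_from 0 phi -> special_from 0 V ->
  taylor_bound 0 (Phi 0%N) (phi 0%N) (V 0%N) -> forall n, taylor_bound n (Phi n) (phi n) (V n).
Proof.
move=> sP sp sV h; elim=> [//|n IH] a x y x0 xy yl.
have dx : cell n.+1 a x by rewrite /cell x0 (le_trans xy).
have dy : cell n.+1 a y by rewrite /cell yl (le_trans x0).
rewrite !sP // !sp // !sV //; case: eqP dx dy => [->|_] dx dy; last first.
  by apply: IH => //; have /andP[] := cell_step dy.
have /andP[_ h1] := cell_step dy.
have /andP[h2 _] := cell_shift dx; have /andP[_ h3] := cell_shift dy.
set d := _ - lamn n (L n) in h2 h3 *.
have := IH _ _ _ x0 xy h1; have := IH _ _ _ h2 (_ : x + d <= y + d) h3.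
rewrite lerD2r xy => /(_ isT).
rewrite (_ : y + d - (x + d) = y - x); last by ring.
move=> e1 e2.
rewrite (_ : _ - _ - _ =
  (Phi n (L n) y - Phi n (L n) x - phi n (L n) x * (y - x)) +
  (Phi n (W n) (y + d) - Phi n (W n) (x + d) - phi n (W n) (x + d) * (y - x))); last by ring.
by apply: (le_trans (ler_normD _ _)); lra.
Qed.

End SpecialSums.

(** * Special Birkhoff sums under the Roth conditions *)

Section RothSpecialSums.
Variables (R : realType) (A : finType) (s : rv_state R A) (W L : nat -> A) (nk : nat -> nat).
Hypothesis cs : comb_state s.
Hypothesis stepWL : forall n,
  step_top (rv_seq s n) (W n) (L n) \/ step_bot (rv_seq s n) (W n) (L n).
Hypothesis leWL : forall n, st_lam (rv_seq s n) (L n) <= st_lam (rv_seq s n) (W n).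
Hypothesis cardA2 : (2 <= #|A|)%N.
Hypothesis blk : is_block_seq s nk.
Hypothesis lam_gt0 : forall a, 0 < st_lam s a.
Notation lamn n := (st_lam (rv_seq s n)).
Notation Q := (prodV s).
Notation P := (Qkl s nk).
Notation q k := (mat_norm (P 0%N k)).
Hypothesis rothA : forall eps : R, 0 < eps -> exists C : R, forall k,
  mat_norm (P k k.+1) <= C * q k `^ eps.
Hypothesis rothB : exists theta C : R, 0 < theta /\ 0 < C /\ forall k (v : A -> R),
  \sum_(a : A) st_lam s a * v a = 0 ->
  vec_norm (tapply (P 0%N k) v) <= C * q k `^ (1 - theta) * vec_norm v.
Hypothesis rothC : forall eps : R, 0 < eps -> exists C : R, forall k l, (k <= l)%N ->
  (forall v : A -> R, stable_norm P k v
     <= C * q l `^ eps * stable_norm P l (tapply (P k l) v)) /\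
  (forall v : A -> R, stable P k v ->
     vec_norm (tapply (P k l) v) <= C * q l `^ eps * vec_norm v).

Let PC : positive_cocycle P (fun k => lamn (nk k)) (4 * #|A|).
Proof. exact: rv_positive_cocycle cs stepWL leWL cardA2 blk lam_gt0. Qed.
Let q1 k : 1 <= q k. Proof. exact: (q_ge1 cardA2 PC). Qed.
Let q0 k : 0 < q k. Proof. exact: (q_gt0 cardA2 PC). Qed.
Let lam0 n a : 0 < lamn n a.
Proof. exact: lamn_gt0 cs stepWL leWL cardA2 blk lam_gt0 n a. Qed.
Let nkm k l : (k <= l)%N -> (nk k <= nk l)%N.
Proof. exact: nk_mono stepWL cardA2 blk k l. Qed.
Let nk0 : nk 0%N = 0%N. Proof. by have [] := blk. Qed.

Section Sums.
Variables (Phi phi V : nat -> A -> R -> R).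
Hypothesis sPhi : special_from s W L 0 Phi.
Hypothesis sphi : special_from s W L 0 phi.
Hypothesis sV : special_from s W L 0 V.
Hypothesis inc0 : increment_bound s 0 (phi 0%N) (V 0%N).
Hypothesis tay0 : taylor_bound s 0 (Phi 0%N) (phi 0%N) (V 0%N).
Hypothesis mean0 : \sum_a (Phi 0%N a (st_lam s a) - Phi 0%N a 0) = 0.

Let inc n : increment_bound s n (phi n) (V n).
Proof. exact: (special_increment cs stepWL leWL cardA2 blk lam_gt0 sphi sV inc0). Qed.
Let tay n : taylor_bound s n (Phi n) (phi n) (V n).
Proof. exact: (special_taylor cs stepWL leWL cardA2 blk lam_gt0 sPhi sphi sV tay0). Qed.

Lemma cell0 n a : cell s n a 0.
Proof. by rewrite /cell lexx ltW. Qed.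

(** The increments of [V] over the cells are nonnegative and their sum is conserved, so the initial
    total bounds each of them at all levels. *)
Lemma variation_bound : exists M : R, 0 <= M /\ forall n a x, cell s n a x ->
  0 <= V n a x - V n a 0 <= M.
Proof.
pose M := \sum_a (V 0%N a (st_lam s a) - V 0%N a 0); exists M.
have ge0 n a x y : 0 <= x -> x <= y -> y <= lamn n a -> 0 <= V n a y - V n a x.
  by move=> x0 xy yl; apply: le_trans (inc x0 xy yl).
have ge0' n a : 0 <= V n a (lamn n a) - V n a 0 by apply: ge0 => //; exact: ltW.
split; first by apply: sumr_ge0 => a _; exact: (ge0' 0%N a).
move=> n a x /andP[x0 xl]; rewrite ge0 //=.
apply: (@le_trans _ _ (V n a (lamn n a) - V n a 0)).
  by have := ge0 n a _ _ x0 xl (lexx _); lra.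
rewrite /M -(special_total cs stepWL cardA2 blk sV (leq0n n)).
by rewrite (bigD1 a) //= lerDl sumr_ge0.
Qed.

(** The bounded variation keeps the special sums of [phi] within a constant of their means on the
    cells. The vectors of means are centered and satisfy the cocycle recursion up to the norm of one
    block, as [centered_growth] requires. *)
Lemma special_derivative_growth : exists theta C : R, [/\ 0 < theta, theta <= 1, 0 < C &
  forall k a x, cell s (nk k) a x -> `|phi (nk k) a x| <= C * q k `^ (1 - theta)].
Proof.
have [M [M0 hM]] := variation_bound.
(* The mean slope of [Phi] on the cell. Weighted by the lengths, these slopes add up to the total
   increment, which is zero at every level. *)
pose v k a := (Phi (nk k) a (lamn (nk k) a) - Phi (nk k) a 0) / lamn (nk k) a.
have lv k : \sum_a lamn (nk k) a * v k a = 0.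
  rewrite -[RHS]mean0 -(special_total cs stepWL cardA2 blk sPhi (leq0n (nk k))).
  apply: eq_bigr => a _; rewrite /v mulrC divfK //; exact: lt0r_neq0.
have near0 k a : `|v k a - phi (nk k) a 0| <= M.
  have := tay (lexx 0) (ltW (lam0 (nk k) a)) (lexx _).
  have /hM/andP[_ hV] : cell s (nk k) a (lamn (nk k) a) by rewrite /cell lexx ltW.
  rewrite subr0 => h; rewrite -(ler_pM2r (lam0 (nk k) a)).
  have -> : `|v k a - phi (nk k) a 0| * lamn (nk k) a =
      `|(v k a - phi (nk k) a 0) * lamn (nk k) a|.
    by rewrite normrM [`|lamn (nk k) a|]gtr0_norm.
  rewrite mulrBl /v divfK; last exact: lt0r_neq0.
  by apply: (le_trans h); rewrite ler_wpM2r // ltW.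
have near k a x : cell s (nk k) a x -> `|phi (nk k) a x - v k a| <= 2 * M.
  move=> dx; have /andP[x0 xl] := dx; have /andP[_ hV] := hM _ _ _ dx.
  have h1 := inc (lexx 0) x0 xl; have h2 := near0 k a.
  rewrite (_ : _ - _ = (phi (nk k) a x - phi (nk k) a 0) - (v k a - phi (nk k) a 0)); last by ring.
  by apply: (le_trans (ler_normB _ _)); lra.
pose e k a := v k.+1 a - tapply (P k k.+1) (v k) a.
have rec k a : v k.+1 a = tapply (P k k.+1) (v k) a + e k a by rewrite /e addrC subrK.
have v0 : \sum_a lamn (nk 0) a * v 0%N a = 0 by exact: lv.
have e0 k : \sum_a lamn (nk k.+1) a * e k a = 0.
  rewrite /e; under eq_bigr do rewrite mulrBr.
  by rewrite sumrB lv (lam_tapply PC _ (leqnSn k)) lv subrr.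
have kk k := nkm (leqnSn k).
have eB k : vec_norm (e k) <= (#|A|%:R * (4 * M)) * mat_norm (P k k.+1).
  rewrite -mulrA; apply: vec_norm_le => a.
  have sd : special_from s W L (nk k) (fun n a x => phi n a x - tapply (Q (nk k) n) (v k) a).
    apply: special_fromB; last exact: (special_from_vec stepWL).
    exact: special_from_le sphi.
  have M2 : 0 <= 2 * M by rewrite mulr_ge0.
  have nearQ b x : cell s (nk k) b x -> `|phi (nk k) b x - tapply (Q (nk k) (nk k)) (v k) b| <= 2 * M.
    move=> dx; have -> : Q (nk k) (nk k) = @mat_id R A.
      by apply: funext => c; apply: funext => c'; rewrite prodV_id.
    by rewrite tapply_id; exact: near.
  have h1 := special_bound_norm cs stepWL leWL cardA2 blk lam_gt0 sd M2 nearQ (kk k) (cell0 (nk k.+1) a).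
  have h2 := near0 k.+1 a; have h3 := cocycle_norm_ge1 cardA2 PC (leqnSn k).
  rewrite /e (_ : _ - _ = (v k.+1 a - phi (nk k.+1) a 0) +
    (phi (nk k.+1) a 0 - tapply (P k k.+1) (v k) a)); last by ring.
  apply: (le_trans (ler_normD _ _)).
  have : M <= M * mat_norm (P k k.+1) by rewrite ler_peMr.
  move: h1; rewrite -/(P k k.+1); lra.
have rothB' : exists theta C : R, 0 < theta /\ 0 < C /\ forall k (v : A -> R),
    \sum_(a : A) lamn (nk 0) a * v a = 0 ->
    vec_norm (tapply (P 0%N k) v) <= C * q k `^ (1 - theta) * vec_norm v.
  by rewrite nk0.
have [th [C [th0 th1 C0 hv]]] := centered_growth cardA2 PC rothA rothB' rec v0 e0 eB.
exists th, (2 * M + C); split=> //; first by rewrite ltr_wpDl // mulr_ge0.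
move=> k a x dx; rewrite (_ : phi _ _ _ = (phi (nk k) a x - v k a) + v k a); last by ring.
apply: (le_trans (ler_normD _ _)); rewrite mulrDl; apply: lerD.
  apply: (le_trans (near k a x dx)); rewrite ler_peMr ?mulr_ge0 // powR_ge1 //; lra.
exact: le_trans (le_vec_norm _ _) (hv k).
Qed.

(** The growth of exponent [1 - th] of the derivative is beaten by the length of the cells, of
    exponent [th / 2 - 1]. *)
Lemma special_oscillation : exists w C : R, [/\ 0 < w, 0 < C &
  forall k a x, cell s (nk k) a x -> `|Phi (nk k) a x - Phi (nk k) a 0| <= C * q k `^ (- w)].
Proof.
have [M [M0 hM]] := variation_bound.
have [th [C [th0 th1 C0 hphi]]] := special_derivative_growth.
have th2 : 0 < th / 2 by lra.
have [Cl [Cl0 hl]] := cocycle_lam_bound cardA2 PC rothA th2.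
exists (th / 2), ((M + C) * Cl); split=> //; first by rewrite mulr_gt0 //; lra.
move=> k a x dx; have /andP[x0 xl] := dx; have /andP[V0 hV] := hM _ _ _ dx.
have h1 := tay (lexx 0) x0 xl; rewrite subr0 in h1.
have h2 := hphi k a 0 (cell0 _ _).
have qge : 1 <= q k `^ (1 - th) by apply: powR_ge1 => //; lra.
have h3 : `|Phi (nk k) a x - Phi (nk k) a 0| <= (M + C) * q k `^ (1 - th) * x.
  rewrite (_ : Phi _ _ x - _ = (Phi (nk k) a x - Phi (nk k) a 0 - phi (nk k) a 0 * x) +
    phi (nk k) a 0 * x); last by ring.
  apply: (le_trans (ler_normD _ _)); rewrite [(M + C) * _]mulrDl mulrDl; apply: lerD.
    apply: (le_trans h1); rewrite ler_wpM2r //; apply: (le_trans hV).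
    by rewrite ler_peMr.
  by rewrite normrM [`|x|]ger0_norm // ler_wpM2r.
apply: (le_trans h3).
apply: (@le_trans _ _ ((M + C) * q k `^ (1 - th) * (Cl * q k `^ (th / 2 - 1)))).
  rewrite ler_wpM2l //; last exact: le_trans xl (hl k a).
  by rewrite mulr_ge0 ?powR_ge0 //; lra.
have -> : q k `^ (- (th / 2)) = q k `^ (1 - th) * q k `^ (th / 2 - 1).
  by rewrite -powR_add //; congr (_ `^ _); field.
by rewrite le_eqVlt; apply/orP; left; apply/eqP; ring.
Qed.

(** The values at 0 follow the cocycle up to the oscillation times the norm of one block, and this
    still decays by (a). *)
Lemma special_correction_blocks : exists (chi : A -> R) (w C : R), [/\ 0 < w, 0 < C &
  forall k a x, cell s (nk k) a x ->
    `|Phi (nk k) a x - tapply (Q 0 (nk k)) chi a| <= C * q k `^ (- w)].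
Proof.
have [w [C [w0 C0 osc]]] := special_oscillation.
pose v k a := Phi (nk k) a 0.
pose e k a := v k.+1 a - tapply (P k k.+1) (v k) a.
have rec k a : v k.+1 a = tapply (P k k.+1) (v k) a + e k a by rewrite /e addrC subrK.
have w2 : 0 < w / 2 by lra.
have w4 : 0 < w / 2 / 2 by lra.
have [Ca [Ca0 hA]] := rothA_gt0 rothA w2.
have [Cq [Cq0 hq]] := powR_q_step cardA2 PC rothA w2.
have kk k := nkm (leqnSn k).
have eB k : vec_norm (e k) <= (#|A|%:R * (C * Ca * Cq)) * q k.+1 `^ (- (w / 2 / 2)).
  rewrite -[leRHS]mulrA; apply: vec_norm_le => a.
  have sd : special_from s W L (nk k) (fun n a x => Phi n a x - tapply (Q (nk k) n) (v k) a).
    apply: special_fromB; last exact: (special_from_vec stepWL).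
    exact: special_from_le sPhi.
  have Cq_ge0 : 0 <= C * q k `^ (- w) by rewrite mulr_ge0 ?powR_ge0 // ltW.
  have nearQ b x : cell s (nk k) b x ->
      `|Phi (nk k) b x - tapply (Q (nk k) (nk k)) (v k) b| <= C * q k `^ (- w).
    move=> dx; have -> : Q (nk k) (nk k) = @mat_id R A.
      by apply: funext => c; apply: funext => c'; rewrite prodV_id.
    by rewrite tapply_id; exact: osc.
  apply: (le_trans (special_bound_norm cs stepWL leWL cardA2 blk lam_gt0 sd Cq_ge0 nearQ (kk k) (cell0 _ _))).
  apply: (@le_trans _ _ (C * q k `^ (- w) * (Ca * q k `^ (w / 2)))).
    by rewrite ler_wpM2l // hA.
  rewrite (_ : _ * (Ca * _) = C * Ca * q k `^ (- (w / 2))); last first.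
    have -> : q k `^ (- (w / 2)) = q k `^ (- w) * q k `^ (w / 2).
      by rewrite -powR_add //; congr (_ `^ _); field.
    by ring.
  rewrite -[leRHS]mulrA; apply: ler_wpM2l; [by rewrite mulr_ge0 ?ltW|exact: hq].
have [chi [t [c [t0 c0 hchi]]]] := cocycle_correction cardA2 PC rothA rothC w4 rec eB.
exists chi, (Num.min w t), (C + c); split.
- by rewrite lt_min w0.
- by rewrite addr_gt0.
move=> k a x dx.
have -> : tapply (Q 0 (nk k)) chi = tapply (P 0%N k) chi by rewrite /Qkl nk0.
rewrite (_ : _ - _ = (Phi (nk k) a x - Phi (nk k) a 0) + (v k a - tapply (P 0%N k) chi a)); last first.
  by rewrite /v; ring.
apply: (le_trans (ler_normD _ _)); rewrite mulrDl; apply: lerD.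
  apply: (le_trans (osc k a x dx)); rewrite ler_wpM2l ?(ltW C0) //; apply: powR_mono => //.
  by rewrite lerN2 ge_min lexx.
apply: le_trans (_ : _ <= c * q k `^ (- t)) _; last first.
  by rewrite ler_wpM2l ?(ltW c0) //; apply: powR_mono => //; rewrite lerN2 ge_min lexx orbT.
by apply: le_trans (hchi k); exact: (le_vec_norm (fun a => v k a - tapply (P 0%N k) chi a)).
Qed.

(* T k bounds the total correction made by the extensions over all the steps of the k-th block. *)
Lemma special_correction : exists (chi : A -> R) (T r : nat -> R), [/\
  forall k n a x, (nk k <= n <= nk k.+1)%N -> cell s n a x ->
    (nk k.+1 - nk k)%:R * `|Phi n a x - tapply (Q 0 n) chi a| <= T k,
  forall k m, \sum_(i < m) T (k + i)%N <= r k &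
  forall (eps : R) k0, 0 < eps -> exists k, (k0 <= k)%N /\ r k <= eps].
Proof.
have [chi [w [C [w0 C0 h]]]] := special_correction_blocks.
have w4 : 0 < w / 4 by lra.
have w2 : 0 < w / 2 by lra.
have [Ca [Ca0 hA]] := rothA_gt0 rothA w4.
have [Cs [Cs0 hs]] := q_sum cardA2 PC w2.
(* One factor [Ca] bounds the number of steps of the block, the other the growth of the sums inside
   it. *)
pose D := Ca * C * Ca; have D0 : 0 < D by rewrite !mulr_gt0.
exists chi, (fun k => D * q k `^ (- (w / 2))), (fun k => D * (Cs * q k `^ (- (w / 2)))); split.
- move=> k n a x /andP[kn nk1] dx.
  have sd : special_from s W L (nk k) (fun n a x => Phi n a x - tapply (Q 0 n) chi a).
    apply: (@special_from_le _ _ _ _ _ 0) => //.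
    by apply: special_fromB => //; exact: (special_from_vec stepWL).
  have Cq_ge0 : 0 <= C * q k `^ (- w) by rewrite mulr_ge0 ?powR_ge0 // ltW.
  have b1 := special_bound_norm cs stepWL leWL cardA2 blk lam_gt0 sd Cq_ge0 (h k) kn dx.
  have b2 := prodV_steps stepWL cardA2 (nkm (leqnSn k)).
  have b3 : mat_norm (Q (nk k) n) <= mat_norm (P k k.+1).
    apply: ler_sum => b _; apply: ler_sum => c _.
    rewrite !ger0_norm ?(prodV_ge0 stepWL) ?(leq_trans kn) //.
    exact: (prodV_mono stepWL).
  apply: (@le_trans _ _ ((Ca * q k `^ (w / 4)) * (C * q k `^ (- w) * (Ca * q k `^ (w / 4))))).
    apply: ler_pM => //; first exact: le_trans b2 (hA k).
    apply: (le_trans b1); rewrite ler_wpM2l //; exact: le_trans b3 (hA k).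
  rewrite (_ : - (w / 2) = w / 4 + (- w + w / 4)); last by field.
  rewrite !powR_add // /D le_eqVlt; apply/orP; left; apply/eqP; ring.
- by move=> k m; rewrite -mulr_sumr ler_wpM2l ?(ltW D0).
move=> eps k0 eps0.
have [k [k0k hk]] := q_unbounded cardA2 PC ((D * Cs / eps) `^ (w / 2)^-1) k0.
exists k; split=> //; rewrite powRN mulrA ler_pdivrMr ?powR_gt0 //.
rewrite [eps * _]mulrC -ler_pdivrMr //.
have X0 : 0 < D * Cs / eps by rewrite divr_gt0 // mulr_gt0.
apply: le_trans (powR_monol (powR_ge0 _ _) hk (ltW w2)).
by rewrite -powRrM mulVf ?powRr1 // ?(ltW X0) // gt_eqF.
Qed.

End Sums.
End RothSpecialSums.

(** * Extension of solutions along Rauzy-Veech steps *)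

Section LeftEnds.
Variables (R : realType) (A : finType).
Implicit Types (p : A -> nat) (lam : A -> R) (a b w l : A).

Lemma left_end_ge0 p lam a : (forall b, 0 < lam b) -> 0 <= left_end p lam a.
Proof. by move=> l0; apply: sumr_ge0 => b _; exact: ltW. Qed.

Lemma left_end_next p lam a b : (forall b, 0 < lam b) -> (p a < p b)%N ->
  left_end p lam a + lam a <= left_end p lam b.
Proof.
move=> l0 ab; rewrite /left_end [leRHS](bigD1 a) //= addrC lerD2r.
rewrite [leLHS]big_mkcond [leRHS]big_mkcond; apply: ler_sum => c _.
case: ifP => ca; last by case: ifP => _ //; exact: ltW.
have -> : (p c < p b)%N && (c != a) by rewrite (ltn_trans ca ab) /=; apply: contraTN ca => /eqP ->; rewrite ltnn.
by [].
Qed.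

Lemma left_end_le p lam a : (forall b, 0 < lam b) -> left_end p lam a + lam a <= lamstar lam.
Proof.
move=> l0; rewrite /left_end /lamstar [leRHS](bigD1 a) //= addrC lerD2r.
rewrite [leLHS]big_mkcond [leRHS]big_mkcond; apply: ler_sum => c _.
case: ifP => ca; last by case: ifP => _ //; exact: ltW.
have -> : c != a by apply: contraTN ca => /eqP ->; rewrite ltnn.
by [].
Qed.

Lemma left_end_last p lam w : comb_bij p -> p w = #|A| ->
  left_end p lam w = lamstar lam - lam w.
Proof.
move=> [pinj pran] pw; rewrite /lamstar (bigD1 w) //= addrC addrK /left_end.
apply: eq_bigl => b; rewrite pw; have := pran b.
case: (eqVneq b w) => [->|bw]; first by rewrite pw ltnn.
move=> /andP[_ pb]; rewrite ltn_neqAle pb andbT.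
by apply/eqP => e; move/eqP: bw; apply; apply: pinj; rewrite e pw.
Qed.

Lemma left_end_unique p lam a b x : comb_bij p -> (forall b, 0 < lam b) ->
  left_end p lam a <= x < left_end p lam a + lam a ->
  left_end p lam b <= x < left_end p lam b + lam b -> a = b.
Proof.
move=> [pinj _] l0 /andP[h1 h2] /andP[h3 h4].
case: (ltngtP (p a) (p b)) => [|| /pinj //] h.
  by have := @left_end_next p lam a b l0 h => h5; exfalso; lra.
by have := @left_end_next p lam b a l0 h => h5; exfalso; lra.
Qed.

Lemma iemE p0 p1 lam a t : comb_bij p0 -> (forall b, 0 < lam b) ->
  0 <= t < lam a -> iem p0 p1 lam (left_end p0 lam a + t) = left_end p1 lam a + t.
Proof.
move=> pb l0 /andP[t0 tl]; rewrite /iem (big_pred1 a); first by ring.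
have ina : left_end p0 lam a <= left_end p0 lam a + t < left_end p0 lam a + lam a.
  by rewrite lerDl ltrD2l t0.
move=> b /=; apply/idP/eqP => [h|-> //].
by symmetry; apply: (@left_end_unique p0 lam a b _ pb l0 ina h).
Qed.

Lemma left_end_winner p lam w l a : comb_bij p -> p w = #|A| ->
  left_end p (rv_newlam lam w l) a = left_end p lam a.
Proof.
move=> [_ pran] pw; apply: eq_bigr => b; rewrite /rv_newlam; case: eqP => // ->.
by rewrite pw => h; have /andP[] := pran a; lia.
Qed.

(** The loser is inserted just after the shortened winner and fills exactly the length that the
    winner lost, so no other letter moves. *)
Lemma left_end_newpi p lam w l a : comb_bij p -> p l = #|A| -> w != l ->
  left_end (rv_newpi p w) (rv_newlam lam w l) a =
  if a == l then left_end p lam w + (lam w - lam l) else left_end p lam a.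
Proof.
move=> [pinj pran] pl wl; have lw : l != w by rewrite eq_sym.
have pwl : (p w < #|A|)%N.
  have /andP[_] := pran w; rewrite leq_eqVlt => /orP[/eqP e|//].
  by move/eqP: wl; case; apply: pinj; rewrite e pl.
have nl : rv_newpi p w l = (p w).+1 by rewrite /rv_newpi pl leqNgt pwl ltnn.
have nw : rv_newpi p w w = p w by rewrite /rv_newpi leqnn.
have nb b : b != l -> rv_newpi p w b = if (p b <= p w)%N then p b else (p b).+1.
  move=> bl; rewrite /rv_newpi; case: ifP => // _.
  have /andP[_] := pran b; rewrite leq_eqVlt => /orP[/eqP e|-> //].
  by move/eqP: bl; case; apply: pinj; rewrite e pl.
have split (p' : A -> nat) (lam' : A -> R) (c : nat) : \sum_(b | (p' b < c)%N) lam' b =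
    (if (p' w < c)%N then lam' w else 0) + ((if (p' l < c)%N then lam' l else 0) +
     \sum_(b | (b != w) && (b != l)) if (p' b < c)%N then lam' b else 0).
  by rewrite big_mkcond (bigD1 w) //= (bigD1 l).
have lamw : rv_newlam lam w l w = lam w - lam l by rewrite /rv_newlam eqxx.
have laml : rv_newlam lam w l l = lam l by rewrite /rv_newlam (negbTE lw).
have lamb b : b != w -> rv_newlam lam w l b = lam b by rewrite /rv_newlam => /negbTE ->.
rewrite /left_end !split lamw laml nl nw.
case: eqP => [->|/eqP al].
  rewrite nl !ltnn ltnSn pl ltnNge (ltnW pwl) /= !add0r addrC; congr (_ + _).
  apply: eq_bigr => b /andP[bw bl]; rewrite nb // lamb //.
  have bw' : p b <> p w by move=> /pinj e; move: bw; rewrite e eqxx.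
  have -> // : ((if (p b <= p w)%N then p b else (p b).+1) < (p w).+1)%N = (p b < p w)%N.
  by case: ifP; lia.
rewrite (nb a) // pl.
have /andP[_ paA] := pran a.
have -> : (#|A| < p a)%N = false by rewrite ltnNge paA.
have -> : \sum_(i | (i != w) && (i != l))
     (if (rv_newpi p w i < if (p a <= p w)%N then p a else (p a).+1)%N
      then rv_newlam lam w l i else 0) =
   \sum_(i | (i != w) && (i != l)) (if (p i < p a)%N then lam i else 0).
  apply: eq_bigr => b /andP[bw bl]; rewrite nb // lamb //.
  have -> // : ((if (p b <= p w)%N then p b else (p b).+1) <
     (if (p a <= p w)%N then p a else (p a).+1))%N = (p b < p a)%N.
  by do 2 case: ifP; lia.
have [aw|aw] := leqP (p a) (p w).
  have -> : (p w < p a)%N = false by lia.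
  by have -> : ((p w).+1 < p a)%N = false by lia.
rewrite (ltnW aw : (p w < (p a).+1)%N) ltnS aw; ring.
Qed.

End LeftEnds.

Section Extension.
Variables (R : realType) (A : finType) (s : rv_state R A) (W L : nat -> A).
Hypothesis cs : comb_state s.
Hypothesis stepWL : forall n,
  step_top (rv_seq s n) (W n) (L n) \/ step_bot (rv_seq s n) (W n) (L n).
Notation lamn n := (st_lam (rv_seq s n)).
Hypothesis WL : forall n, W n != L n.
Hypothesis lam0 : forall n a, 0 < lamn n a.

Definition top_end n a := left_end (st_pi0 (rv_seq s n)) (lamn n) a.
Definition bot_end n a := left_end (st_pi1 (rv_seq s n)) (lamn n) a.
Definition total_length n := lamstar (lamn n).

Lemma total_lengthS n : total_length n.+1 = total_length n - lamn n (L n).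
Proof.
rewrite /total_length /lamstar (bigD1 (W n)) //= [in RHS](bigD1 (W n)) //= (lamnS stepWL) eqxx.
rewrite (eq_bigr (fun i => lamn n i)); last first.
  by move=> i iW; rewrite (lamnS stepWL) (negbTE iW).
ring.
Qed.

Definition is_top n := st_pi0 (rv_seq s n) (W n) == #|A|.

Lemma step_topP n : is_top n -> [/\ top_end n (W n) = total_length n - lamn n (W n),
  bot_end n (L n) = total_length n - lamn n (L n),
  forall a, top_end n.+1 a = top_end n a &
  forall a, bot_end n.+1 a =
    if a == L n then bot_end n (W n) + (lamn n (W n) - lamn n (L n)) else bot_end n a].
Proof.
move=> /eqP tW; have [b0 b1] : comb_state (rv_seq s n).
  by apply: comb_state_seq => //; apply/card_gt0P; exists (W 0%N).
have [[p0 p1 _ e]|[_ p0 _ _]] := stepWL n; last first.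
  have [i0 _] := b0; have eWL : W n = L n by apply: i0; rewrite tW p0.
  by move: (WL n); rewrite eWL eqxx.
rewrite /top_end /bot_end /total_length !(left_end_last _ b0 p0) !(left_end_last _ b1 p1).
split=> // a; rewrite /rv_seq iterS -/(rv_seq s n) e /=.
  exact: left_end_winner.
exact: left_end_newpi.
Qed.

Lemma step_botP n : ~~ is_top n -> [/\ bot_end n (W n) = total_length n - lamn n (W n),
  top_end n (L n) = total_length n - lamn n (L n),
  forall a, bot_end n.+1 a = bot_end n a &
  forall a, top_end n.+1 a =
    if a == L n then top_end n (W n) + (lamn n (W n) - lamn n (L n)) else top_end n a].
Proof.
move=> tW; have [b0 b1] : comb_state (rv_seq s n).
  by apply: comb_state_seq => //; apply/card_gt0P; exists (W 0%N).
have [[p0 p1 _ e]|[p1 p0 _ e]] := stepWL n; first by move: tW; rewrite /is_top p0 eqxx.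
rewrite /top_end /bot_end /total_length !(left_end_last _ b0 p0) !(left_end_last _ b1 p1).
split=> // a; rewrite /rv_seq iterS -/(rv_seq s n) e /=.
  exact: left_end_winner.
exact: left_end_newpi.
Qed.

Lemma top_end_ge0 n a : 0 <= top_end n a. Proof. exact: left_end_ge0. Qed.
Lemma bot_end_ge0 n a : 0 <= bot_end n a. Proof. exact: left_end_ge0. Qed.
Lemma top_end_le n a : top_end n a + lamn n a <= total_length n. Proof. exact: left_end_le. Qed.
Lemma bot_end_le n a : bot_end n a + lamn n a <= total_length n. Proof. exact: left_end_le. Qed.

Section Equation.
Variable F : nat -> A -> R -> R.
Hypothesis sF : special_from s W L 0 F.

(* A point outside the induced interval is T x for a unique x in the induced interval;
   the solution is propagated from x by the cohomological equation. *)
Definition extend n (g : R -> R) : R -> R := fun y =>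
  if y < total_length n.+1 then g y else
  g (top_end n.+1 (L n) + (y - total_length n.+1)) +
  if is_top n then F n (L n) (y - total_length n.+1)
  else F n (W n) (y - total_length n.+1 + (lamn n (W n) - lamn n (L n))).

Definition solves n (g : R -> R) (eps : R) := forall a t, 0 <= t < lamn n a ->
  `|g (bot_end n a + t) - g (top_end n a + t) - F n a t| <= eps.

(** On the loser's cell of level [n.+1] the sum has two terms. The equation for one of them holds
    exactly, by the definition of [extend]; subtracting it from the equation of level [n.+1] leaves
    the other one, with the same error. On the remaining points nothing changes. *)
Lemma extend_solves n g eps : 0 <= eps -> solves n.+1 g eps -> solves n (extend n g) eps.
Proof.
move=> eps0 sg a t /andP[t0 tl].
have sga b u : 0 <= u < lamn n.+1 b ->
  `|g (bot_end n.+1 b + u) - g (top_end n.+1 b + u) - F n.+1 b u| <= eps by exact: sg.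
have lL : lamn n.+1 (L n) = lamn n (L n).
  by rewrite (lamnS stepWL) eq_sym (negbTE (WL n)).
have lW : lamn n.+1 (W n) = lamn n (W n) - lamn n (L n) by rewrite (lamnS stepWL) eqxx.
have WLn := WL n; have LWn : (L n == W n) = false by rewrite eq_sym (negbTE WLn).
have lam0W := lam0 n.+1 (W n); rewrite lW in lam0W.
have FL u : F n.+1 (L n) u = F n (L n) u + F n (W n) (u + (lamn n (W n) - lamn n (L n))).
  by rewrite sF // eqxx.
have FW u : F n.+1 (W n) u = F n (W n) u by rewrite sF // (negbTE WLn).
have Fo b u : b != L n -> F n.+1 b u = F n b u by move=> /negbTE bL; rewrite sF // bL.
have tp b := top_end_le n.+1 b; have bp b := bot_end_le n.+1 b.
have tS := total_lengthS n.
rewrite /extend.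
have inI b u : b != L n -> 0 <= u < lamn n.+1 b -> top_end n.+1 b = top_end n b ->
    bot_end n.+1 b = bot_end n b ->
    (bot_end n b + u < total_length n.+1) * (top_end n b + u < total_length n.+1) *
    (`|g (bot_end n b + u) - g (top_end n b + u) - F n b u| <= eps).
  move=> bL /andP[u0 ul] et eb; have := tp b; have := bp b; rewrite et eb => h1 h2.
  split; first by split; lra.
  by rewrite -et -eb -Fo //; apply: sg; rewrite u0.
have [top|bot] := boolP (is_top n).
  have [tW bL tE bE] := step_topP top.
  have tpL := tp (L n); rewrite tE lL in tpL.
  have bpL := bp (L n); rewrite bE eqxx lL in bpL.
  have [aL|aL] := eqVneq a (L n).
    rewrite aL bL in tl *; rewrite -tS ltNge lerDl t0 /=.
    have -> : top_end n (L n) + t < total_length n.+1 by lra.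
    rewrite tE [total_length _ + t]addrC addrK (_ : _ - F n (L n) t = 0) ?normr0 //; ring.
  have [aW|aW] := eqVneq a (W n).
    rewrite aW in tl *.
    have [tlow|thigh] := ltP t (lamn n (W n) - lamn n (L n)).
      have rg : 0 <= t < lamn n.+1 (W n) by rewrite t0 lW.
      have eb : bot_end n.+1 (W n) = bot_end n (W n) by rewrite bE (negbTE WLn).
      by have [[-> ->]] := inI _ _ WLn rg (tE _) eb.
    pose u := t - (lamn n (W n) - lamn n (L n)).
    have tu : t = u + (lamn n (W n) - lamn n (L n)) by rewrite /u subrK.
    have u01 : 0 <= u < lamn n.+1 (L n) by rewrite lL /u; lra.
    have eb : bot_end n (W n) + t = bot_end n.+1 (L n) + u by rewrite bE eqxx tu; ring.
    have et : top_end n (W n) + t = total_length n.+1 + u by rewrite tW tS tu; ring.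
    rewrite eb et.
    have -> : bot_end n.+1 (L n) + u < total_length n.+1 by have := bp (L n); lra.
    have -> : total_length n.+1 + u < total_length n.+1 = false by rewrite ltNge lerDl; have /andP[-> _] := u01.
    rewrite [total_length _ + u]addrC addrK; have := sga (L n) u u01; rewrite FL -tu.
    by congr (`|_| <= _); ring.
  have rg : 0 <= t < lamn n.+1 a by rewrite t0 (lamnS stepWL) (negbTE aW).
  have eb : bot_end n.+1 a = bot_end n a by rewrite bE (negbTE aL).
  by have [[-> ->]] := inI _ _ aL rg (tE _) eb.
have [bW tL bE tE] := step_botP bot.
have tpL := tp (L n); rewrite tE eqxx lL in tpL.
have bpL := bp (L n); rewrite bE lL in bpL.
have [aL|aL] := eqVneq a (L n).
  rewrite aL in tl *.
  have -> : bot_end n (L n) + t < total_length n.+1 by lra.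
  rewrite tL -tS ltNge lerDl t0 /=.
  rewrite [total_length _ + t]addrC addrK.
  have := sga (L n) t; rewrite lL t0 tl FL bE => /(_ isT).
  by congr (`|_| <= _); ring.
have [aW|aW] := eqVneq a (W n).
  rewrite aW in tl *.
  have [tlow|thigh] := ltP t (lamn n (W n) - lamn n (L n)).
    have rg : 0 <= t < lamn n.+1 (W n) by rewrite t0 lW.
    have et : top_end n.+1 (W n) = top_end n (W n) by rewrite tE (negbTE WLn).
    by have [[-> ->]] := inI _ _ WLn rg et (bE _).
  pose u := t - (lamn n (W n) - lamn n (L n)).
  have tu : t = u + (lamn n (W n) - lamn n (L n)) by rewrite /u subrK.
  have u0 : 0 <= u by rewrite /u; lra.
  have ul : u < lamn n (L n) by rewrite /u; lra.
  have eb : bot_end n (W n) + t = total_length n.+1 + u by rewrite bW tS tu; ring.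
  have et : top_end n (W n) + t = top_end n.+1 (L n) + u by rewrite tE eqxx tu; ring.
  rewrite eb et ltNge lerDl u0 /=.
  have -> : top_end n.+1 (L n) + u < total_length n.+1 by have := tp (L n); rewrite lL; lra.
  by rewrite [total_length _ + u]addrC addrK -tu (_ : _ - F n (W n) t = 0) ?normr0 //; ring.
have rg : 0 <= t < lamn n.+1 a by rewrite t0 (lamnS stepWL) (negbTE aW).
have et : top_end n.+1 a = top_end n a by rewrite tE (negbTE aL).
by have [[-> ->]] := inI _ _ aL rg et (bE _).
Qed.

Lemma extend_arg n y : ~~ (y < total_length n.+1) -> y < total_length n ->
  0 <= y - total_length n.+1 < lamn n (L n) /\
  0 <= top_end n.+1 (L n) + (y - total_length n.+1) < total_length n.+1.
Proof.
rewrite -leNgt => h1 h2; have tS := total_lengthS n.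
have lL : lamn n.+1 (L n) = lamn n (L n).
  by rewrite (lamnS stepWL) eq_sym (negbTE (WL n)).
have := top_end_le n.+1 (L n); have := top_end_ge0 n.+1 (L n); rewrite lL => h3 h4.
by split; lra.
Qed.

(** The term added by [extend] does not depend on the function extended, so it cancels in
    differences. *)
Lemma extend_diff n g1 g2 d : (forall y, 0 <= y < total_length n.+1 -> `|g1 y - g2 y| <= d) ->
  forall y, 0 <= y < total_length n -> `|extend n g1 y - extend n g2 y| <= d.
Proof.
move=> h y /andP[y0 yl]; rewrite /extend; case: ifPn => yl'; first by apply: h; rewrite y0.
have [_ arg] := extend_arg yl' yl.
by rewrite opprD addrACA subrr addr0; exact: h.
Qed.

Lemma extend_bound n g d B : (forall y, 0 <= y < total_length n.+1 -> `|g y| <= d) ->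
  (forall a x, cell s n a x -> `|F n a x| <= B) -> 0 <= B ->
  forall y, 0 <= y < total_length n -> `|extend n g y| <= d + B.
Proof.
move=> h hF B0 y /andP[y0 yl]; rewrite /extend; case: ifPn => yl'.
  by have /h := introT andP (conj y0 yl'); lra.
have [/andP[arg0 arg1] arg] := extend_arg yl' yl.
apply: (le_trans (ler_normD _ _)); apply: lerD; first exact: h.
have := lam0 n.+1 (W n); rewrite (lamnS stepWL) eqxx => lW.
by case: ifP => _; apply: hF; rewrite /cell; lra.
Qed.

Lemma measurable_extend n g : measurable_fun [set: R] g ->
  (forall a, measurable_fun [set: R] (F n a)) -> measurable_fun [set: R] (extend n g).
Proof.
move=> mg mF; rewrite /extend; apply: measurable_fun_ifT => //.
  exact: measurable_fun_ltr.
apply: measurable_funD.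
  apply: (measurableT_comp mg); apply: measurable_funD => //.
  exact: measurable_funB.
case: (is_top n); apply: (measurableT_comp (mF _)); first exact: measurable_funB.
by apply: measurable_funD => //; exact: measurable_funB.
Qed.

Lemma measurable_special : (forall a, measurable_fun [set: R] (F 0%N a)) ->
  forall n a, measurable_fun [set: R] (F n a).
Proof.
move=> h; elim=> [//|n IH] a.
have [->|aL] := eqVneq a (L n); last first.
  by rewrite (_ : F n.+1 a = F n a) //; apply: funext => x; rewrite sF // (negbTE aL).
rewrite (_ : F n.+1 (L n) = fun x => F n (L n) x + F n (W n) (x + (lamn n (W n) - lamn n (L n)))).
  apply: measurable_funD; first exact: IH.
  by apply: (measurableT_comp (IH _)); exact: measurable_funD.
by apply: funext => x; rewrite sF // eqxx.
Qed.

Fixpoint extends m k (g : R -> R) : R -> R :=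
  if k is k'.+1 then extend m (extends m.+1 k' g) else g.

Lemma extends_cat m k p g : extends m (k + p) g = extends m k (extends (m + k) p g).
Proof.
elim: k m => [|k IH] m; first by rewrite addn0.
by rewrite addSn /= IH addnS.
Qed.

Lemma extends_solves m k g eps : 0 <= eps -> solves (m + k) g eps ->
  solves m (extends m k g) eps.
Proof.
move=> eps0; elim: k m => [|k IH] m; first by rewrite addn0.
by rewrite -addSnnS => /IH /(extend_solves eps0).
Qed.

Lemma extends_diff m k g1 g2 d :
  (forall y, 0 <= y < total_length (m + k) -> `|g1 y - g2 y| <= d) ->
  forall y, 0 <= y < total_length m -> `|extends m k g1 y - extends m k g2 y| <= d.
Proof.
elim: k m => [|k IH] m; first by rewrite addn0.
by rewrite -addSnnS => /IH /extend_diff.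
Qed.

Lemma extends_bound m k B : 0 <= B ->
  (forall n a x, (m <= n < m + k)%N -> cell s n a x -> `|F n a x| <= B) ->
  forall y, 0 <= y < total_length m -> `|extends m k (fun=> 0) y| <= k%:R * B.
Proof.
move=> B0; elim: k m => [|k IH] m h; first by move=> y _ /=; rewrite normr0 mul0r.
move=> y yI; rewrite -natr1 mulrDl mul1r /=; apply: extend_bound => //.
  by apply: IH => n a x hn; apply: h; lia.
by move=> a x; apply: h; lia.
Qed.

Lemma measurable_extends m k g : measurable_fun [set: R] g ->
  (forall a, measurable_fun [set: R] (F 0%N a)) -> measurable_fun [set: R] (extends m k g).
Proof.
move=> mg mF; elim: k m => [//|k IH] m /=.
by apply: measurable_extend; [exact: IH|exact: measurable_special].
Qed.

End Equation.
End Extension.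

(** * A bounded solution as a uniform limit *)

Section UniformLimit.
Variables (R : realType) (A : finType) (s : rv_state R A) (W L : nat -> A) (nk : nat -> nat).
Hypothesis cs : comb_state s.
Hypothesis stepWL : forall n,
  step_top (rv_seq s n) (W n) (L n) \/ step_bot (rv_seq s n) (W n) (L n).
Notation lamn n := (st_lam (rv_seq s n)).
Hypothesis WL : forall n, W n != L n.
Hypothesis lam0 : forall n a, 0 < lamn n a.
Hypothesis nk0 : nk 0%N = 0%N.
Hypothesis nk_incr : forall k, (nk k < nk k.+1)%N.
Variables (F : nat -> A -> R -> R) (T r : nat -> R).
Hypothesis sF : special_from s W L 0 F.
Hypothesis hT : forall k n a x, (nk k <= n <= nk k.+1)%N -> cell s n a x ->
  (nk k.+1 - nk k)%:R * `|F n a x| <= T k.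
Hypothesis hr : forall k m, \sum_(i < m) T (k + i)%N <= r k.
Hypothesis r_small : forall (eps : R) k0, 0 < eps -> exists k, (k0 <= k)%N /\ r k <= eps.
Hypothesis mF : forall a, measurable_fun [set: R] (F 0%N a).

Let psi k := extends s W L F 0 (nk k) (fun=> 0).

Let step_gt0 k : 0 < (nk k.+1 - nk k)%:R :> R.
Proof. by rewrite ltr0n subn_gt0. Qed.

Let step_ge1 k : 1 <= (nk k.+1 - nk k)%:R :> R.
Proof. by rewrite ler1n subn_gt0. Qed.

Let T_ge0 k : 0 <= T k.
Proof.
have c0 : cell s (nk k) (W 0%N) 0 by rewrite /cell lexx ltW.
have kk : (nk k <= nk k <= nk k.+1)%N by rewrite leqnn ltnW.
by apply: le_trans (hT kk c0); rewrite mulr_ge0 // ltW.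
Qed.

Let T_le_r k : T k <= r k.
Proof. by have := hr k 1; rewrite big_ord_recl big_ord0 addr0 addn0. Qed.

(** Both functions extend, from level [nk k], respectively the zero function and its extension
    across block [k]; the latter is bounded by the number of steps times [T k] divided by that
    number. *)
Let psi_step k y : 0 <= y < total_length s 0 -> `|psi k.+1 y - psi k y| <= T k.
Proof.
move=> yI; rewrite /psi -(subnKC (ltnW (nk_incr k))) extends_cat add0n.
apply: (extends_diff stepWL WL lam0) => [z zI|//]; rewrite subr0.
set N := (nk k.+1 - nk k)%N.
apply: le_trans (_ : _ <= N%:R * (T k / N%:R)) _; last first.
  by rewrite mulrC divfK // lt0r_neq0 // step_gt0.
apply: (extends_bound stepWL WL lam0) zI => //; first by rewrite divr_ge0 // ltW.
move=> n a x hn cx; rewrite ler_pdivlMr ?step_gt0 //. rewrite mulrC; apply: hT => //.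
by have := nk_incr k; move: hn; rewrite /N; lia.
Qed.

Let psi_cauchy k m y : 0 <= y < total_length s 0 -> (k <= m)%N -> `|psi m y - psi k y| <= r k.
Proof.
move=> yI /subnKC <-; apply: le_trans (hr k (m - k)).
elim: (m - k)%N => [|j IH]; first by rewrite addn0 subrr normr0 big_ord0.
rewrite big_ord_recr /= addnS.
rewrite (_ : _ - _ = (psi (k + j)%N y - psi k y) + (psi (k + j).+1 y - psi (k + j)%N y)); last by ring.
by apply: (le_trans (ler_normD _ _)); apply: lerD => //; exact: psi_step.
Qed.

Lemma cohomological_limit : exists Psi : R -> R, [/\ measurable_fun [set: R] Psi,
  exists M, forall y, `|Psi y| <= M &
  forall a t, 0 <= t < st_lam s a ->
    Psi (bot_end s 0 a + t) - Psi (top_end s 0 a + t) = F 0%N a t].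
Proof.
pose I0 y := 0 <= y < total_length s 0.
have r_ge0 k : 0 <= r k by exact: le_trans (T_ge0 k) (T_le_r k).
have lim y : exists l, forall k, I0 y -> `|l - psi k y| <= r k.
  have [yI|yI] := boolP (I0 y); last by exists 0 => k.
  have [|l hl] := @dominated_limit R (fun k => psi k y) r.
    by move=> n m nm; exact: psi_cauchy.
  by exists l.
have [l hl] := choice lim.
(* Zero outside the interval, which makes the function bounded and measurable on the whole line. *)
pose Psi y := if I0 y then l y else 0.
pose h k y := if I0 y then psi k y else 0.
have hPsi k y : `|Psi y - h k y| <= r k.
  by rewrite /Psi /h; case: ifP => [/hl //|_]; rewrite subrr normr0.
exists Psi; split.
- have /choice[kk hkk] : forall j : nat, exists k, r k <= j.+1%:R^-1.
    by move=> j; have [|k [_ hk]] := @r_small j.+1%:R^-1 0; [rewrite invr_gt0|exists k].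
  apply: (@measurable_fun_cvg _ _ _ setT (fun j => h (kk j))).
    move=> j; rewrite /h; apply: measurable_fun_ifT => //.
      by apply: measurable_and; [exact: measurable_fun_ler|exact: measurable_fun_ltr].
    by apply: (measurable_extends sF).
  move=> y _; apply/cvgrPdist_le => /= e e0.
  near=> j; apply: (le_trans (hPsi _ _)); apply: (le_trans (hkk j)); apply: ltW.
  by near: j; exact: (near_infty_natSinv_lt (PosNum e0)).
- exists (r 0%N) => y; have := hPsi 0%N y.
  by rewrite /h /psi nk0 /=; case: ifP => _; rewrite subr0.
move=> a t tl; have /andP[t0 t1] := tl.
have bI : I0 (bot_end s 0 a + t).
  by have := bot_end_ge0 lam0 0 a; have := bot_end_le lam0 0 a; rewrite /I0 /=; lra.
have tI : I0 (top_end s 0 a + t).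
  by have := top_end_ge0 lam0 0 a; have := top_end_le lam0 0 a; rewrite /I0 /=; lra.
apply/eqP; rewrite -subr_eq0 -normr_le0; apply/ler_addgt0Pr => e e0.
have e3 : 0 < e / 3 by lra.
have [k [_ rk]] := r_small 0 e3.
(* At level [nk k] the zero function solves the equation with error at most [T k], and extension
   preserves the error. *)
have sol : solves s F 0 (psi k) (T k).
  apply: (extends_solves cs stepWL WL lam0 sF) => //; rewrite add0n => b u /andP[u0 u1].
  rewrite subr0 sub0r normrN.
  apply: le_trans (_ : _ <= (nk k.+1 - nk k)%:R * `|F (nk k) b u|) _.
    by rewrite ler_peMl.
  have kk : (nk k <= nk k <= nk k.+1)%N by rewrite leqnn ltnW.
  have cu : cell s (nk k) b u by rewrite /cell u0 ltW.
  exact: hT kk cu.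
have := sol a t tl; have := hl _ k bI; have := hl _ k tI; have := T_le_r k.
rewrite /Psi bI tI add0r !ler_norml => Tr /andP[? ?] /andP[? ?] /andP[? ?].
by apply/andP; split; lra.
Unshelve. all: end_near.
Qed.

End UniformLimit.

(** * Absolute continuity and integrals *)

Section Increments.
Variable R : realType.
Implicit Types (f g V : R -> R) (a b l u x y z : R).

(** The supremum of the points up to which the inequality holds from [a] can be passed unless it is
    [b]. The local inequality is asked only for [y] and [z] on either side of [x], the form that a
    derivative at [x] provides. *)
Lemma local_to_global f g a b : a <= b ->
  (forall x, a <= x <= b -> exists d, 0 < d /\ forall y z,
     a <= y -> x - d < y -> y <= x -> x <= z -> z < x + d -> z <= b ->
     `|f z - f y| <= g z - g y) ->
  `|f b - f a| <= g b - g a.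
Proof.
move=> ab loc.
pose E := [set x | a <= x <= b /\ `|f x - f a| <= g x - g a]%classic.
have Ea : E a by rewrite /E /= lexx ab !subrr normr0.
have Eb x : E x -> x <= b by move=> [/andP[]].
have supE : has_sup E by split; [exists a|exists b => x /Eb].
have ac : a <= sup E by apply: ub_le_sup => //; have [] := supE.
have cb : sup E <= b by apply: ge_sup => //; exists a.
have [|d [d0 hd]] := loc (sup E); first by rewrite ac cb.
have [y Ey yd] := sup_adherent d0 supE.
have yc : y <= sup E by apply: ub_le_sup => //; have [] := supE.
have [/andP[ay yb] hy] := Ey.
pose z := Num.min b (sup E + d / 2).
have cz : sup E <= z by rewrite /z le_min cb lerDl; lra.
have zb : z <= b by rewrite /z ge_min lexx.
have zd : z < sup E + d by rewrite /z gt_min ltrD2l; apply/orP; right; lra.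
have h := hd y z ay yd yc cz zd zb.
have Ez : E z.
  split; first by rewrite zb andbT (le_trans ac).
  rewrite (_ : f z - f a = (f z - f y) + (f y - f a)); last by ring.
  by apply: (le_trans (ler_normD _ _)); lra.
have zc : z <= sup E by apply: ub_le_sup => //; have [] := supE.
have zE : z = b.
  move: zc; rewrite /z ge_min => /orP[bc|]; last by lra.
  by apply/eqP; rewrite eq_le zb /= /z le_min lexx /=; lra.
by have [_] := Ez; rewrite zE.
Qed.

Lemma deriv_local l u f x (d M e : R) : inI l u x -> deriv_within l u f x d -> `|d| <= M ->
  0 < e -> exists eta, 0 < eta /\ forall y z, inI l u y -> inI l u z ->
    x - eta < y -> y <= x -> x <= z -> z < x + eta -> `|f z - f y| <= (M + e) * (z - y).
Proof.
move=> xI df dM e0; have [eta [eta0 h]] := df e e0.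
have one w : inI l u w -> `|w - x| < eta -> `|f w - f x| <= (M + e) * `|w - x|.
  move=> wI wx; have [->|wx0] := eqVneq w x; first by rewrite !subrr normr0 mulr0.
  have p : 0 < `|w - x| by rewrite normr_gt0 subr_eq0.
  have hw : `|(f w - f x) / (w - x) - d| < e by apply: h => //; rewrite p.
  rewrite -ler_pdivrMr // -normfV -normrM.
  rewrite (_ : (f w - f x) / (w - x) = ((f w - f x) / (w - x) - d) + d); last by ring.
  by apply: (le_trans (ler_normD _ _)); lra.
exists eta; split=> // y z yI zI y1 y2 z1 z2.
rewrite (_ : f z - f y = (f z - f x) + (f x - f y)); last by ring.
apply: (le_trans (ler_normD _ _)).
have hz := one z zI; have hy := one y yI.
rewrite [`|f x - f y|]distrC (_ : z - y = (z - x) + (x - y)); last by ring.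
rewrite mulrDr; apply: lerD.
  by move: hz; rewrite ger0_norm ?subr_ge0 //; apply; lra.
by move: hy; rewrite [`|y - x|]distrC ger0_norm ?subr_ge0 //; apply; lra.
Qed.

Lemma deriv_within_affine l u f x (d c : R) :
  deriv_within l u f x d -> deriv_within l u (fun t => f t - c * t) x (d - c).
Proof.
move=> h e e0; have [eta [eta0 he]] := h e e0; exists eta; split=> // z zI zx.
have zx0 : z - x != 0 by have /andP[] := zx; rewrite normr_gt0.
rewrite (_ : _ - (d - c) = (f z - f x) / (z - x) - d); first exact: he.
by field.
Qed.

Lemma abs_cont_affine l u f (c : R) : abs_cont_on l u f -> abs_cont_on l u (fun t => f t - c * t).
Proof.
move=> h e e0; have e2 : 0 < e / 2 by lra.
have [d [d0 hd]] := h _ e2.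
have c0 : 0 < `|c| + 1 by rewrite ltr_wpDl.
exists (Num.min d (e / 2 / (`|c| + 1))); split.
  by rewrite lt_min d0 divr_gt0.
move=> s sI ss; rewrite lt_min => /andP[s1 s2].
apply: (@le_lt_trans _ _ (\sum_(p <- s) `|f p.2 - f p.1| + `|c| * \sum_(p <- s) (p.2 - p.1))).
  rewrite mulr_sumr -big_split /= big_seq [leRHS]big_seq; apply: ler_sum => p ps.
  have /andP[/andP[_ p12] _] := allP sI p ps.
  rewrite (_ : _ - _ = (f p.2 - f p.1) - c * (p.2 - p.1)); last by ring.
  by apply: (le_trans (ler_normB _ _)); rewrite lerD2l normrM [`|p.2 - _|]ger0_norm // subr_ge0.
have b1 := hd s sI ss s1.
have S0 : 0 <= \sum_(p <- s) (p.2 - p.1).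
  rewrite big_seq; apply: sumr_ge0 => p ps; rewrite subr_ge0.
  by have /andP[/andP[_ ->] _] := allP sI p ps.
have b2 : (`|c| + 1) * \sum_(p <- s) (p.2 - p.1) < e / 2.
  by rewrite mulrC -ltr_pdivlMr.
by rewrite mulrDl mul1r in b2; lra.
Qed.

(** A mean value inequality, applied to [f] minus a linear function; [local_to_global] also covers
    the one-sided derivative at [l]. *)
Lemma deriv_taylor l u f f' (c M : R) a b : l <= a -> a <= b -> b < u -> deriv_on l u f f' ->
  (forall x, a <= x <= b -> `|f' x - c| <= M) -> `|f b - f a - c * (b - a)| <= M * (b - a).
Proof.
move=> la ab bu df hM; apply/ler_addgt0Pr => e e0.
pose e' := e / (b - a + 1); have e'0 : 0 < e' by rewrite divr_gt0 //; lra.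
have := @local_to_global (fun t => f t - c * t) (fun t => (M + e') * t) a b ab.
rewrite (_ : f b - c * b - (f a - c * a) = f b - f a - c * (b - a)); last by ring.
move=> /(_ _)/le_trans; apply.
  move=> x /andP[ax xb]; have xI : inI l u x by rewrite /inI (le_trans la ax) (le_lt_trans xb bu).
  have [|eta [eta0 h]] := deriv_local xI (deriv_within_affine c (df x xI)) _ e'0 (M := M).
    by apply: hM; rewrite ax.
  exists eta; split=> // y z ay y1 y2 z1 z2 zb; rewrite -mulrBr; apply: h => //.
    by rewrite /inI (le_trans la ay) (le_lt_trans y2 (le_lt_trans xb bu)).
  by rewrite /inI (le_lt_trans zb bu) andbT (le_trans la) // (le_trans ax).
rewrite -mulrBr mulrDl lerD2l /e' mulrAC ler_pdivrMr; last by lra.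
by rewrite ler_wpM2l ?(ltW e0) //; lra.
Qed.

(** Over [n] equal pieces the bounds add up to the increment of [V] times [(b - a) / n], which is
    arbitrarily small. *)
Lemma increments_const (H V : R -> R) a b : a <= b ->
  (forall x y, a <= x -> x <= y -> y <= b -> `|H y - H x| <= (V y - V x) * (y - x)) ->
  H b = H a.
Proof.
move=> ab h; apply/eqP; rewrite -subr_eq0 -normr_le0; apply/ler_addgt0Pr => e e0; rewrite add0r.
pose X := `|V b - V a| * (b - a).
have X0 : 0 <= X by rewrite mulr_ge0 // subr_ge0.
pose n := (Num.truncn (X / e)).+1.
have n0 : 0 < n%:R :> R by rewrite ltr0n.
have Xn : X <= e * n%:R by rewrite mulrC -ler_pdivrMr // ltW // truncnS_gt.
pose w := (b - a) / n%:R; have w0 : 0 <= w by rewrite divr_ge0 ?subr_ge0 // ltW.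
have wn : n%:R * w = b - a by rewrite /w mulrC divfK // lt0r_neq0.
pose x i := a + i%:R * w.
have xS i : x i.+1 = x i + w by rewrite /x -natr1; ring.
have xb i : (i <= n)%N -> x i <= b.
  move=> ni; have : i%:R * w <= n%:R * w by rewrite ler_wpM2r // ler_nat.
  by rewrite wn /x; lra.
have xa i : a <= x i by rewrite lerDl mulr_ge0.
have ind i : (i <= n)%N -> `|H (x i) - H a| <= (V (x i) - V a) * w.
  elim: i => [_|i IH ni]; first by rewrite /x mul0r addr0 !subrr normr0 mul0r.
  have xi : x i <= x i.+1 by rewrite xS lerDl.
  have := h _ _ (xa i) xi (xb _ ni); rewrite {3}xS [x i + w]addrC addrK => h1.
  have h2 := IH (ltnW ni).
  rewrite (_ : H _ - H a = (H (x i.+1) - H (x i)) + (H (x i) - H a)); last by ring.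
  by apply: (le_trans (ler_normD _ _)); lra.
have xn : x n = b by rewrite /x wn; ring.
have := ind n (leqnn n); rewrite xn => /le_trans; apply.
apply: (@le_trans _ _ (`|V b - V a| * w)); first by rewrite ler_wpM2r // ler_norm.
by rewrite /w mulrA ler_pdivrMr.
Qed.

End Increments.

(** * Majorants of functions of bounded variation *)

Section BoundedVariation.
Variable R : realType.
Implicit Types (phi : R -> R) (s : seq R).

Let variation phi s : R := \sum_(i < (size s).-1) `|phi (nth 0 s i.+1) - phi (nth 0 s i)|.

Let variation_rcons phi s y : (0 < size s)%N ->
  variation phi (rcons s y) = variation phi s + `|phi y - phi (last 0 s)|.
Proof.
move=> s0; rewrite /variation size_rcons /=.
have -> : size s = (size s).-1.+1 by rewrite prednK.
rewrite big_ord_recr /=; congr (_ + `|phi _ - phi _|).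
- apply: eq_bigr => i _; have := ltn_ord i; rewrite !nth_rcons => hi.
  have -> : (i.+1 < size s)%N by lia.
  by have -> : (i < size s)%N by lia.
- by rewrite nth_rcons prednK // ltnn eqxx.
- rewrite nth_rcons prednK // leqnn -nth_last //.
Qed.

Let variation_rcons_le phi s y : variation phi s <= variation phi (rcons s y).
Proof.
case: s => [|z s]; last by rewrite variation_rcons // lerDl.
by rewrite /variation /= !big_ord0.
Qed.

Lemma sorted_rcons_le s (y : R) : sorted <=%R s -> all (fun x => x <= y) s ->
  sorted <=%R (rcons s y).
Proof.
case: s => [//|z s] ss sy; rewrite /= rcons_path; apply/andP; split=> //.
exact: (allP sy _ (mem_last z s)).
Qed.

(** The majorant is the total variation up to [x]. *)
Lemma bv_majorant l u phi : bv_on l u phi -> exists (V : R -> R) (K : R),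
  (forall x y, inI l u x -> inI l u y -> x <= y -> `|phi y - phi x| <= V y - V x) /\
  (forall x, inI l u x -> 0 <= V x <= K).
Proof.
move=> [K hK].
pose E x := [set t | exists s, [/\ all (inI l u) s, sorted <=%R s, all (fun z => z <= x) s &
  t = variation phi s]]%classic.
have E0 x : E x 0 by exists [::]; split=> //; rewrite /variation big_ord0.
have ubE x : ubound (E x) K by move=> _ [s [sI ss _ ->]]; exact: hK.
exists (fun x => sup (E x)), K; split; last first.
  move=> x _; apply/andP; split; first by apply: ub_le_sup => //; exists K.
  by apply: ge_sup => //; exists 0.
move=> x y xI yI xy.
suff : sup (E x) <= sup (E y) - `|phi y - phi x| by lra.
apply: ge_sup; first by exists 0.
move=> _ [s [sI ss sx ->]].
suff : variation phi s + `|phi y - phi x| <= sup (E y) by lra.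
(* Inserting [x] before [y] does not decrease the variation and makes the jump from [x] to [y] one
   of its terms, even if the sequence is empty. *)
have e : E y (variation phi (rcons (rcons s x) y)).
  exists (rcons (rcons s x) y); split=> //.
  - by rewrite !all_rcons xI yI.
  - apply: sorted_rcons_le; first exact: sorted_rcons_le.
    by rewrite all_rcons xy /=; apply: sub_all sx => z /le_trans; apply.
  by rewrite !all_rcons lexx xy /=; apply: sub_all sx => z /le_trans; apply.
apply: (@le_trans _ _ (variation phi (rcons (rcons s x) y))); last first.
  by apply: ub_le_sup => //; exists K.
rewrite variation_rcons ?size_rcons // last_rcons lerD2r.
exact: variation_rcons_le.
Qed.

End BoundedVariation.

(** * A mean value inequality for absolutely continuous functions *)

Section AbsoluteContinuity.
Local Open Scope classical_set_scope.
Local Open Scope ring_scope.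
Variable R : realType.
Notation mu := (@lebesgue_measure R).
Implicit Types (f : R -> R) (a b l u x y z : R) (s : seq (R * R)).

Let chain (p q : R * R) := p.2 <= q.1.

(** The pair [p0] is the previous interval of the chain: restricting [U] to the right of it lets the
    induction add disjoint pieces. *)
Lemma length_in_measurable (U : set R) s (p0 : R * R) : measurable U -> path chain p0 s ->
  (forall p, p \in s -> p.1 <= p.2 /\ `[p.1, p.2[ `<=` U) ->
  ((\sum_(p <- s) (p.2 - p.1))%:E <= mu (U `&` `[p0.2, +oo[))%E.
Proof.
move=> mU; elim: s p0 => [|q s IH] p0 /=; first by rewrite big_nil.
move=> /andP[pq qs] h; rewrite big_cons EFinD.
have [q12 qU] : q.1 <= q.2 /\ `[q.1, q.2[ `<=` U by apply: h; rewrite inE eqxx.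
have hs : forall p, p \in s -> p.1 <= p.2 /\ `[p.1, p.2[ `<=` U.
  by move=> p ps; apply: h; rewrite inE ps orbT.
have mq : mu `[q.1, q.2[ = (q.2 - q.1)%:E.
  rewrite lebesgue_measure_itv /= lte_fin; case: ltgtP q12 => // -> _.
  by rewrite subrr.
apply: (@le_trans _ _ (mu (`[q.1, q.2[ `|` (U `&` `[q.2, +oo[)))).
  rewrite measureU //.
  - rewrite -[in leLHS]mq; apply: leeD => //; exact: IH.
  - exact: measurableI.
  - apply/seteqP; split=> // z [] /=; rewrite !in_itv /= => /andP[_ zq] [_].
    by rewrite andbT leNgt zq.
apply: le_measure; rewrite ?inE //.
- by apply: measurableU => //; exact: measurableI.
- exact: measurableI.
move=> z [/= zq|[Uz /=]].
  split; first exact: qU.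
  by move: zq; rewrite /= !in_itv /= andbT => /andP[qz _]; rewrite (le_trans pq).
rewrite !in_itv /= !andbT => qz; split=> //=.
by rewrite ?in_itv /= ?andbT (le_trans pq) // (le_trans q12).
Qed.

(* The null set where the derivative is not controlled is put inside an open set of small measure;
   the variation of f along intervals contained in it is small by absolute continuity. *)
Lemma abs_cont_mean l u f f' (M : R) a b : l <= a -> a <= b -> b < u -> abs_cont_on l u f ->
  {ae mu, forall x, inI l u x -> deriv_within l u f x (f' x)} ->
  (forall x, a <= x <= b -> `|f' x| <= M) -> `|f b - f a| <= M * (b - a).
Proof.
move=> la ab bu acf [N [mN N0 subN]] hM; apply/ler_addgt0Pr => e e0.
pose e1 := e / 2; have e10 : 0 < e1 by rewrite /e1; lra.
have [d [d0 hd]] := acf _ e10.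
have [|U [oU NU Ud]] := lebesgue_regularity_outer mN _ d0.
  by rewrite [ltLHS]N0.
have mU : measurable U := open_measurable oU.
have muU : (mu U < d%:E)%E.
  rewrite (measureDI mu mU mN) [X in (_ + X)%E](_ : _ = 0) ?adde0 //.
  apply/eqP; rewrite -measure_le0 -[leRHS]N0; apply: le_measure; rewrite ?inE //.
    exact: measurableI.
pose valid x s := path chain (a, a) s /\ forall p, p \in s -> [/\ a <= p.1, p.1 <= p.2, p.2 <= x &
  forall z, p.1 <= z <= p.2 -> U z].
pose E x := [set t | exists s, valid x s /\ t = \sum_(p <- s) `|f p.2 - f p.1|].
(* The largest variation of [f] along chains of intervals contained in [U] and ending before [x];
   the total length of a chain is below [d], so [v] is at most [e1]. *)
pose v x := sup (E x).
have E0 x : E x 0 by exists [::]; rewrite big_nil; split=> //; split.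
have ubE x : x <= b -> ubound (E x) e1.
  move=> xb _ [s [[ps hs] ->]]; apply: ltW; apply: hd.
  - apply/allP => p /hs[ap p12 px _]; rewrite (le_trans la ap) p12 /=.
    exact: le_lt_trans px (le_lt_trans xb bu).
  - exact: path_sorted ps.
  rewrite -lte_fin; apply: le_lt_trans muU.
  apply: (@le_trans _ _ (mu (U `&` `[(a, a).2, +oo[))).
    apply: length_in_measurable => // p /hs[ap p12 px hU]; split=> // z /=.
    by rewrite in_itv /= => /andP[z1 z2]; apply: hU; rewrite z1 ltW.
  apply: le_measure; rewrite ?inE //; exact: measurableI.
have v_ge0 x : x <= b -> 0 <= v x by move=> xb; apply: ub_le_sup => //; exists e1; exact: ubE.
have v_le x : x <= b -> v x <= e1 by move=> xb; apply: ge_sup; [exists 0|exact: ubE].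
have v_mono x y : x <= y -> y <= b -> v x <= v y.
  move=> xy yb; apply: ge_sup; first by exists 0.
  move=> t [s [[ps hs] ->]]; apply: ub_le_sup; first by exists e1; exact: ubE.
  exists s; split=> //; split=> // p /hs[h1 h2 h3 h4]; split=> //; exact: le_trans xy.
have v_step y z : a <= y -> y <= z -> z <= b -> (forall w, y <= w <= z -> U w) ->
    `|f z - f y| <= v z - v y.
  move=> ay yz zb yzU; rewrite lerBrDr addrC -lerBrDr; apply: ge_sup; first by exists 0.
  move=> t [s [[ps hs] ->]]; rewrite lerBrDr; apply: ub_le_sup; first by exists e1; exact: ubE.
  exists (rcons s (y, z)); split; last by rewrite -cats1 big_cat /= big_seq1.
  split.
    rewrite rcons_path ps /chain /=.
    by have := mem_last (a, a) s; rewrite inE => /orP[/eqP -> //|/hs[]].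
  move=> p; rewrite mem_rcons inE => /orP[/eqP -> //|/hs[h1 h2 h3 h4]]; split=> //.
  exact: le_trans yz.
pose e' := e1 / (b - a + 1); have e'0 : 0 < e' by rewrite divr_gt0 //; lra.
(* Near a point of the null set the increments are paid by [v], near any other point by the linear
   term. *)
have := @local_to_global R f (fun t => (M + e') * t + v t) a b ab.
move=> /(_ _)/le_trans; apply; last first.
  have h1 := v_le b (lexx b); have h2 := v_ge0 a ab.
  have h3 : e' * (b - a) <= e1.
    by rewrite /e' mulrAC ler_pdivrMr; [rewrite ler_wpM2l ?(ltW e10) //; lra|lra].
  have -> : e = e1 + e1 by rewrite /e1; field.
  have -> : (M + e') * b + v b - ((M + e') * a + v a) = M * (b - a) + e' * (b - a) + (v b - v a) by ring.
  lra.
move=> x /andP[ax xb]; have xI : inI l u x by rewrite /inI (le_trans la ax) (le_lt_trans xb bu).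
have Mge0 : 0 <= M by apply: le_trans (hM x _); rewrite // ax.
have [Nx|Nx] := pselect (N x).
  have [eta /= eta0 etaU] : exists2 eta, 0 < eta & ball x eta `<=` U.
    by have /nbhs_ballP[eta /= eta0 h] := open_nbhs_nbhs (conj oU (NU x Nx)); exists eta.
  exists eta; split=> // y z ay y1 y2 z1 z2 zb.
  have yz := le_trans y2 z1.
  have : `|f z - f y| <= v z - v y.
    apply: v_step => // w /andP[yw wz]; apply: etaU; rewrite /ball /= ltr_norml.
    by apply/andP; split; lra.
  move=> /le_trans; apply.
  have : 0 <= (M + e') * (z - y) by rewrite mulr_ge0 ?subr_ge0 // addr_ge0 // ltW.
  lra.
have dx : deriv_within l u f x (f' x).
  by apply: contrapT => h; apply: Nx; apply: subN => /(_ xI).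
have [|eta [eta0 h]] := deriv_local xI dx _ e'0 (M := M); first by apply: hM; rewrite ax.
exists eta; split=> // y z ay y1 y2 z1 z2 zb.
have yI : inI l u y by rewrite /inI (le_trans la ay) (le_lt_trans y2 (le_lt_trans xb bu)).
have zI : inI l u z.
  by rewrite /inI (le_lt_trans zb bu) andbT (le_trans la) // (le_trans ax).
apply: (le_trans (h y z yI zI y1 y2 z1 z2)).
have := v_mono _ _ (le_trans y2 z1) zb; lra.
Qed.

Lemma abs_cont_taylor l u f f' (c M : R) a b : l <= a -> a <= b -> b < u -> abs_cont_on l u f ->
  {ae mu, forall x, inI l u x -> deriv_within l u f x (f' x)} ->
  (forall x, a <= x <= b -> `|f' x - c| <= M) -> `|f b - f a - c * (b - a)| <= M * (b - a).
Proof.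
move=> la ab bu acf df hM.
rewrite (_ : _ - _ = (f b - c * b) - (f a - c * a)); last by ring.
apply: (@abs_cont_mean l u (fun t => f t - c * t) (fun t => f' t - c)) => //.
  exact: abs_cont_affine.
have [N [mN N0 subN]] := df; exists N; split=> // x /= h; apply: subN => dx.
by apply: h => xI; apply: deriv_within_affine; exact: dx.
Qed.

End AbsoluteContinuity.

(** * Integrals of bounded measurable functions *)

Section BoundedMeasurable.
Local Open Scope classical_set_scope.
Local Open Scope ring_scope.
Variable R : realType.
Notation mu := (@lebesgue_measure R).
Implicit Types (f g h : R -> R) (l u x y z c d M : R).

Definition bounded_measurable g := measurable_fun [set: R] g /\ exists M, forall t, `|g t| <= M.

Definition integ g x y : R := \int[mu]_(t in `[x, y[) g t.

Lemma bounded_measurable_integrable g x y : bounded_measurable g ->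
  mu.-integrable `[x, y[ (EFin \o g).
Proof.
move=> [mg [M hM]]; apply: measurable_bounded_integrable => //.
- rewrite [ltLHS]lebesgue_measure_itv /=; case: ifP => _; last exact: ltry.
  by rewrite -EFinB ltry.
- exact: measurable_funTS.
- exists M; split; first exact: num_real.
  by move=> N MN t _ /=; rewrite (le_trans (hM t)) // ltW.
Qed.

Lemma integ_empty g x y : y <= x -> integ g x y = 0.
Proof.
by move=> yx; rewrite /integ set_itv_ge ?Rintegral_set0 // bnd_simp -leNgt.
Qed.

Lemma integ_cat g x y z : bounded_measurable g -> x <= y -> y <= z ->
  integ g x z = integ g x y + integ g y z.
Proof.
move=> bg xy yz; rewrite /integ.
have -> : `[x, z[%classic = `[x, y[%classic `|` `[y, z[%classic.
  apply/seteqP; split=> t /=; rewrite !in_itv /=.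
    by case: (ltP t y) => ty /andP[xt tz]; [left|right]; rewrite ?xt ?ty.
  move=> [/andP[xt ty]|/andP[yt tz]]; first by rewrite xt (lt_le_trans ty).
  by rewrite tz (le_trans xy).
apply: Rintegral_setU => //.
  rewrite (_ : _ `|` _ = `[x, z[%classic); first exact: bounded_measurable_integrable.
  apply/seteqP; split=> t /=; rewrite !in_itv /=; last first.
    by case: (ltP t y) => ty /andP[xt tz]; [left|right]; rewrite ?xt ?ty.
  move=> [/andP[xt ty]|/andP[yt tz]]; first by rewrite xt (lt_le_trans ty).
  by rewrite tz (le_trans xy).
apply/disj_setPS => t [] /=; rewrite !in_itv /= => /andP[_ ty] /andP[yt _].
by move: ty; rewrite ltNge yt.
Qed.

Lemma integ_ext g h x y : (forall t, x <= t -> t < y -> g t = h t) -> integ g x y = integ h x y.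
Proof.
move=> e; apply: eq_Rintegral => t; rewrite inE /= in_itv /= => /andP[xt ty]; exact: e.
Qed.

Lemma integ_cst c x y : x <= y -> integ (fun=> c) x y = c * (y - x).
Proof.
move=> xy; rewrite /integ Rintegral_cst //; congr (_ * _).
rewrite [X in fine X](lebesgue_measure_itv `[x, y[) /= lte_fin.
by case: ltgtP xy => // -> _; rewrite subrr.
Qed.

Lemma bounded_measurable_cst c : bounded_measurable (fun=> c).
Proof. by split; [exact: measurable_cst|exists `|c|]. Qed.

Lemma bounded_measurableD g h : bounded_measurable g -> bounded_measurable h ->
  bounded_measurable (fun t => g t + h t).
Proof.
move=> [mg [M hM]] [mh [N hN]]; split; first exact: measurable_funD.
by exists (M + N) => t; rewrite (le_trans (ler_normD _ _)) // lerD.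
Qed.

Lemma bounded_measurableN g : bounded_measurable g -> bounded_measurable (fun t => - g t).
Proof.
move=> [mg [M hM]]; split; first exact: measurable_funN.
by exists M => t; rewrite normrN.
Qed.

Lemma bounded_measurableB g h : bounded_measurable g -> bounded_measurable h ->
  bounded_measurable (fun t => g t - h t).
Proof. by move=> bg bh; apply: bounded_measurableD => //; exact: bounded_measurableN. Qed.

Lemma bounded_measurable_shift g d : bounded_measurable g ->
  bounded_measurable (fun t => g (t + d)).
Proof.
move=> [mg [M hM]]; split; last by exists M.
by apply: (measurableT_comp mg); exact: measurable_funD.
Qed.

Lemma integD g h x y : bounded_measurable g -> bounded_measurable h ->
  integ (fun t => g t + h t) x y = integ g x y + integ h x y.
Proof. by move=> bg bh; apply: RintegralD => //; exact: bounded_measurable_integrable. Qed.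

Lemma integB g h x y : bounded_measurable g -> bounded_measurable h ->
  integ (fun t => g t - h t) x y = integ g x y - integ h x y.
Proof. by move=> bg bh; apply: RintegralB => //; exact: bounded_measurable_integrable. Qed.

Lemma integ_near g x y c M : bounded_measurable g -> x <= y ->
  (forall t, x <= t -> t < y -> `|g t - c| <= M) -> `|integ g x y - c * (y - x)| <= M * (y - x).
Proof.
move=> bg xy h.
have b k : mu.-integrable `[x, y[ (EFin \o (fun=> k)).
  by apply: bounded_measurable_integrable; exact: bounded_measurable_cst.
have h1 : integ (fun=> c - M) x y <= integ g x y.
  apply: le_Rintegral => //; first exact: bounded_measurable_integrable.
  by move=> t /=; rewrite in_itv /= => /andP[xt ty]; have := h t xt ty; rewrite ler_norml; lra.
have h2 : integ g x y <= integ (fun=> c + M) x y.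
  apply: le_Rintegral => //; first exact: bounded_measurable_integrable.
  by move=> t /=; rewrite in_itv /= => /andP[xt ty]; have := h t xt ty; rewrite ler_norml; lra.
rewrite !integ_cst // in h1 h2.
by rewrite ler_norml; lra.
Qed.

Lemma integ_bound g x y M : bounded_measurable g -> x <= y -> (forall t, `|g t| <= M) ->
  `|integ g x y| <= M * (y - x).
Proof.
move=> bg xy h; have := @integ_near g x y 0 M bg xy; rewrite mul0r subr0; apply.
by move=> t _ _; rewrite subr0.
Qed.

(** The image measure under a translation gives half-open intervals their length, which
    characterizes Lebesgue measure. *)
Lemma lebesgue_measure_shift d (D : set R) : measurable D ->
  pushforward mu (fun t : measurableTypeR R => (t : R) + d : measurableTypeR R) D = mu D.
Proof.
have mshift : measurable_fun [set: measurableTypeR R]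
    (fun t : measurableTypeR R => (t : R) + d : measurableTypeR R).
  exact: measurable_funD.
move=> mD; symmetry.
apply: (@lebesgue_measure_unique R
  (measure_function_pushforward__canonical__measure_function_Measure mu mshift)) => //.
move=> _ [[x y] /= _ <-] /=; rewrite /pushforward /=.
rewrite (_ : _ @^-1` _ = `]x - d, y - d]%classic).
  rewrite !lebesgue_measure_itv /= !lte_fin ltrD2r; case: ifP => // _.
  by rewrite -!EFinB; congr (_%:E); ring.
by apply/seteqP; split=> t /=; rewrite !in_itv /= ltrBlDr lerBrDr.
Qed.

Lemma integ_shift g x y d : bounded_measurable g ->
  integ (fun t => g (t + d)) x y = integ g (x + d) (y + d).
Proof.
move=> bg; have mshift : measurable_fun [set: measurableTypeR R]
    (fun t : measurableTypeR R => (t : R) + d : measurableTypeR R).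
  exact: measurable_funD.
pose nu := measure_function_pushforward__canonical__measure_function_Measure mu mshift.
have pre : (fun t : R => t + d) @^-1` `[x + d, y + d[%classic = `[x, y[%classic.
  by apply/seteqP; split=> t /=; rewrite !in_itv /= lerD2r ltrD2r.
rewrite /integ /Rintegral; congr fine.
pose I := `[x + d, y + d[%classic; rewrite -/I in pre *.
transitivity (\int[nu]_(t in I) (g t)%:E)%E; last first.
  by apply: eq_measure_integral => D mD _; exact: lebesgue_measure_shift.
rewrite integral_pushforward //.
- by rewrite pre.
- by apply/measurable_EFinP; have [] := bg.
- rewrite pre; apply: bounded_measurable_integrable; exact: bounded_measurable_shift.
- exact: measurable_itv.
Qed.

Lemma lipschitz_measurable g (K : R) : (forall x y, `|g x - g y| <= K * `|x - y|) ->
  measurable_fun [set: R] g.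
Proof.
move=> h; rewrite (_ : g = fun t => (g t + K * t) - K * t); last by apply: funext => t; ring.
apply: measurable_funB; last exact: measurable_funM.
apply: nondecreasing_measurable => // x y xy.
have := h x y; rewrite [`|x - y|]distrC [`|y - x|]ger0_norm ?subr_ge0 // ler_norml; lra.
Qed.

Lemma integ_lipschitz g l M : bounded_measurable g -> (forall t, `|g t| <= M) ->
  forall x y, `|integ g l x - integ g l y| <= M * `|x - y|.
Proof.
move=> bg hM; have M0 : 0 <= M by apply: le_trans (hM 0).
suff h x y : x <= y -> `|integ g l x - integ g l y| <= M * (y - x).
  move=> x y; case: (leP x y) => xy; first by rewrite [`|x - y|]distrC [`|y - x|]ger0_norm ?subr_ge0 // h.
  have yx := ltW xy.
  by rewrite [`|integ g l x - _|]distrC [`|x - y|]ger0_norm ?subr_ge0 // h.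
move=> xy; have [yl|ly] := leP y l.
  rewrite !integ_empty ?(le_trans xy) // subrr normr0 mulr_ge0 // subr_ge0 //.
have [xl|lx] := leP x l.
  rewrite (integ_empty _ xl) sub0r normrN; apply: (le_trans (integ_bound bg (ltW ly) hM)).
  by rewrite ler_wpM2l //; lra.
rewrite (integ_cat bg (ltW lx) xy) opprD addrA subrr sub0r normrN.
exact: integ_bound.
Qed.

Definition clamp l u g t := if inI l u t then g t else 0.

(** The Jordan decomposition: [g] is the difference of the nondecreasing functions [g + V] and
    [V]. *)
Lemma clamp_bounded_measurable l u g (V : R -> R) (K : R) :
  (forall x y, inI l u x -> inI l u y -> x <= y -> `|g y - g x| <= V y - V x) ->
  (forall x, inI l u x -> 0 <= V x <= K) -> bounded_measurable (clamp l u g).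
Proof.
move=> inc hV; have [ul|lu] := leP u l.
  rewrite (_ : clamp l u g = fun=> 0); first exact: bounded_measurable_cst.
  by apply: funext => t; rewrite /clamp /inI; case: ifP => // /andP[? ?]; lra.
have lI : inI l u l by rewrite /inI lexx.
pose B := `|g l| + K.
have gB x : inI l u x -> `|g x| <= B.
  move=> xI; have /andP[lx _] := xI; have := inc l x lI xI lx.
  have /andP[? ?] := hV x xI; have /andP[? ?] := hV l lI => h.
  rewrite (_ : g x = (g x - g l) + g l); last by ring.
  by apply: (le_trans (ler_normD _ _)); rewrite /B; lra.
have B0 : 0 <= B by apply: le_trans (gB l lI).
split; last first.
  by exists B => t; rewrite /clamp; case: ifP => [/gB //|_]; rewrite normr0.
(* A nondecreasing function bounded by [C] on the interval stays nondecreasing on the line when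
   continued by [- C] on the left and [C] on the right. *)
have ext (w : R -> R) (C : R) : (forall x, inI l u x -> - C <= w x <= C) -> 0 <= C ->
    (forall x y, inI l u x -> inI l u y -> x <= y -> w x <= w y) ->
    measurable_fun [set: R] (fun t => if t < l then - C else if t < u then w t else C).
  move=> wC C0 wm; apply: nondecreasing_measurable => // x y xy.
  case: (ltP x l) => xl.
    case: (ltP y l) => yl; first exact: lexx.
    case: (ltP y u) => yu; last by lra.
    by have /andP[] : - C <= w y <= C by apply: wC; rewrite /inI yl.
  have ly : l <= y by rewrite (le_trans xl).
  have -> : y < l = false by rewrite ltNge ly.
  case: (ltP x u) => xu.
    have xI : inI l u x by rewrite /inI xl.
    case: (ltP y u) => yu; last by have /andP[] := wC x xI.
    by apply: wm => //; rewrite /inI ly.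
  by rewrite ltNge (le_trans xu xy).
have mI : measurable_fun [set: R] (inI l u).
  by apply: measurable_and; [exact: measurable_fun_ler|exact: measurable_fun_ltr].
pose C := B + K; have K0 : 0 <= K by have /andP[] := hV l lI; exact: le_trans.
have C0 : 0 <= C by rewrite addr_ge0.
have m1 := ext (fun t => g t + V t) C _ C0 _; have m2 := ext V C _ C0 _.
rewrite (_ : clamp l u g = fun t => if inI l u t then
   (if t < l then - C else if t < u then g t + V t else C) -
   (if t < l then - C else if t < u then V t else C) else 0); last first.
  apply: funext => t; rewrite /clamp /inI; case: ifP => // /andP[lt tu].
  by rewrite ltNge lt tu /=; ring.
apply: measurable_fun_ifT => //; apply: measurable_funB; [apply: m1|apply: m2].
- move=> x xI; have := gB x xI; have /andP[? ?] := hV x xI; rewrite ler_norml /C => /andP[? ?].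
  by apply/andP; split; lra.
- move=> x y xI yI xy; have := inc x y xI yI xy; rewrite ler_norml => /andP[? ?]; lra.
- by move=> x xI; have /andP[? ?] := hV x xI; rewrite /C; apply/andP; split; lra.
- move=> x y xI yI xy; have := inc x y xI yI xy; have := normr_ge0 (g y - g x); lra.
Qed.

Lemma integral_clamp l u g : bounded_measurable (clamp l u g) ->
  (\int[mu]_(x in `[l, u[) (g x)%:E)%E = (integ (clamp l u g) l u)%:E.
Proof.
move=> bg; rewrite /integ /Rintegral fineK; last first.
  by apply: integrable_fin_num => //; exact: bounded_measurable_integrable.
apply: eq_integral => t; rewrite inE /= in_itv /= => tI.
by rewrite /clamp /inI tI.
Qed.

(* Both sides have increments close to those of the same step functions. *)
Lemma integ_primitive (f g V : R -> R) l u : bounded_measurable g -> l <= u ->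
  (forall x y, l <= x -> x <= y -> y <= u ->
     `|f y - f x - g x * (y - x)| <= (V y - V x) * (y - x)) ->
  (forall x t, l <= x -> x <= t -> t < u -> `|g t - g x| <= V t - V x) ->
  (forall x y, l <= x -> x <= y -> y <= u -> V x <= V y) ->
  f u - f l = integ g l u.
Proof.
move=> bg lu hf hg hV; apply/eqP; rewrite -subr_eq0; apply/eqP.
pose H x := f x - f l - integ g l x.
have : H u = H l.
  apply: (@increments_const R H (fun t => 2 * V t)) => // x y lx xy yu.
  have h1 := hf x y lx xy yu.
  have h2 : `|integ g x y - g x * (y - x)| <= (V y - V x) * (y - x).
    apply: integ_near => // t xt ty; apply: (le_trans (hg x t lx xt (lt_le_trans ty yu))).
    by rewrite lerD2r hV ?(le_trans lx xt) // ltW.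
  rewrite /H (integ_cat bg lx xy).
  rewrite (_ : _ - _ = (f y - f x - g x * (y - x)) - (integ g x y - g x * (y - x))); last by ring.
  by apply: (le_trans (ler_normB _ _)); lra.
by rewrite /H => ->; rewrite subrr sub0r integ_empty // oppr0.
Qed.

End BoundedMeasurable.

Section Telescope.
Variables (R : realType) (A : finType).

(** The cells tile the whole interval, whichever of the two orders places them. This is how the
    invariance of the integral under the exchange is used. *)
Lemma integ_left_ends p (lam : A -> R) g : comb_bij p -> (forall b, 0 < lam b) ->
  bounded_measurable g ->
  \sum_a integ g (left_end p lam a) (left_end p lam a + lam a) = integ g 0 (lamstar lam).
Proof.
move=> pb l0 bg; have [pinj pran] := pb.
pose G k := \sum_(b | (p b <= k)%N) lam b.
have G0 k : 0 <= G k by apply: sumr_ge0 => b _; exact: ltW.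
suff h k : (k <= #|A|)%N -> \sum_(a | (p a <= k)%N)
    integ g (left_end p lam a) (left_end p lam a + lam a) = integ g 0 (G k).
  have all_le b : (p b <= #|A|)%N by have /andP[] := pran b.
  have -> : lamstar lam = G #|A| by apply: eq_bigl => b; rewrite all_le.
  by rewrite -(h _ (leqnn #|A|)); apply: eq_bigl => b; rewrite all_le.
elim: k => [_|k IH kA].
  have none b : (p b <= 0)%N = false by have /andP[] := pran b; lia.
  by rewrite /G !big_pred0 // integ_empty.
have [a pa] := comb_bij_surj pb (kA : 0 < k.+1 <= #|A|)%N.
have eL : left_end p lam a = G k by rewrite /left_end pa; apply: eq_bigl => b; rewrite ltnS.
have pred b : ((p b <= k.+1) && (b != a))%N = (p b <= k)%N.
  case: (eqVneq b a) => [->|ba]; first by rewrite pa ltnn andbF.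
  rewrite andbT leq_eqVlt; case: eqP => [e|_]; last by rewrite ltnS.
  by exfalso; move/eqP: ba; apply; apply: pinj; rewrite e pa.
have eG : G k.+1 = G k + lam a.
  by rewrite /G (bigD1 a) /= ?pa // addrC; congr (_ + _); apply: eq_bigl.
rewrite (bigD1 a) /= ?pa // (eq_bigl _ _ pred) IH; last exact: ltnW.
rewrite eL eG addrC; symmetry; apply: integ_cat => //.
by rewrite lerDl ltW.
Qed.

End Telescope.

(** * The case of regularity one *)

Section RothCohomology.
Variables (R : realType) (A : finType) (pi0 pi1 : A -> nat) (lam : A -> R).

(** The analytic core, in coordinates of the cells. Measurability of [Psi] is part of the conclusion
    because higher regularity integrates it. *)
Lemma roth_cohomology : (2 <= #|A|)%N -> admissible pi0 pi1 -> (forall a, 0 < lam a) ->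
  roth_type pi0 pi1 lam ->
  forall (Phi phi V : A -> R -> R),
  (forall a x y, 0 <= x -> x <= y -> y <= lam a -> `|phi a y - phi a x| <= V a y - V a x) ->
  (forall a x y, 0 <= x -> x <= y -> y <= lam a ->
    `|Phi a y - Phi a x - phi a x * (y - x)| <= (V a y - V a x) * (y - x)) ->
  \sum_a (Phi a (lam a) - Phi a 0) = 0 ->
  (forall a, measurable_fun [set: R] (Phi a)) ->
  exists (chi : A -> R) (Psi : R -> R), [/\ measurable_fun [set: R] Psi,
    exists M, forall y, `|Psi y| <= M &
    forall a t, 0 <= t < lam a ->
      Psi (left_end pi1 lam a + t) - Psi (left_end pi0 lam a + t) = Phi a t - chi a].
Proof.
move=> cardA2 [b0 [b1 _]] lam_gt0 [_ [nk [blk [rothA [rothB rothC]]]]].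
move=> Phi phi V inc tay mean0 mPhi.
set s := RVState pi0 pi1 lam in blk rothA rothB rothC.
have cs : comb_state s by split.
have [W [L [leWL stepWL]]] := rv_winners (ltnW cardA2) cs.
have [chi [T [r [hT hr hs]]]] :=
  special_correction cs stepWL leWL cardA2 blk lam_gt0 rothA rothB rothC
    (special_sumP s W L Phi) (special_sumP s W L phi) (special_sumP s W L V) inc tay mean0.
have WL := winner_neq_loser cs stepWL cardA2 blk.
have lam0 := lamn_gt0 cs stepWL leWL cardA2 blk lam_gt0.
have nk0 : nk 0%N = 0%N by have [] := blk.
pose F n a x := special_sum s W L Phi n a x - tapply (prodV s 0 n) chi a.
have sF : special_from s W L 0 F.
  by apply: special_fromB; [exact: special_sumP|exact: (special_from_vec stepWL)].
have F0 a t : F 0%N a t = Phi a t - chi a by rewrite /F /= tapply_id.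
have mF a : measurable_fun [set: R] (F 0%N a).
  by rewrite (_ : F 0%N a = fun t => Phi a t - chi a); [exact: measurable_funB|apply: funext].
have [Psi [mPsi bPsi ePsi]] :=
  cohomological_limit cs stepWL WL lam0 nk0 (nk_incr stepWL cardA2 blk) sF hT hr hs mF.
exists chi, Psi; split=> // a t tl; rewrite -F0.
exact: ePsi.
Qed.

End RothCohomology.

(** * Regularity on a single interval *)

Section Pieces.
Variable R : realType.
Notation mu := (@lebesgue_measure R).
Implicit Types (f g V : R -> R) (l u x y : R).

Definition majorized l u g := exists V (K : R),
  (forall x y, inI l u x -> inI l u y -> x <= y -> `|g y - g x| <= V y - V x) /\
  (forall x, inI l u x -> 0 <= V x <= K).

Lemma lipschitz_majorized l u g (K : R) : 0 <= K ->
  (forall x y, inI l u x -> inI l u y -> x <= y -> `|g y - g x| <= K * (y - x)) ->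
  majorized l u g.
Proof.
move=> K0 h; exists (fun t => K * (t - l)), (K * (u - l)); split.
  by move=> x y xI yI xy; apply: (le_trans (h x y xI yI xy)); rewrite -mulrBr; apply: ler_wpM2l => //; lra.
move=> x /andP[lx xu]; rewrite mulr_ge0 ?subr_ge0 //=.
by apply: ler_wpM2l => //; lra.
Qed.

Lemma majorized_bounded l u g : majorized l u g -> exists B, 0 <= B /\
  forall x, inI l u x -> `|g x| <= B.
Proof.
move=> [V [K [inc hV]]]; have [ul|lu] := leP u l.
  by exists 0; split=> // x /andP[? ?]; lra.
have lI : inI l u l by rewrite /inI lexx.
have /andP[V0 V1] := hV l lI.
exists (`|g l| + K); split; first by rewrite addr_ge0 // (le_trans V0).
move=> x xI; have /andP[lx _] := xI; have := inc l x lI xI lx; have /andP[? ?] := hV x xI => h.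
rewrite (_ : g x = (g x - g l) + g l); last by ring.
by apply: (le_trans (ler_normD _ _)); lra.
Qed.

Lemma majorized_measurable l u g : majorized l u g -> bounded_measurable (clamp l u g).
Proof. by move=> [V [K [inc hV]]]; exact: clamp_bounded_measurable inc hV. Qed.

Lemma taylor_primitive l u f g V (K : R) :
  (forall x y, inI l u x -> inI l u y -> x <= y -> `|g y - g x| <= V y - V x) ->
  (forall x, inI l u x -> 0 <= V x <= K) ->
  (forall x y, inI l u x -> inI l u y -> x <= y ->
     `|f y - f x - g x * (y - x)| <= (V y - V x) * (y - x)) ->
  majorized l u f /\ forall x y, inI l u x -> inI l u y -> x <= y ->
    f y - f x = integ (clamp l u g) x y.
Proof.
move=> inc hV tay; have mg : majorized l u g by exists V, K.
have [B [B0 gB]] := majorized_bounded mg.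
split.
  have [ul|lu] := leP u l.
    by apply: (@lipschitz_majorized _ _ _ 0) => // x y /andP[? ?]; lra.
  have lI : inI l u l by rewrite /inI lexx.
  have K0 : 0 <= K by have /andP[] := hV l lI; exact: le_trans.
  apply: (@lipschitz_majorized _ _ _ (B + K)); first by rewrite addr_ge0.
  move=> x y xI yI xy; rewrite (_ : f y - f x = (f y - f x - g x * (y - x)) + g x * (y - x)); last by ring.
  apply: (le_trans (ler_normD _ _)); rewrite mulrDl addrC; apply: lerD.
    by rewrite normrM [`|y - x|]ger0_norm ?subr_ge0 // ler_wpM2r ?subr_ge0 ?gB.
  apply: (le_trans (tay x y xI yI xy)); rewrite ler_wpM2r ?subr_ge0 //.
  by have /andP[? ?] := hV x xI; have /andP[? ?] := hV y yI; lra.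
move=> x y xI yI xy; have /andP[lx _] := xI; have /andP[_ yu] := yI.
have sub z : x <= z -> z <= y -> inI l u z.
  by move=> xz zy; rewrite /inI (le_trans lx xz) (le_lt_trans zy yu).
apply: (@integ_primitive R f (clamp l u g) V) => //; first exact: majorized_measurable.
- move=> z w xz zw wy; have zI := sub z xz (le_trans zw wy).
  by rewrite /clamp zI; apply: tay => //; apply: sub => //; exact: le_trans xz zw.
- move=> z t xz zt ty; have zI := sub z xz (le_trans zt (ltW ty)).
  have tI := sub t (le_trans xz zt) (ltW ty).
  by rewrite /clamp zI tI; exact: inc.
move=> z w xz zw wy; have zI := sub z xz (le_trans zw wy).
have wI := sub w (le_trans xz zw) wy.
by have := inc z w zI wI zw; have := normr_ge0 (g w - g z); lra.
Qed.

(** Descending induction from [D r]: a majorant of one derivative gives a Taylor bound, hence a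
    majorant and an integral formula, for the preceding one. The passage from [D r] uses absolute
    continuity, the others the mean value inequality. *)
Lemma piece_regular l u (D : nat -> R -> R) r : (0 < r)%N ->
  (forall j, (j.+1 < r)%N -> deriv_on l u (D j) (D j.+1)) ->
  abs_cont_on l u (D r.-1) ->
  {ae mu, forall x, inI l u x -> deriv_within l u (D r.-1) x (D r x)} ->
  bv_on l u (D r) ->
  (forall j, (j <= r)%N -> majorized l u (D j)) /\
  forall j, (j < r)%N -> forall x y, inI l u x -> inI l u y -> x <= y ->
    D j y - D j x = integ (clamp l u (D j.+1)) x y.
Proof.
move=> r0 dD acD aeD bvD.
have step j : (j < r)%N -> majorized l u (D j.+1) -> majorized l u (D j) /\
    forall x y, inI l u x -> inI l u y -> x <= y -> D j y - D j x = integ (clamp l u (D j.+1)) x y.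
  move=> jr [V [K [inc hV]]]; apply: (taylor_primitive inc hV) => x y xI yI xy.
  have /andP[lx _] := xI; have /andP[_ yu] := yI.
  have near t : x <= t <= y -> `|D j.+1 t - D j.+1 x| <= V y - V x.
    move=> /andP[xt ty].
    have tI : inI l u t by rewrite /inI (le_trans lx xt) (le_lt_trans ty yu).
    have := inc x t xI tI xt; have := inc t y tI yI ty; have := normr_ge0 (D j.+1 y - D j.+1 t); lra.
  have [jr'|jr'] := ltnP j.+1 r.
    exact: (deriv_taylor lx xy yu (dD j jr') near).
  have rj : r = j.+1 by lia.
  rewrite rj /= in acD aeD.
  exact: (abs_cont_taylor lx xy yu acD aeD near).
have maj j : (j <= r)%N -> majorized l u (D j).
  move=> jr; rewrite -(subKn jr); have : (r - j <= r)%N by lia.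
  elim: (r - j)%N => [_|i IH ir]; first by rewrite subn0; exact: bv_majorant.
  have [] // := @step (r - i.+1)%N; first by lia.
  by rewrite -subSn // subSS; apply: IH; lia.
by split=> // j jr; have [] := step j jr (maj j.+1 jr).
Qed.

End Pieces.

(** * Induction on the regularity *)

Section Polynomials.
Variable R : realType.
Implicit Types (p : {poly R}) (x y l u B : R).

Lemma poly_antiderivative p : exists P : {poly R}, P^`() = p /\ (size P <= (size p).+1)%N.
Proof.
exists (\poly_(i < (size p).+1) (p`_i.-1 / i%:R)); split; last exact: size_poly.
apply/polyP => i; rewrite coef_deriv coef_poly ltnS /=.
case: leqP => h; last by rewrite -[LHS]mulr_natr divfK // pnatr_eq0.
rewrite mul0rn nth_default //.
Qed.

Lemma poly_lipschitz p B : exists K, 0 <= K /\ forall x y, `|x| <= B -> `|y| <= B ->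
  `|p.[y] - p.[x]| <= K * `|y - x|.
Proof.
elim/poly_ind: p => [|p c [K [K0 h]]].
  by exists 0; split=> // x y _ _; rewrite !horner0 subrr normr0 mul0r.
have KB : 0 <= K * `|B| by rewrite mulr_ge0.
pose C := K * `|B| + `|p.[0]| + K * `|B|.
exists (K * `|B| + C).
split; first by have := normr_ge0 p.[0]; rewrite /C; lra.
move=> x y xB yB; rewrite !hornerMXaddC.
have BB : B <= `|B| := ler_norm B.
rewrite (_ : _ - _ = (p.[y] - p.[x]) * y + p.[x] * (y - x)); last by ring.
apply: (le_trans (ler_normD _ _)); rewrite [leRHS]mulrDl; apply: lerD.
  rewrite normrM mulrAC; apply: ler_pM => //; first exact: h.
  exact: le_trans yB BB.
rewrite normrM; apply: ler_wpM2r => //.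
have B0 : `|0 : R| <= B by rewrite normr0 (le_trans (normr_ge0 x)).
have := h 0 x B0 xB; rewrite subr0 => hx.
have h2 : K * `|x| <= K * `|B| by apply: ler_wpM2l => //; exact: le_trans xB BB.
rewrite (_ : p.[x] = (p.[x] - p.[0]) + p.[0]); last by ring.
by apply: (le_trans (ler_normD _ _)); rewrite /C; lra.
Qed.

Lemma poly_taylor p B : exists K, 0 <= K /\ forall x y, `|x| <= B -> `|y| <= B ->
  `|p.[y] - p.[x] - p^`().[x] * (y - x)| <= K * `|y - x| * `|y - x|.
Proof.
elim/poly_ind: p => [|p c [K [K0 h]]].
  by exists 0; split=> // x y _ _; rewrite deriv0 !horner0 mul0r !subrr normr0 !mul0r.
have [C [C0 hC]] := poly_lipschitz p B.
exists (K * `|B| + C); split; first by rewrite addr_ge0 // mulr_ge0.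
move=> x y xB yB; rewrite derivD derivM derivX derivC addr0 mulr1 !hornerMXaddC hornerD hornerMX.
rewrite (_ : _ - _ - _ = (p.[y] - p.[x] - p^`().[x] * (y - x)) * x + (y - x) * (p.[y] - p.[x])); last by ring.
apply: (le_trans (ler_normD _ _)).
rewrite (_ : (K * `|B| + C) * _ * _ = K * `|B| * `|y - x| * `|y - x| + C * `|y - x| * `|y - x|);
  last by ring.
apply: lerD; rewrite normrM.
  rewrite (_ : K * `|B| * _ * _ = K * `|y - x| * `|y - x| * `|B|); last by ring.
  by apply: ler_pM => //; [exact: h|exact: le_trans xB (ler_norm B)].
by rewrite mulrC; apply: ler_wpM2r => //; exact: hC.
Qed.

(** Lipschitz and Taylor bounds for polynomials are an instance of [integ_primitive] with a linear
    majorant. *)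
Lemma poly_integ p P (g : R -> R) l u : bounded_measurable g -> l <= u -> P^`() = p ->
  (forall t, l <= t -> t < u -> g t = p.[t]) -> integ g l u = P.[u] - P.[l].
Proof.
move=> bg lu Pp gp; pose B := Num.max `|l| `|u|.
have bB t : l <= t -> t <= u -> `|t| <= B.
  move=> lt tu; have := ler_norm u; have := lerNnormlW (lexx `|l|).
  by rewrite /B ler_norml le_max => h1 h2; apply/andP; split;
    [rewrite lerNl le_max; apply/orP; left; lra|apply/orP; right; lra].
have [K [K0 hK]] := poly_lipschitz p B; have [C [C0 hC]] := poly_taylor P B.
symmetry; apply: (@integ_primitive R (horner P) g (fun t => (K + C) * t)) => //.
- move=> x y lx xy yu; have yB := bB y (le_trans lx xy) yu; have xB := bB x lx (le_trans xy yu).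
  (* At the right end [g] is unspecified, but there the increment is trivial. *)
  have [xu|ux] := ltP x u; last first.
    have -> : y = x by apply/eqP; rewrite eq_le xy (le_trans yu).
    by rewrite !subrr !mulr0 subrr normr0.
  rewrite gp // -Pp; apply: (le_trans (hC x y xB yB)).
  rewrite ger0_norm ?subr_ge0 // -mulrBr; apply: ler_wpM2r; first by rewrite subr_ge0.
  by apply: ler_wpM2r; [rewrite subr_ge0|lra].
- move=> x t lx xt tu; rewrite !gp ?(le_trans lx xt) ?(le_lt_trans xt tu) //.
  have tB := bB t (le_trans lx xt) (ltW tu); have xB := bB x lx (le_trans xt (ltW tu)).
  apply: (le_trans (hK x t xB tB)); rewrite ger0_norm ?subr_ge0 // -mulrBr.
  by apply: ler_wpM2r; [rewrite subr_ge0|lra].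
by move=> x y _ xy _; apply: ler_wpM2l => //; rewrite addr_ge0.
Qed.

End Polynomials.

Section Primitive.
Variable R : realType.
Implicit Types (g : R -> R) (u x y : R).

Lemma lipschitz_cont u g : Defs.lipschitz_on 0 u g -> cont_on 0 u g.
Proof.
move=> [K h] x xI e e0; have K0 : 0 < `|K| + 1 by rewrite ltr_wpDl.
exists (e / (`|K| + 1)); split; first by rewrite divr_gt0.
move=> y yI yx; apply: (le_lt_trans (h y x yI xI)).
apply: (@le_lt_trans _ _ ((`|K| + 1) * `|y - x|)).
  by apply: ler_wpM2r => //; have := ler_norm K; lra.
by rewrite mulrC -ltr_pdivlMr.
Qed.

Lemma integ_deriv_on u g : bounded_measurable g -> cont_on 0 u g ->
  deriv_on 0 u (clamp 0 u (integ g 0)) g.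
Proof.
move=> bg cg x xI e e0; have e2 : 0 < e / 2 by lra.
have [d [d0 hd]] := cg x xI _ e2; exists d; split=> // z zI /andP[zx0 zx].
rewrite /clamp zI xI.
have near a b : 0 <= a -> a <= b -> b < u -> (forall t, a <= t -> t < b -> `|t - x| < d) ->
    `|integ g a b - g x * (b - a)| <= e / 2 * (b - a).
  move=> a0 ab bu ht; apply: integ_near => // t xt tb; apply: ltW; apply: hd; last exact: ht.
  by rewrite /inI (le_trans a0 xt) (lt_trans tb bu).
have zx' : z - x != 0 by rewrite -normr_gt0.
suff h : `|integ g 0 z - integ g 0 x - g x * (z - x)| <= e / 2 * `|z - x|.
  apply: (@le_lt_trans _ _ (e / 2)); last by lra.
  rewrite -(ler_pM2r zx0) -normrM (_ : ((integ g 0 z - integ g 0 x) / (z - x) - g x) * (z - x) = integ g 0 z - integ g 0 x - g x * (z - x)) //.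
  by field.
have /andP[x0 xu] := xI; have /andP[z0 zu] := zI.
have [xz|zx''] := leP x z.
  rewrite (integ_cat bg x0 xz) (_ : _ - _ - _ = integ g x z - g x * (z - x)); last by ring.
  rewrite [`|z - x|]ger0_norm ?subr_ge0 //.
  apply: near => // t xt tz; rewrite ger0_norm ?subr_ge0 //.
  by apply: le_lt_trans zx; rewrite ger0_norm ?subr_ge0 //; lra.
have zlex := ltW zx''.
rewrite (integ_cat bg z0 zlex) (_ : _ - _ - _ = - (integ g z x - g x * (x - z))); last by ring.
rewrite normrN [`|z - x|]distrC [`|x - z|]ger0_norm ?subr_ge0 //.
apply: near => // t zt tx; rewrite distrC ger0_norm ?subr_ge0 ?(ltW tx) //.
by apply: le_lt_trans zx; rewrite distrC ger0_norm ?subr_ge0 //; lra.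
Qed.

End Primitive.

Section Induction.
Variables (R : realType) (A : finType) (pi0 pi1 : A -> nat) (lam : A -> R).
Hypothesis cardA2 : (2 <= #|A|)%N.
Hypothesis adm : admissible pi0 pi1.
Hypothesis lam_gt0 : forall a, 0 < lam a.
Hypothesis roth : roth_type pi0 pi1 lam.
Notation P0 := (left_end pi0 lam).
Notation P1 := (left_end pi1 lam).
Notation tot := (lamstar lam).
Notation cl a g := (clamp (P0 a) (P0 a + lam a) g).

Let cb0 : comb_bij pi0. Proof. by have [] := adm. Qed.
Let cb1 : comb_bij pi1. Proof. by have [_ []] := adm. Qed.

(* f a j stands for the j-th derivative on the interval of a *)
Definition regular r (f : A -> nat -> R -> R) : Prop :=
  [/\ forall a j, (j < r)%N -> forall x y,
        inI (P0 a) (P0 a + lam a) x -> inI (P0 a) (P0 a + lam a) y -> x <= y ->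
        f a j y - f a j x = integ (cl a (f a j.+1)) x y,
      forall a j, (j <= r)%N -> majorized (P0 a) (P0 a + lam a) (f a j) &
      forall j, (1 <= j <= r)%N -> \sum_a integ (cl a (f a j)) (P0 a) (P0 a + lam a) = 0].

(** Stronger than the statement aimed at, to carry the induction: [Psi] must be integrable, and
    continuous for [2 <= r] so that its primitive is differentiable. The last clause is the
    mean-zero condition on the derivatives of [chi], each integral being written as an increment of
    the preceding derivative. *)
Definition solvable r (f : A -> nat -> R -> R) : Prop :=
  exists (p : A -> {poly R}) (Psi : R -> R),
  [/\ forall a, (size (p a) <= r)%N, bounded_measurable Psi,
      C_lip lam r Psi /\ ((2 <= r)%N -> cont_on 0 tot Psi),
      forall a x, inI (P0 a) (P0 a + lam a) x ->
        f a 0%N x = (p a).[x] + Psi (x - P0 a + P1 a) - Psi x &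
      forall j, (1 <= j)%N -> (j < r)%N ->
        \sum_a (((p a)^`(j.-1)).[P0 a + lam a] - ((p a)^`(j.-1)).[P0 a]) = 0].

Lemma regular_solvable1 f : regular 1 f -> solvable 1 f.
Proof.
move=> [D1 D2 D3].
have bm a : bounded_measurable (cl a (f a 1%N)) by apply: majorized_measurable; exact: D2.
have /choice[V /choice[K VK]] := fun a => D2 a 1%N (leqnn 1).
(* On the cell this is [f a 0]; the integral also supplies a value at the right end, which is not in
   the domain of [f]. *)
pose Phi a t := f a 0%N (P0 a) + integ (cl a (f a 1%N)) (P0 a) (P0 a + t).
pose phi a t := if t < lam a then f a 1%N (P0 a + t) else f a 1%N (P0 a).
(* At the right end [phi] is given its value at the left end, and [2 * K a] is large enough to pay
   for the jump. *)
pose U a t := if t < lam a then V a (P0 a + t) else 2 * K a.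
have inP a t : 0 <= t -> t < lam a -> inI (P0 a) (P0 a + lam a) (P0 a + t).
  by move=> t0 tl; rewrite /inI lerDl ltrD2l t0.
have inP0 a : inI (P0 a) (P0 a + lam a) (P0 a) by rewrite /inI lexx ltrDl /=.
have inc a x y : 0 <= x -> x <= y -> y <= lam a -> `|phi a y - phi a x| <= U a y - U a x.
  move=> x0 xy yl; have [hinc hV] := VK a; rewrite /phi /U.
  have [yl'|ly] := ltP y (lam a).
    rewrite (le_lt_trans xy yl'); apply: hinc; rewrite ?lerD2l ?inP ?(le_trans x0 xy) //.
    exact: le_lt_trans yl'.
  have [xl|lx] := ltP x (lam a); last by rewrite !subrr normr0.
  have h := hinc _ _ (inP0 a) (inP a x x0 xl); rewrite lerDl x0 in h.
  have /andP[? ?] := hV _ (inP0 a); have /andP[? ?] := hV _ (inP a x x0 xl).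
  by rewrite distrC; apply: (le_trans (h isT)); lra.
have tay a x y : 0 <= x -> x <= y -> y <= lam a ->
    `|Phi a y - Phi a x - phi a x * (y - x)| <= (U a y - U a x) * (y - x).
  move=> x0 xy yl; have [hinc hV] := VK a.
  have l1 : P0 a <= P0 a + x by rewrite lerDl.
  have l2 : P0 a + x <= P0 a + y by rewrite lerD2l.
  rewrite (_ : Phi a y - Phi a x = integ (cl a (f a 1%N)) (P0 a + x) (P0 a + y)); last first.
    by rewrite /Phi (integ_cat (bm a) l1 l2); ring.
  rewrite (_ : y - x = (P0 a + y) - (P0 a + x)); last by ring.
  apply: integ_near => // t xt ty.
  pose s := t - P0 a; have ts : t = P0 a + s by rewrite /s; ring.
  have xs : x <= s by rewrite /s; lra.
  have sy : s < y by rewrite /s; lra.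
  have sl := lt_le_trans sy yl; have s0 := le_trans x0 xs.
  rewrite ts /clamp inP //.
  have := inc a x s x0 xs (ltW sl); have := inc a s y s0 (ltW sy) yl.
  rewrite {3}/phi sl => h1 h2; apply: (le_trans h2).
  by have := normr_ge0 (phi a y - phi a s); lra.
have mean0 : \sum_a (Phi a (lam a) - Phi a 0) = 0.
  rewrite -[RHS](D3 1%N) //; apply: eq_bigr => a _; rewrite /Phi addr0.
  by rewrite (@integ_empty _ _ (P0 a) (P0 a)) //; ring.
have mPhi a : measurable_fun [set: R] (Phi a).
  have [_ [M hM]] := bm a.
  apply: (@lipschitz_measurable _ _ M) => x y.
  have := integ_lipschitz (P0 a) (bm a) hM (P0 a + x) (P0 a + y).
  rewrite (_ : P0 a + x - (P0 a + y) = x - y); last by ring.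
  by rewrite /Phi (_ : f a 0%N (P0 a) + integ _ _ _ - _ =
    integ (cl a (f a 1%N)) (P0 a) (P0 a + x) - integ (cl a (f a 1%N)) (P0 a) (P0 a + y)); last by ring.
have [chi [Psi [mPsi [M hM] ePsi]]] :=
  roth_cohomology cardA2 adm lam_gt0 roth inc tay mean0 mPhi.
exists (fun a => (chi a)%:P), Psi; split=> //.
- by move=> a; exact: size_polyC_leq1.
- by split=> //; exists M.
- by split=> //; rewrite /C_lip /=; exists M => x _.
- move=> a x xI; have /andP[px xp] := xI.
  have xl : 0 <= x - P0 a < lam a by apply/andP; split; lra.
  have := ePsi a _ xl; rewrite [P1 a + _]addrC [P0 a + (x - _)]addrC subrK /Phi.
  rewrite [P0 a + (x - _)]addrC subrK -(D1 a 0%N) // hornerC; lra.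
- by move=> j j1 j2; lia.
Qed.

(** The exchange is a translation on each interval, so with [Psi] a primitive of the solution [Psi1]
    for the derivative, [f - Psi o T + Psi] has the polynomial derivative [p1] on each interval.
    Integrating from 0 makes [Psi] continuous across the intervals; the constants that arise go into
    [chi]. *)
Lemma regular_solvableS r f : (1 <= r)%N ->
  (forall f, regular r f -> solvable r f) -> regular r.+1 f -> solvable r.+1 f.
Proof.
move=> r1 IH [D1 D2 D3].
have [|p1 [Psi1 [sp1 bm1 [lip1 cont1] eq1 sum1]]] := IH (fun a j => f a j.+1).
  split=> [a j jr|a j jr|j /andP[j1 jr]]; [exact: D1|exact: D2|by apply: D3].
have tot0 : 0 <= tot by apply: sumr_ge0 => a _; exact: ltW.
have [mPsi1 [M hM]] := bm1; have M0 : 0 <= M by apply: le_trans (hM 0).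
pose I := integ Psi1 0; pose Psi := clamp 0 tot I.
have Idiff x y : 0 <= x -> x <= y -> integ Psi1 x y = I y - I x.
  by move=> x0 xy; rewrite /I (integ_cat bm1 x0 xy); ring.
have Ilip := integ_lipschitz 0 bm1 hM.
have inc x y : inI 0 tot x -> inI 0 tot y -> x <= y -> `|I y - I x| <= M * (y - x).
  by move=> _ _ xy; apply: (le_trans (Ilip y x)); rewrite ger0_norm ?subr_ge0.
have bmPsi : bounded_measurable Psi.
  by apply: majorized_measurable; exact: lipschitz_majorized M0 inc.
have P00 a : 0 <= P0 a by exact: left_end_ge0.
have P10 a : 0 <= P1 a by exact: left_end_ge0.
have P0l a : P0 a + lam a <= tot by exact: left_end_le.
have P1l a : P1 a + lam a <= tot by exact: left_end_le.
have bmf a : bounded_measurable (cl a (f a 1%N)) by apply: majorized_measurable; exact: D2.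
pose g a t := cl a (f a 1%N) t - Psi1 (t + (P1 a - P0 a)) + Psi1 t.
have bms a : bounded_measurable (fun t => Psi1 (t + (P1 a - P0 a))).
  exact: bounded_measurable_shift.
have bmg a : bounded_measurable (g a).
  by apply: bounded_measurableD => //; exact: bounded_measurableB.
have gp a t : P0 a <= t -> t < P0 a + lam a -> g a t = (p1 a).[t].
  move=> lt tu; have tI : inI (P0 a) (P0 a + lam a) t by rewrite /inI lt.
  rewrite /g /clamp tI (eq1 a t tI) (_ : t - P0 a + P1 a = t + (P1 a - P0 a)); ring.
have /choice[AD hAD] := fun a => poly_antiderivative (p1 a).
have integ_g a x : P0 a <= x -> integ (g a) (P0 a) x =
    integ (cl a (f a 1%N)) (P0 a) x - (I (x - P0 a + P1 a) - I (P1 a)) + (I x - I (P0 a)).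
  move=> px; rewrite /g integD //; last exact: bounded_measurableB.
  rewrite integB // integ_shift // (Idiff (P0 a) x) //.
  have -> : P0 a + (P1 a - P0 a) = P1 a by ring.
  have -> : x + (P1 a - P0 a) = x - P0 a + P1 a by ring.
  by rewrite (Idiff (P1 a)) //; lra.
have AD_g a x : P0 a <= x -> x <= P0 a + lam a ->
    (AD a).[x] - (AD a).[P0 a] = integ (g a) (P0 a) x.
  move=> px xp; symmetry; apply: (poly_integ (bmg a) px (proj1 (hAD a))) => t lt tx.
  by apply: gp => //; exact: lt_le_trans xp.
(* The constant of integration, determined by the equation at the left end of the interval. *)
pose c a := f a 0%N (P0 a) - I (P1 a) + I (P0 a) - (AD a).[P0 a].
have inP0 a : inI (P0 a) (P0 a + lam a) (P0 a) by rewrite /inI lexx ltrDl /=.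
exists (fun a => AD a + (c a)%:P), Psi; split=> //.
- move=> a; apply: (leq_trans (size_polyD _ _)); rewrite geq_max.
  have [_ h] := hAD a; apply/andP; split; first by apply: (leq_trans h); rewrite ltnS.
  by apply: (leq_trans (size_polyC_leq1 _)).
- have lipPsi : Defs.lipschitz_on 0 tot Psi.
    by exists M => x y xI yI; rewrite /Psi /clamp xI yI; exact: Ilip.
  have contPsi := lipschitz_cont lipPsi.
  split=> //; rewrite /C_lip ltnS leqNgt r1 /=.
  have [r2|r2] := leqP r 1.
    have -> : (r.+1 - 2 = 0)%N by lia.
    by exists (fun=> Psi); split=> //; split=> // j; lia.
  have rE : (r.+1 - 2 = (r - 2).+1)%N by lia.
  move: lip1; rewrite /C_lip leqNgt r2 /= => -[D [hD0 [hD1 [hD2 hD3]]]].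
  exists (fun j => if j is j'.+1 then D j' else Psi); rewrite rE; split=> //; split=> //.
  move=> [|j] jr; last by apply: hD1; lia.
  move=> x xI; rewrite hD0 //; exact: (integ_deriv_on bm1 (cont1 r2) xI).
- move=> a x xI; have /andP[px xp] := xI.
  have TI : inI 0 tot (x - P0 a + P1 a) by rewrite /inI; have := P10 a; have := P1l a; lra.
  have xI' : inI 0 tot x by rewrite /inI; have := P00 a; have := P0l a; lra.
  rewrite /Psi /clamp TI xI' hornerD hornerC /c.
  have := AD_g a x px (ltW xp); rewrite integ_g // -(D1 a 0%N) //; lra.
(* For the first derivative the mean is computed from the equation: the integrals of [Psi1] over the
   image intervals and over the original ones both equal its integral over the whole interval. The
   higher derivatives are those of [p1]. *)
move=> [//|[|j]] _ jr.
  rewrite (eq_bigr (fun a => (AD a).[P0 a + lam a] - (AD a).[P0 a])); last first.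
    by move=> a _; rewrite /= !hornerD !hornerC; ring.
  under eq_bigr do rewrite AD_g ?lerDl ?(ltW (lam_gt0 _)) ?lexx // integ_g ?lerDl ?(ltW (lam_gt0 _)) //.
  rewrite big_split sumrB (D3 1%N) //=.
  rewrite (eq_bigr (fun a => integ Psi1 (P1 a) (P1 a + lam a))); last first.
    by move=> a _; rewrite Idiff ?lerDl ?(ltW (lam_gt0 _)) //; congr (I _ - _); ring.
  rewrite [X in _ + X](eq_bigr (fun a => integ Psi1 (P0 a) (P0 a + lam a))); last first.
    by move=> a _; rewrite Idiff ?lerDl ?(ltW (lam_gt0 _)).
  by rewrite !integ_left_ends // sub0r addNr.
rewrite -[RHS](sum1 j.+1) //; apply: eq_bigr => a _.
rewrite -[j.+2.-1]/(j.+1) -[j.+1.-1]/j derivSn derivD derivC addr0.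
by have [-> _] := hAD a.
Qed.

Lemma regular_solvable r f : (1 <= r)%N -> regular r f -> solvable r f.
Proof.
case: r => // r _; elim: r f => [|r IH] f; first exact: regular_solvable1.
by apply: regular_solvableS.
Qed.

End Induction.

(** * Regularity of polynomial pieces *)

Section PolynomialPieces.
Variable R : realType.
Implicit Types (p : {poly R}) (l u : R).

Lemma poly_piece p l u : exists K, [/\ 0 <= K,
  forall x y, inI l u x -> inI l u y -> `|p.[y] - p.[x]| <= K * `|y - x| &
  forall x y, inI l u x -> inI l u y ->
    `|p.[y] - p.[x] - p^`().[x] * (y - x)| <= K * `|y - x| * `|y - x|].
Proof.
pose B := Num.max `|l| `|u|.
have bB t : inI l u t -> `|t| <= B.
  move=> /andP[lt tu]; have := ler_norm u; have := lerNnormlW (lexx `|l|).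
  by rewrite /B ler_norml le_max => h1 h2; apply/andP; split;
    [rewrite lerNl le_max; apply/orP; left; lra|apply/orP; right; lra].
have [K [K0 hK]] := poly_lipschitz p B; have [C [C0 hC]] := poly_taylor p B.
exists (K + C); split; first exact: addr_ge0.
  move=> x y xI yI; apply: (le_trans (hK x y (bB x xI) (bB y yI))).
  by apply: ler_wpM2r => //; lra.
move=> x y xI yI; apply: (le_trans (hC x y (bB x xI) (bB y yI))).
by do 2! apply: ler_wpM2r => //; lra.
Qed.

Lemma poly_deriv_on p l u : deriv_on l u (horner p) (horner p^`()).
Proof.
have [K [K0 _ h]] := poly_piece p l u => x xI e e0.
have K1 : 0 < K + 1 by lra.
exists (e / (K + 1)); split; first by rewrite divr_gt0.
move=> z zI /andP[zx0 zx].
have zx' : z - x != 0 by rewrite -normr_gt0.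
apply: (@le_lt_trans _ _ (K * `|z - x|)).
  rewrite -(ler_pM2r zx0) -normrM.
  rewrite (_ : ((p.[z] - p.[x]) / (z - x) - p^`().[x]) * (z - x) =
    p.[z] - p.[x] - p^`().[x] * (z - x)); first exact: h.
  by field.
rewrite ltr_pdivlMr // in zx; apply: le_lt_trans zx.
by rewrite mulrC ler_wpM2l //; lra.
Qed.

Lemma poly_majorized p l u : majorized l u (horner p).
Proof.
have [K [K0 h _]] := poly_piece p l u; apply: (lipschitz_majorized K0) => x y xI yI xy.
by apply: (le_trans (h x y xI yI)); rewrite ger0_norm ?subr_ge0.
Qed.

Lemma poly_cont_on p l u : cont_on l u (horner p).
Proof.
have [K [K0 h _]] := poly_piece p l u => x xI e e0.
have K1 : 0 < K + 1 by lra.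
exists (e / (K + 1)); split; first by rewrite divr_gt0.
move=> y yI yx; apply: (le_lt_trans (h x y xI yI)).
rewrite ltr_pdivlMr // in yx; apply: le_lt_trans yx.
by rewrite mulrC ler_wpM2l //; lra.
Qed.

Lemma poly_abs_cont_on p l u : abs_cont_on l u (horner p).
Proof.
have [K [K0 h _]] := poly_piece p l u => e e0.
have K1 : 0 < K + 1 by lra.
exists (e / (K + 1)); split; first by rewrite divr_gt0.
move=> s sI _; rewrite ltr_pdivlMr // => hs.
apply: le_lt_trans hs; rewrite mulr_suml big_seq [leRHS]big_seq; apply: ler_sum => q qs.
have /andP[/andP[lq q12] qu] := allP sI q qs.
apply: le_trans (h q.1 q.2 _ _) _.
- by rewrite /inI lq (le_lt_trans q12).
- by rewrite /inI qu (le_trans lq).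
rewrite ger0_norm ?subr_ge0 // mulrC; apply: ler_wpM2l; first by rewrite subr_ge0.
by lra.
Qed.

Lemma poly_bv_on p l u : bv_on l u (horner p).
Proof.
have [V [K [inc hV]]] := poly_majorized p l u; exists `|K| => s sI ss.
case: s sI ss => [|z s] sI ss; first by rewrite big_ord0.
have nI i : (i <= size s)%N -> inI l u (nth 0 (z :: s) i).
  by move=> i_s; apply: (allP sI); rewrite mem_nth.
have ind i : (i <= size s)%N -> \sum_(j < i) `|p.[nth 0 (z :: s) j.+1] - p.[nth 0 (z :: s) j]|
    <= V (nth 0 (z :: s) i) - V z.
  elim: i => [_|i IH is_]; first by rewrite big_ord0 subrr.
  rewrite big_ord_recr /=.
  have le : nth 0 (z :: s) i <= nth 0 s i by exact: (pathP 0 ss).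
  have := inc _ _ (nI i (ltnW is_)) (nI i.+1 is_) le; have := IH (ltnW is_); rewrite /=; lra.
apply: (le_trans (ind (size s) (leqnn _))).
have /andP[? ?] := hV _ (nI (size s) (leqnn _)).
have /andP[? ?] : 0 <= V z <= K by exact: (hV _ (nI 0%N (leq0n _))).
by have := ler_norm K; lra.
Qed.

End PolynomialPieces.

Theorem mainTheorem8 (R : realType) (A : finType)
  (pi0 pi1 : A -> nat) (lam : A -> R) (r : nat) :
  (2 <= #|A|)%N ->
  admissible pi0 pi1 ->
  (forall a, 0 < lam a) ->
  roth_type pi0 pi1 lam ->
  (1 <= r)%N ->
  forall Phi : R -> R, BVr_star pi0 lam r Phi ->
  exists (chi Psi : R -> R),
    Gamma_star pi0 lam r chi /\ C_lip lam r Psi /\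
    forall x : R, inI 0 (lamstar lam) x ->
      Phi x = chi x + Psi (iem pi0 pi1 lam x) - Psi x.
Proof.
move=> cardA2 adm lam_gt0 roth r1 Phi [D [hD hI]].
have [cb0 [cb1 _]] := adm.
have reg a := piece_regular r1 (proj1 (proj2 (hD a)))
  (proj1 (proj2 (proj2 (proj2 (hD a))))) (proj1 (proj2 (proj2 (proj2 (proj2 (hD a))))))
  (proj2 (proj2 (proj2 (proj2 (proj2 (hD a)))))).
have regD : regular pi0 lam r D.
  split=> [a j jr|a j jr|j jr].
  - by have [_] := reg a; apply.
  - by have [h _] := reg a; exact: h.
  have /andP[_ jr'] := jr.
  have bm a : bounded_measurable (clamp (left_end pi0 lam a) (left_end pi0 lam a + lam a) (D a j)).
    by apply: majorized_measurable; have [h _] := reg a; exact: h.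
  have := hI j jr; rewrite /jl /jr.
  under eq_bigr do rewrite (integral_clamp (bm _)).
  by rewrite sumEFin => -[].
have [p [Psi [sp bm [lip _] eqD sum0]]] := regular_solvable cardA2 adm lam_gt0 roth r1 regD.
have iemx a x : inI (left_end pi0 lam a) (left_end pi0 lam a + lam a) x ->
    iem pi0 pi1 lam x = x - left_end pi0 lam a + left_end pi1 lam a.
  move=> /andP[px xp]; have tl : 0 <= x - left_end pi0 lam a < lam a by apply/andP; split; lra.
  have := iemE pi1 cb0 lam_gt0 tl; rewrite addrC subrK => ->; ring.
(* The equation thus holds by definition at every point; what remains is to identify this function
   with a polynomial on each interval. *)
pose chi x := Phi x - Psi (iem pi0 pi1 lam x) + Psi x.
have chip a x : inI (left_end pi0 lam a) (left_end pi0 lam a + lam a) x -> chi x = (p a).[x].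
  move=> xI; rewrite /chi (iemx a x xI); have [h _] := hD a.
  by rewrite -(h x xI) (eqD a x xI); ring.
exists chi, Psi; split; last by split=> // x _; rewrite /chi; ring.
split; first by move=> a; exists (p a); split=> // x; exact: chip.
exists (fun a j => horner ((p a)^`(j))); split.
  move=> a /=; split; first by move=> x xI; rewrite /= (chip a x xI).
  split; first by move=> j jr; exact: (poly_deriv_on ((p a)^`(j))).
  split; first exact: poly_cont_on.
  split; first exact: poly_abs_cont_on.
  split; last exact: poly_bv_on.
  by apply: aeW => x; rewrite -{2}(prednK r1); exact: (poly_deriv_on ((p a)^`(r.-1))).
move=> j /andP[j1 jr].
have bmp a : bounded_measurable (clamp (left_end pi0 lam a) (left_end pi0 lam a + lam a)
    (horner ((p a)^`(j)))) by apply: majorized_measurable; exact: poly_majorized.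
rewrite /jl /jr; under eq_bigr do rewrite (integral_clamp (bmp _)).
rewrite sumEFin; congr (_%:E).
(* Below order [r] the mean is an increment clause of [solvable]; at order [r] the derivative of a
   polynomial of degree less than [r] vanishes. *)
have [jr'|rj] := ltnP j r.
  rewrite -[RHS](sum0 j j1 jr'); apply: eq_bigr => a _.
  apply: (poly_integ (bmp a)); first by rewrite lerDl ltW.
    by rewrite -derivnS prednK.
  by move=> t lt tu; rewrite /clamp /inI lt tu.
apply: big1 => a _.
have -> : (p a)^`(j) = 0 by apply: derivn_poly0; exact: leq_trans rj.
rewrite (@integ_ext _ _ (fun=> 0)); last by move=> t _ _; rewrite /clamp horner0; case: ifP.
by rewrite integ_cst ?mul0r // lerDl ltW.
Qed.
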